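(* Let $\psi(x,z)$ denote the normalized Baker--Akhiezer function associated to the root system $R$ with multiplicities $m=\{m_\alpha\}$, and let $\psi^\vee(x,z)$ denote the normalized Baker--Akhiezer function associated to the dual system $R^\vee$ with multiplicities $m_{\alpha^\vee}=m_\alpha$. Then $\psi(x,z)=\psi^\vee(z,x)$.
   Context: $V=\mathbb R^n$ is a Euclidean space with scalar product $(\cdot,\cdot)$, extended complex-bilinearly to $V\otimes\mathbb C$; variables $x,z$ range over $V\otimes\mathbb C$. $R\subset V$ is a reduced irreducible root system of rank $n$, $R_+$ positive roots, $W$ the Weyl group, $\alpha^\vee=2\alpha/(\alpha,\alpha)$, $R^\vee=\{\alpha^\vee\}$ with positive part $R^\vee_+=\{\alpha^\vee:\alpha\in R_+\}$, $P^\vee=\{\pi\in V:(\pi,\alpha)\in\mathbb Z\ \forall\alpha\in R\}$. $q\in\mathbb C^\times$ is not a root of unity, $\log q$ is fixed, $q^a=e^{a\log q}$, $[a]=q^a-q^{-a}$. $m_\alpha\in\mathbb Z_{\ge0}$ are $W$-invariant. Put $\rho^\vee=\frac12\sum_{\alpha\in R_+}m_\alpha\alpha^\vee$ and $\mathcal N=\{\rho^\vee-\sum_{\alpha\in R_+}l_\alpha\alpha^\vee:0\le l_\alpha\le m_\alpha\}$. A Baker--Akhiezer function associated to $\{R,m\}$ is a function $\psi(x,z)=q^{2(x,z)}\sum_{\nu\in\mathcal N\cap P^\vee}\psi_\nu(x)q^{2(\nu,z)}$ such that for each $\alpha\in R$, $s=1,\dots,m_\alpha$: $\psi(x,z+\frac12s\alpha)=\psi(x,z-\frac12s\alpha)$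 whenever $q^{2(\alpha^\vee,z)}=1$. It exists and is unique up to a factor depending on $x$; the normalized one is the unique one with $$\psi_{\rho^\vee}(x)=\prod_{\alpha\in R_+}\prod_{j=1}^{m_\alpha}[j-(\alpha,x)] .$$ The same definition applied to $R^\vee$ (so that the roles of $\alpha$ and $\alpha^\vee$ are interchanged) gives $\psi^\vee$.
   Formalization: The coefficients ψ_ν(x) of both normalized Baker–Akhiezer functions are required to be continuous in x; without some regularity the normalization does not determine ψ at special x (e.g. n=1, m=1, q^{(α,x)}=q). *)

(* Defs.v *)
From HB Require Import structures.
From mathcomp Require Import all_boot all_order all_algebra finmap.
From mathcomp Require Import complex.
From mathcomp Require Import all_classical all_reals topology normedtype.
From mathcomp Require Import sequences exp trigo.

Set Implicit Arguments.
Unset Strict Implicit.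
Unset Printing Implicit Defensive.

Import Order.TTheory GRing.Theory Num.Theory.
Import numFieldNormedType.Exports.

Local Open Scope classical_set_scope.
Local Open Scope ring_scope.

(* Euclidean structure on V = K^n, given by the Gram matrix G of an arbitrary
   scalar product. Since [bil] makes sense over any ring, its complex-bilinear
   extension is [bil] for the same Gram matrix viewed over K[i]. *)
Definition bil (F : comNzRingType) (n : nat) (G : 'M[F]_n) (u v : 'rV[F]_n) : F :=
  (u *m G *m v^T) 0 0.

Definition scalar_product (K : realType) (n : nat) (G : 'M[K]_n) : Prop :=
  G^T = G /\ forall v : 'rV[K]_n, v != 0 -> 0 < bil G v v.

Definition complexify (K : realType) (m n : nat) (A : 'M[K]_(m, n)) :
    'M[K[i]]_(m, n) :=
  map_mx (fun t : K => t%:C%C) A.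

Definition cbil (K : realType) (n : nat) (G : 'M[K]_n) (x z : 'rV[K[i]]_n) : K[i] :=
  bil (complexify G) x z.

Section RootSystems.
Context (K : realType) (n : nat) (G : 'M[K]_n).
Implicit Types (R Rp : {fset 'rV[K]_n}) (m : 'rV[K]_n -> nat).

Definition coroot (a : 'rV[K]_n) : 'rV[K]_n := (2 / bil G a a) *: a.

Definition reflection (a v : 'rV[K]_n) : 'rV[K]_n := v - bil G v (coroot a) *: a.

Definition root_system R : Prop :=
  [/\ 0 \notin R,
      <<(R : seq 'rV[K]_n)>>%VS = fullv,
      forall a b, a \in R -> b \in R -> reflection a b \in R &
      forall a b, a \in R -> b \in R -> bil G b (coroot a) \is a Num.int].

Definition reduced R : Prop :=
  forall (a : 'rV[K]_n) (t : K), a \in R -> t *: a \in R -> t = 1 \/ t = -1.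

Definition irreducible_rs R : Prop :=
  R != fset0%fset /\
  forall A B : {fset 'rV[K]_n}, R = (A `|` B)%fset ->
    (forall a b, a \in A -> b \in B -> bil G a b = 0) ->
    A = fset0%fset \/ B = fset0%fset.

Definition positive_roots R Rp : Prop :=
  exists2 v : 'rV[K]_n,
    forall a, a \in R -> bil G v a != 0 &
    Rp = [fset a in R | 0 < bil G v a]%fset.

Definition weyl_group R (w : 'rV[K]_n -> 'rV[K]_n) : Prop :=
  exists2 s : seq 'rV[K]_n, {subset s <= R} & w = (fun v => foldr reflection v s).

Definition weyl_invariant R m : Prop :=
  forall w, weyl_group R w -> forall a, a \in R -> m (w a) = m a.

(* Applied to R it is R^\vee; applied to R_+ it is R^\vee_+. *)
Definition dual_roots R : {fset 'rV[K]_n} := [fset coroot a | a in R]%fset.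

Definition coweight_lattice R : set 'rV[K]_n :=
  [set p | forall a, a \in R -> bil G p a \is a Num.int].

Definition rho_vee Rp m : 'rV[K]_n :=
  2^-1 *: \sum_(a <- Rp) (m a)%:R *: coroot a.

(* The convex polytope \mathcal N: the l_alpha are real numbers. *)
Definition polytope Rp m : set 'rV[K]_n :=
  [set v | exists2 l : 'rV[K]_n -> K,
     forall a, a \in Rp -> 0 <= l a <= (m a)%:R &
     v = rho_vee Rp m - \sum_(a <- Rp) l a *: coroot a].

End RootSystems.

Definition cexp (K : realType) (w : K[i]) : K[i] :=
  let: (a +i* b)%C := w in ((expR a * cos b) +i* (expR a * sin b))%C.

(* q^a, for the fixed value logq of log q. *)
Definition qpow (K : realType) (logq a : K[i]) : K[i] := cexp (a * logq).

Definition qbracket (K : realType) (logq a : K[i]) : K[i] :=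
  qpow logq a - qpow logq (- a).

Section BakerAkhiezer.
Context (K : realType) (n : nat) (G : 'M[K]_n) (logq : K[i]).
Implicit Types (R Rp : {fset 'rV[K]_n}) (m : 'rV[K]_n -> nat).
Implicit Types (psi : 'rV[K[i]]_n -> 'rV[K[i]]_n -> K[i]).

(* The coefficients psi_nu(x) are given by [c nu x]. *)
Definition baker_akhiezer_with R Rp m
    (c : 'rV[K]_n -> 'rV[K[i]]_n -> K[i]) psi : Prop :=
  (forall x z, psi x z = qpow logq (2 * cbil G x z) *
     \sum_(nu \in polytope G Rp m `&` coweight_lattice G R)
        c nu x * qpow logq (2 * cbil G (complexify nu) z)) /\
  (forall a, a \in R -> forall s : nat, (1 <= s <= m a)%N ->
     forall x z, qpow logq (2 * cbil G (complexify (coroot G a)) z) = 1 ->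
       psi x (z + complexify ((s%:R / 2) *: a)) =
       psi x (z - complexify ((s%:R / 2) *: a))).

Definition normalization Rp m (x : 'rV[K[i]]_n) : K[i] :=
  \prod_(a <- Rp) \prod_(1 <= j < (m a).+1)
    qbracket logq (j%:R - cbil G (complexify a) x).

(* The coefficients are required to depend continuously on x. The linear
   conditions on psi(x, -) determine it up to a factor only for generic x: for
   n = 1, m = 1 and q^(alpha,x) = q they allow arbitrary multiples of
   q^(2(x,z) - (alpha^\vee,z)), while the prescribed leading coefficient is 0.
   Continuity (rather than analyticity) is all that is needed to make the
   normalized function unique for every x. *)
Definition normalized_baker_akhiezer R Rp m psi : Prop :=
  exists c : 'rV[K]_n -> 'rV[K[i]]_n -> K[i],
    [/\ baker_akhiezer_with R Rp m c psi,
        forall nu, (polytope G Rp m `&` coweight_lattice G R) nu ->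
          continuous (c nu : 'rV[K[i]^o]_n -> K[i]^o) &
        forall x, c (rho_vee G Rp m) x = normalization Rp m x].

End BakerAkhiezer.

(* Main.v *)
(** If a finite exponential sum with generically shifted exponents satisfies the
    conditions of [R], then every string of exponents in the direction [a^\vee] that
    carries a nonzero coefficient carries at least [m_a + 1] of them, so that in every
    direction [v] the exponents extend over at least [\sum_(a > 0) m_a |(v, a^\vee)|],
    which is the width of the polytope. Applied to the edges of the polytope, the
    conditions determine the coefficients on an edge from its end point; walking along
    edges gives the coefficients at all vertices. On the hyperplane [q^(2 (a, x)) = 1]
    the edge coefficients are symmetric, hence [psi(x + s a^\vee / 2, z) - psi(x - s
    a^\vee / 2, z)] has too small a width and vanishes: in the variable [x], [psi]
    satisfies the conditions of the dual system.

    The coefficients of [psi] are rational in exponentials, by solving the conditions,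
    and continuous, hence exponential sums. Their behaviour as [x] tends to infinity
    along [v] and [- v] bounds their exponents by the dual polytope, and identifies the
    top coefficient with the normalisation of [psi^\vee]. Therefore [psi(x, z) -
    psi^\vee(z, x)], as a function of [x], satisfies the dual conditions and has width
    smaller than that of the dual polytope, so it is zero. *)
Require Import Defs.
From mathcomp Require Import all_boot all_order all_algebra finmap.
From mathcomp Require Import complex.
From mathcomp Require Import all_classical all_reals topology normedtype.
From mathcomp Require Import sequences exp trigo.
From mathcomp Require Import archimedean ring lra.

Set Implicit Arguments.
Unset Strict Implicit.
Unset Printing Implicit Defensive.

Import Order.TTheory GRing.Theory Num.Theory.
Import numFieldNormedType.Exports.

Local Open Scope classical_set_scope.
Local Open Scope ring_scope.

(** * The complex exponential and continuous functions *)

Section ComplexExponential.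
Variable K : realType.
Implicit Types (a b t : K) (w z : K[i]).

(** The conditions are linear in the coefficients and rigid only for generic x. Vanishing is
    therefore proved off finitely many points of a real line x + (t / log q) w and carried to x by
    continuity; on such a line the functions q^(2 (mu, x)) become real exponentials, which separates
    exponents even if |q| = 1. The top coefficients are identified without computing the interior
    ones: the rescaled string conditions have a limit as x goes to infinity along v, the limit
    system has at most a one-dimensional solution space by the same width estimate, and the
    coefficients of the normalisation of psi^\vee, expanded in exponentials, solve it. The passage
    from rational to polynomial goes one coroot direction at a time: denominators cancel by
    continuity, and interpolation at integer points, with a number of nodes independent of the base
    point, combines the one-variable statements into one in all variables. *)

Lemma cexpD w z : cexp (w + z) = cexp w * cexp z.
Proof.
case: w => a b; case: z => c d; apply/eqP.
by rewrite eq_complex /= expRD cosD sinD; apply/andP; split; apply/eqP; ring.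
Qed.

Lemma cexp0 : cexp (0 : K[i]) = 1.
Proof. by apply/eqP; rewrite eq_complex /= expR0 cos0 sin0 mul1r mulr0 !eqxx. Qed.

Lemma cexp_neq0 w : cexp w != 0.
Proof.
apply/negP => /eqP e; have := oner_neq0 K[i].
by rewrite -cexp0 -{1}(subrr w) cexpD e mul0r eqxx.
Qed.

Lemma cexpN w : cexp (- w) = (cexp w)^-1.
Proof.
by apply: (mulfI (cexp_neq0 w)); rewrite -cexpD subrr cexp0 divff // cexp_neq0.
Qed.

Lemma cexp_real t : cexp t%:C%C = (expR t)%:C%C.
Proof. by apply/eqP; rewrite eq_complex /= cos0 sin0 mulr1 mulr0 !eqxx. Qed.

Lemma cexp_imag t : cexp (t *i)%C = (cos t +i* sin t)%C.
Proof. by apply/eqP; rewrite eq_complex /= expR0 !mul1r !eqxx. Qed.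

Lemma cexpMn w k : cexp (w *+ k) = cexp w ^+ k.
Proof. by elim: k => [|k IH]; rewrite ?cexp0 // mulrS cexpD IH exprS. Qed.

Lemma cexp_ipi : cexp (pi *i)%C = -1 :> K[i].
Proof. by rewrite cexp_imag cospi sinpi; apply/eqP; rewrite eq_complex /= oppr0 !eqxx. Qed.

(** Polar coordinates. It makes every nonzero root of a denominator a value of [qpow] in
    [laurent_quotient]. *)
Lemma cexp_surj w : w != 0 -> exists z, cexp z = w.
Proof.
case: w => a b w0.
set r := Num.sqrt (a ^+ 2 + b ^+ 2).
have r2 : r ^+ 2 = a ^+ 2 + b ^+ 2 by rewrite sqr_sqrtr // addr_ge0 ?sqr_ge0.
have r0 : 0 < r.
  rewrite sqrtr_gt0 lt_neqAle addr_ge0 ?sqr_ge0 // andbT eq_sym.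
  apply: contra w0; rewrite paddr_eq0 ?sqr_ge0 // !sqrf_eq0 => /andP[/eqP-> /eqP->].
  by rewrite eq_complex /= !eqxx.
have cs2 : (a / r) ^+ 2 + (b / r) ^+ 2 = 1.
  rewrite !expr_div_n -mulrDl -r2 divff // expf_neq0 // gt_eqF //.
have ar1 : -1 <= a / r <= 1.
  rewrite -ler_norml -(@ler_sqr _ `|_|) ?nnegrE // real_normK ?num_real // expr1n -cs2.
  by rewrite lerDl sqr_ge0.
(* [acos] only reaches [0, pi], so the sign of [b] selects the half plane. *)
pose th := if 0 <= b then acos (a / r) else - acos (a / r).
exists (ln r +i* th)%C.
have ct : cos th = a / r.
  by rewrite /th; case: ifP => _; rewrite ?cosN acosK // in_itv.
have st : sin th = b / r.
  have e : sin (acos (a / r)) = `|b / r|.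
    rewrite sin_acos // -cs2 addrC addKr sqrtr_sqr //.
  rewrite /th; case: ifP => b0; rewrite ?sinN e.
    by rewrite ger0_norm // divr_ge0 // ltW.
  by rewrite ltr0_norm ?opprK // pmulr_llt0 ?invr_gt0 // ltNge b0.
apply/eqP; rewrite eq_complex /= lnK ?posrE // ct st.
by rewrite !(mulrCA r) divff ?lt0r_neq0 ?mulr1 ?eqxx.
Qed.

Lemma cos2pi_eq1 t : cos (2 * pi * t) = 1 -> t \is a Num.int.
Proof.
move=> c1.
have pi0 := @pi_gt0 K.
(* [cos] is injective on [0, pi], which settles fractional parts up to 1/2; larger ones are
   reflected to [1 - s]. *)
have aux (s : K) : 0 <= s <= 2^-1 -> cos (2 * pi * s) = 1 -> s = 0.
  move=> /andP[s0 s1] e.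
  have h : 2 * pi * s = 0.
    apply: cos_inj; rewrite ?in_itv /= ?e ?cos0 ?lexx ?(ltW pi0) //.
    by apply/andP; split; nra.
  by move/eqP: h; rewrite !mulf_eq0 pnatr_eq0 (gt_eqF pi0) /= => /eqP.
pose s := t - (Num.floor t)%:~R.
have s01 : 0 <= s < 1.
  rewrite /s subr_ge0 ltrBlDr.
  by have /andP[h1 h2] := floor_itv t; rewrite h1 /= addrC -intrD1.
have cs : cos (2 * pi * s) = 1.
  have per k x : cos (x - 2 * pi * k%:R) = cos x :> K.
    elim: k => [|k IH]; first by rewrite mulr0 subr0.
    rewrite -IH -[in RHS](subrK (pi *+ 2) (x - 2 * pi * k%:R)) cosD2pi; congr cos.
    by rewrite -natr1; ring.
  rewrite /s; case: (Num.floor t) => k.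
    by rewrite mulrBr per.
  rewrite NegzE mulrNz -[LHS](per k.+1) -[RHS]c1; congr cos.
  by rewrite pmulrn; ring.
have : s = 0.
  case: (lerP s 2^-1) => h; first by apply: aux; rewrite // h; case/andP: s01 => ->.
  have := aux (1 - s).
  have -> : cos (2 * pi * (1 - s)) = 1.
    by rewrite -[RHS]cs -[RHS]cosN -[RHS]cosD2pi; congr cos; ring.
  move=> /(_ _ erefl) e.
  have : 1 - s = 0 by apply: e; apply/andP; split; case/andP: s01 => ? ?; lra.
  case/andP: s01 => ? ?; lra.
by move=> /eqP; rewrite subr_eq0 => /eqP ->; rewrite intr_int.
Qed.

Lemma cexp_2ipi_eq1 t : cexp ((2 * pi * t) *i)%C = 1 -> t \is a Num.int.
Proof. by rewrite cexp_imag => -[/cos2pi_eq1]. Qed.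

Lemma Re_continuous : continuous (fun z : K[i]^o => complex.Re (z : K[i]) : K^o).
Proof.
move=> z; apply/(@cvgrPdist_lt K K^o K[i]^o (nbhs z) _) => e e0.
have e0' : 0 < e%:C%C by rewrite ltcR.
have := @cvgr_dist_lt K[i] K[i]^o K[i]^o (nbhs z) (nbhs_filter z) id z cvg_id _ e0' => h.
apply: (@filterS _ (nbhs z) (nbhs_filter z) _ _ _ h) => w /=; rewrite -ltcR -raddfB.
exact: le_lt_trans (normc_ge_Re _).
Qed.

Lemma normc_ge_Im (w : K[i]) : `|complex.Im w|%:C%C <= `|w|.
Proof.
case: w => a b; rewrite normc_def /= lecR -sqrtr_sqr ler_wsqrtr //.
by rewrite lerDr sqr_ge0.
Qed.

Lemma Im_continuous : continuous (fun z : K[i]^o => complex.Im (z : K[i]) : K^o).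
Proof.
move=> z; apply/(@cvgrPdist_lt K K^o K[i]^o (nbhs z) _) => e e0.
have e0' : 0 < e%:C%C by rewrite ltcR.
have := @cvgr_dist_lt K[i] K[i]^o K[i]^o (nbhs z) (nbhs_filter z) id z cvg_id _ e0' => h.
apply: (@filterS _ (nbhs z) (nbhs_filter z) _ _ _ h) => w /=; rewrite -ltcR -raddfB.
exact: le_lt_trans (normc_ge_Im _).
Qed.

Lemma real_complex_continuous : continuous (fun t : K^o => t%:C%C : K[i]^o).
Proof.
move=> t; apply/(@cvgrPdist_lt K[i] K[i]^o K^o (nbhs t) _) => e e0.
have /complex_realP[r er] : e \is Num.real by rewrite gtr0_real.
have r0 : 0 < r by rewrite -ltcR -er.
have := @cvgr_dist_lt K K^o K^o (nbhs t) (nbhs_filter t) id t cvg_id _ r0 => h.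
apply: (@filterS _ (nbhs t) (nbhs_filter t) _ _ _ h) => s /=; rewrite er -raddfB normc_def /= expr0n addr0 sqrtr_sqr ltcR.
by [].
Qed.

Lemma cexp_continuous : continuous (fun z : K[i]^o => cexp (z : K[i]) : K[i]^o).
Proof.
have e : (fun z : K[i]^o => cexp (z : K[i]) : K[i]^o) = (fun z : K[i]^o =>
  ((expR (complex.Re (z : K[i])) * cos (complex.Im (z : K[i])))%:C%C : K[i]^o) +
  ('i%C : K[i]^o) * ((expR (complex.Re (z : K[i])) * sin (complex.Im (z : K[i])))%:C%C : K[i]^o)).
  by apply/funext => -[a b] /=; simpc.
rewrite e => z.
have cR := @continuous_comp _ _ _ _ (expR : K^o -> K^o) z (@Re_continuous z)
  (@continuous_expR K _).
have cI1 := @continuous_comp _ _ _ _ (cos : K^o -> K^o) z (@Im_continuous z)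
  (@continuous_cos K _).
have cI2 := @continuous_comp _ _ _ _ (sin : K^o -> K^o) z (@Im_continuous z)
  (@continuous_sin K _).
have c1 := @continuous_comp _ _ _ _ _ z (cvgM cR cI1) (@real_complex_continuous _).
have c2 := @continuous_comp _ _ _ _ _ z (cvgM cR cI2) (@real_complex_continuous _).
apply: (@cvgD K[i] K[i]^o K[i]^o (nbhs z) (nbhs_filter z)); first exact: c1.
apply: (@cvgM K[i] K[i]^o (nbhs z) (nbhs_filter z)); last exact: c2.
exact: cvg_cst.
Qed.

End ComplexExponential.

Lemma rV_continuous (K : realType) (n : nat) (T : topologicalType)
    (h : T -> 'rV[K[i]^o]_n) (t : T) :
  (forall i, {for t, continuous (fun s => h s 0 i : K[i]^o)}) ->
  {for t, continuous h}.
Proof.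
move=> hc A [P nP sPA].
have F : \forall s \near nbhs t, forall i : 'I_n, P 0 i (h s 0 i).
  apply: (@filter_forall _ _ _ (nbhs t) (nbhs_filter t)) => i.
  exact: (hc i _ (nP 0 i)).
apply: (@filterS _ (nbhs t) (nbhs_filter t) _ _ _ F) => s Ps; apply: sPA => i j.
by rewrite (ord1 i); exact: Ps.
Qed.

(* Wrapped in a record so that unification does not unfold the continuity. *)
Record ccont (K : realType) (n : nat) (f : 'rV[K[i]]_n -> K[i]) : Prop :=
  Ccont { ccontP : continuous (f : 'rV[K[i]^o]_n -> K[i]^o) }.

Section ContinuousFunctions.
Context (K : realType) (n : nat).
Implicit Types (f g : 'rV[K[i]]_n -> K[i]).

Lemma ccont_ext f g : ccont f -> f =1 g -> ccont g.
Proof. by move=> h /funext <-. Qed.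

Lemma ccont_cst (c : K[i]) : ccont (fun _ : 'rV[K[i]]_n => c).
Proof. by split=> x; exact: (@cvg_cst K[i]^o c _ (nbhs (x : 'rV[K[i]^o]_n)) (nbhs_filter _)). Qed.

Lemma ccont_coord i : ccont (fun x : 'rV[K[i]]_n => x 0 i).
Proof. split; exact: (@coord_continuous K[i] 1 n 0 i). Qed.

Lemma ccontD f g : ccont f -> ccont g -> ccont (fun x => f x + g x).
Proof.
move=> [cf] [cg]; split=> x.
exact: (@cvgD K[i] K[i]^o _ (nbhs (x : 'rV[K[i]^o]_n)) (nbhs_filter _) f g _ _ (cf x) (cg x)).
Qed.

Lemma ccontM f g : ccont f -> ccont g -> ccont (fun x => f x * g x).
Proof.
move=> [cf] [cg]; split=> x.
exact: (@cvgM K[i] _ (nbhs (x : 'rV[K[i]^o]_n)) (nbhs_filter _) f g _ _ (cf x) (cg x)).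
Qed.

Lemma ccontB f g : ccont f -> ccont g -> ccont (fun x => f x - g x).
Proof.
move=> cf cg; apply: (ccont_ext (f := fun x => f x + (-1) * g x)); last by move=> x; rewrite mulN1r.
by apply: ccontD => //; apply: ccontM => //; exact: ccont_cst.
Qed.

Lemma ccont_sum (I : Type) (r : seq I) (P : pred I) (F : I -> 'rV[K[i]]_n -> K[i]) :
  (forall i, P i -> ccont (F i)) -> ccont (fun x => \sum_(i <- r | P i) F i x).
Proof.
move=> h; elim: r => [|i r IH].
  by apply: (ccont_ext (ccont_cst 0)) => x; rewrite big_nil.
case Pi: (P i).
  by apply: (ccont_ext (ccontD (h i Pi) IH)) => x; rewrite big_cons Pi.
by apply: (ccont_ext IH) => x; rewrite big_cons Pi.
Qed.

Lemma ccont_prod (I : Type) (r : seq I) (P : pred I) (F : I -> 'rV[K[i]]_n -> K[i]) :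
  (forall i, P i -> ccont (F i)) -> ccont (fun x => \prod_(i <- r | P i) F i x).
Proof.
move=> h; elim: r => [|i r IH].
  by apply: (ccont_ext (ccont_cst 1)) => x; rewrite big_nil.
case Pi: (P i).
  by apply: (ccont_ext (ccontM (h i Pi) IH)) => x; rewrite big_cons Pi.
by apply: (ccont_ext IH) => x; rewrite big_cons Pi.
Qed.

Lemma ccont_comp (k : nat) (h : 'rV[K[i]]_k -> 'rV[K[i]]_n) f :
  (forall i, ccont (fun x => h x 0 i)) -> ccont f -> ccont (fun x => f (h x)).
Proof.
move=> hc [fc]; split=> x.
have ch : {for (x : 'rV[K[i]^o]_k), continuous (h : 'rV[K[i]^o]_k -> 'rV[K[i]^o]_n)}.
  by apply: rV_continuous => i; exact: (ccontP (hc i)).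
exact: (@continuous_comp _ _ _ (h : 'rV[K[i]^o]_k -> 'rV[K[i]^o]_n) (f : 'rV[K[i]^o]_n -> K[i]^o) x ch (fc _)).
Qed.

Lemma ccont_shift f y : ccont f -> ccont (fun x => f (x + y)).
Proof.
apply: ccont_comp => i; apply: (ccont_ext (ccontD (ccont_coord i) (ccont_cst (y 0 i)))).
by move=> x; rewrite mxE.
Qed.

Lemma ccont_cexp f : ccont f -> ccont (fun x => cexp (f x)).
Proof.
move=> [fc]; split=> x.
exact: (@continuous_comp _ _ _ (f : 'rV[K[i]^o]_n -> K[i]^o)
  (fun z : K[i]^o => cexp (z : K[i]) : K[i]^o) x (fc x) (@cexp_continuous _ _)).
Qed.

Lemma ccont_mulmx (B : 'cV[K[i]]_n) : ccont (fun x => (x *m B) 0 0).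
Proof.
have h : ccont (fun x => \sum_j x 0 j * B j 0).
  apply: ccont_sum => j _; apply: ccontM; first exact: ccont_coord.
  exact: ccont_cst.
by apply: (ccont_ext h) => x; rewrite mxE.
Qed.

Lemma avoid_finite (bad : seq K) (e : K) : 0 < e ->
  exists2 t, 0 < t < e & t \notin bad.
Proof.
move=> e0.
suff [d d0 [de h]] : exists2 d, 0 < d & d <= e /\ forall t, 0 < t < d -> t \notin bad.
  exists (d / 2); first by apply/andP; split; lra.
  by apply: h; apply/andP; split; lra.
elim: bad => [|b bad [d d0 [de IH]]]; first by exists e.
case: (lerP b 0) => b0.
  exists d => //; split=> // t /andP[t0 td]; rewrite inE negb_or IH ?t0 ?td // andbT.
  by rewrite gt_eqF // (le_lt_trans b0).
exists (Num.min b d); first by rewrite lt_min b0.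
split; first by rewrite ge_min de orbT.
move=> t /andP[t0]; rewrite lt_min => /andP[tb td].
by rewrite inE negb_or IH ?t0 ?td // andbT lt_eqF.
Qed.

(** Only the base point is concerned, and 0 may itself be excluded: a finite set leaves arbitrarily
    small positive parameters, at which continuity applies. *)
Lemma line_identity f (x w : 'rV[K[i]]_n) (bad : seq K) : ccont f ->
  (forall t : K, t \notin bad -> f (x + t%:C%C *: w) = 0) -> f x = 0.
Proof.
move=> [fc] h; apply/eqP/negPn/negP => fx0.
pose l (t : K^o) : 'rV[K[i]^o]_n := x + t%:C%C *: w.
have lc : {for (0 : K^o), continuous l}.
  apply: rV_continuous => i.
  have e : (fun s => l s 0 i : K[i]^o) =
           (fun s : K^o => x 0 i + (s%:C%C : K[i]^o) * (w 0 i)).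
    by apply/funext => s; rewrite !mxE.
  rewrite e.
  apply: (@cvgD K[i] K[i]^o _ (nbhs (0 : K^o)) (nbhs_filter _)); first exact: cvg_cst.
  apply: (@cvgM K[i] _ (nbhs (0 : K^o)) (nbhs_filter _)); last exact: cvg_cst.
  exact: real_complex_continuous.
have flc := @continuous_comp _ _ _ l (f : 'rV[K[i]^o]_n -> K[i]^o) 0 lc (fc _).
have l0 : l 0 = x by rewrite /l scale0r addr0.
have n0 : 0 < `|f x| by rewrite normr_gt0.
have := @cvgr_dist_lt K[i] K[i]^o _ (nbhs (0 : K^o)) (nbhs_filter _) _ _ flc _ n0.
move=> /nbhs_ballP[e /= e0 he].
have [t /andP[t0 te] tb] := avoid_finite bad e0.
have := he t; rewrite /= /ball /= sub0r normrN gtr0_norm // => /(_ te).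
by rewrite /= l0 [f (l t)]h // subr0 ltxx.
Qed.

End ContinuousFunctions.

Arguments ccont_cst {K n} c.
Arguments ccont_coord {K n} i.

(** * Width of unions of strings *)

Section Bilinear.
Context (F : comNzRingType) (n : nat) (G : 'M[F]_n).
Implicit Types (u v w : 'rV[F]_n) (t : F).

Lemma bilDl u v w : bil G (u + v) w = bil G u w + bil G v w.
Proof. by rewrite /bil !mulmxDl mxE. Qed.

Lemma bilDr u v w : bil G w (u + v) = bil G w u + bil G w v.
Proof. by rewrite /bil linearD /= mulmxDr mxE. Qed.

Lemma bilZl t u v : bil G (t *: u) v = t * bil G u v.
Proof. by rewrite /bil -!scalemxAl mxE. Qed.

Lemma bilZr t u v : bil G u (t *: v) = t * bil G u v.
Proof. by rewrite /bil linearZ /= -scalemxAr mxE. Qed.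

Lemma bilNl u v : bil G (- u) v = - bil G u v.
Proof. by rewrite -scaleN1r bilZl mulN1r. Qed.

Lemma bilNr u v : bil G u (- v) = - bil G u v.
Proof. by rewrite -scaleN1r bilZr mulN1r. Qed.

Lemma bilBl u v w : bil G (u - v) w = bil G u w - bil G v w.
Proof. by rewrite bilDl bilNl. Qed.

Lemma bilBr u v w : bil G w (u - v) = bil G w u - bil G w v.
Proof. by rewrite bilDr bilNr. Qed.

Lemma bil0l v : bil G 0 v = 0.
Proof. by rewrite -(scale0r 0) bilZl mul0r. Qed.

Lemma bil0r v : bil G v 0 = 0.
Proof. by rewrite -(scale0r 0) bilZr mul0r. Qed.

Lemma bil_suml (I : Type) (r : seq I) (P : pred I) (f : I -> 'rV[F]_n) v :
  bil G (\sum_(i <- r | P i) f i) v = \sum_(i <- r | P i) bil G (f i) v.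
Proof.
by elim/big_rec2: _ => [|i y x _ <-]; rewrite ?bil0l ?bilDl.
Qed.

Lemma bil_sumr (I : Type) (r : seq I) (P : pred I) (f : I -> 'rV[F]_n) v :
  bil G v (\sum_(i <- r | P i) f i) = \sum_(i <- r | P i) bil G v (f i).
Proof.
by elim/big_rec2: _ => [|i y x _ <-]; rewrite ?bil0r ?bilDr.
Qed.

Lemma bil_sym u v : G^T = G -> bil G u v = bil G v u.
Proof.
move=> hG; rewrite /bil.
have -> : (u *m G *m v^T) 0 0 = ((u *m G *m v^T)^T) 0 0 by rewrite [in RHS]mxE.
by rewrite !trmx_mul trmxK hG mulmxA.
Qed.

End Bilinear.

Lemma seq_argmax (K : realType) (T : eqType) (s : seq T) (f : T -> K) p0 : p0 \in s ->
  exists2 p, p \in s & forall p', p' \in s -> f p' <= f p.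
Proof.
elim: s p0 => [|a [|b s] IH] // p0 _.
  by exists a; rewrite ?mem_head // => p'; rewrite inE => /eqP->.
have [p ps hp] := IH b (mem_head _ _).
case: (lerP (f a) (f p)) => h.
  exists p; first by rewrite inE ps orbT.
  by move=> p'; rewrite inE => /orP[/eqP-> //|/hp].
exists a; first exact: mem_head.
move=> p'; rewrite inE => /orP[/eqP-> //|/hp h'].
exact: le_trans h' (ltW h).
Qed.

Section Euclidean.
Context (K : realType) (n : nat) (G : 'M[K]_n).
Hypothesis hG : scalar_product G.
Implicit Types (u v w a b : 'rV[K]_n) (L D S : seq 'rV[K]_n).

Lemma bilC u v : bil G u v = bil G v u.
Proof. by apply: bil_sym; case: hG. Qed.

Lemma bil_gt0 v : v != 0 -> 0 < bil G v v.
Proof. by case: hG => _; apply. Qed.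

Lemma bil_neq0 v : v != 0 -> bil G v v != 0.
Proof. by move=> /bil_gt0 /lt0r_neq0. Qed.

Lemma perturb L v w : exists2 e0 : K, 0 < e0 & forall e, 0 < e -> e <= e0 ->
  forall d, d \in L -> bil G v d != 0 -> Num.sg (bil G (v + e *: w) d) = Num.sg (bil G v d).
Proof.
elim: L => [|d L [e0 e00 IH]]; first by exists 1.
case: (eqVneq (bil G v d) 0) => [vd0|vd0].
  exists e0 => // e eg ele d'; rewrite inE => /orP[/eqP->|]; first by rewrite vd0 eqxx.
  exact: IH.
pose e1 := `|bil G v d| / (`|bil G w d| + 1).
have w1 : 0 < `|bil G w d| + 1 by rewrite ltr_wpDl.
have e10 : 0 < e1 by rewrite divr_gt0 // normr_gt0.
exists (Num.min e0 e1); first by rewrite lt_min e00.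
move=> e eg; rewrite le_min => /andP[ele0 ele1] d'; rewrite inE => /orP[/eqP->|]; last exact: IH.
move=> _; rewrite bilDl bilZl.
have lt : e * `|bil G w d| < `|bil G v d|.
  have : e * (`|bil G w d| + 1) <= `|bil G v d| by rewrite -ler_pdivlMr.
  by apply: lt_le_trans; rewrite mulrDr mulr1 ltrDl.
have : `|e * bil G w d| < `|bil G v d| by rewrite normrM gtr0_norm.
rewrite ltr_norml => /andP[].
case: (ltrgt0P (bil G v d)) vd0 => // s _.
  by move=> h1 h2; rewrite !gtr0_sg //; lra.
by move=> h1 h2; rewrite !ltr0_sg //; lra.
Qed.

Definition orth_proj a v := v - (bil G v a / bil G a a) *: a.

Lemma orth_projP a v : bil G (orth_proj a v) a = 0.
Proof.
rewrite /orth_proj bilBl bilZl; case: (eqVneq a 0) => [->|/bil_neq0 a0].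
  by rewrite !bil0r mulr0 subrr.
by rewrite divfK // subrr.
Qed.

Lemma bil_orth_proj a v : bil G (orth_proj a v) v = bil G (orth_proj a v) (orth_proj a v).
Proof. by rewrite {3}/orth_proj bilBr bilZr orth_projP mulr0 subr0. Qed.

(** A step along [orth_proj a d] keeps the product with [a] and changes the product with [d]; a
    small one keeps all signs obtained so far. With a root [a] it produces vectors on a single wall,
    with [a = 0] there is no constraint. *)
Lemma generic_near a v L D : (forall d, d \in D -> orth_proj a d != 0) ->
  exists v', [/\ bil G v' a = bil G v a,
    forall d, d \in L -> bil G v d != 0 -> Num.sg (bil G v' d) = Num.sg (bil G v d) &
    forall d, d \in D -> bil G v' d != 0].
Proof.
elim: D L => [|d D IH] L hD; first by exists v.
have [|v' [va vL vD]] := IH L; first by move=> d' d'D; apply: hD; rewrite inE d'D orbT.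
case: (eqVneq (bil G v' d) 0) => [v0|v0]; last first.
  by exists v'; split=> // d'; rewrite inE => /orP[/eqP->|/vD].
have [e0 e00 he] := perturb (L ++ D) v' (orth_proj a d).
have he' := he e0 e00 (lexx _).
exists (v' + e0 *: orth_proj a d); split.
- by rewrite bilDl bilZl orth_projP mulr0 addr0.
- move=> d' d'L vd'; rewrite he' ?vL // ?mem_cat ?d'L //.
  by rewrite -sgr_eq0 vL // sgr_eq0.
- move=> d'; rewrite inE => /orP[/eqP->|d'D].
    rewrite bilDl bilZl v0 add0r mulf_neq0 ?lt0r_neq0 // bil_orth_proj bil_gt0 //.
    by apply: hD; rewrite mem_head.
  by rewrite -sgr_eq0 he' ?sgr_eq0 ?vD // mem_cat d'D orbT.
Qed.

Lemma generic D : (forall d, d \in D -> d != 0) ->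
  exists v, forall d, d \in D -> bil G v d != 0.
Proof.
move=> hD; have [|v [_ _ h]] := @generic_near 0 0 [::] D; last by exists v.
by move=> d /hD; rewrite /orth_proj scaler0 subr0.
Qed.

(* For slopes sigma_b = (w, b) / (v, b) the set of maximisers of
   (w, .) - sigma_b (v, .) contains a string in direction b, and the v-intervals
   covered by these strings do not overlap, since a set of maximisers for a
   larger slope lies to the left of one for a smaller slope. *)
Lemma width_strings v (B : seq 'rV[K]_n) (m : 'rV[K]_n -> K) S p0 :
  uniq B -> p0 \in S ->
  (forall b c, b \in B -> c \in B -> b != c -> bil G v b != 0 ->
    bil G v b *: c - bil G v c *: b != 0) ->
  (forall b, b \in B -> 0 <= m b) ->
  (forall b p, b \in B -> p \in S -> exists t1 t2,
     [/\ p + t1 *: b \in S, p + t2 *: b \in S & m b <= t1 - t2]) ->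
  exists x y, [/\ x \in S, y \in S & \sum_(b <- B) m b * `|bil G v b| <= bil G v (x - y)].
Proof.
move=> uB p0S indep m0 hS.
pose B' := [seq b <- B | bil G v b != 0].
have BB' : \sum_(b <- B) m b * `|bil G v b| = \sum_(b <- B') m b * `|bil G v b|.
  rewrite big_filter [LHS](bigID (fun b => bil G v b != 0)) /= [X in _ + X]big1 ?addr0 //.
  by move=> b; rewrite negbK => /eqP->; rewrite normr0 mulr0.
rewrite BB'.
pose D := [seq bil G v bc.1 *: bc.2 - bil G v bc.2 *: bc.1 |
            bc <- [seq (b, c) | b <- B', c <- B'] & bc.1 != bc.2].
have [w hw] : exists w, forall d, d \in D -> bil G w d != 0.
  apply: generic => d /mapP[[b c]]; rewrite mem_filter /= => /andP[bc].
  move=> /allpairsP[[b' c'] [/= b'B c'B [eb ec]] ->] /=; subst b' c'.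
  by move: b'B c'B; rewrite !mem_filter => /andP[vb bB] /andP[vc cB]; exact: indep.
have {}hw b c : b \in B' -> c \in B' -> b != c -> bil G v b * bil G w c != bil G v c * bil G w b.
  move=> bB cB bc; rewrite -subr_eq0 -!bilZr -bilBr; apply: hw.
  apply/mapP; exists (b, c) => //; rewrite mem_filter /= bc.
  by apply/allpairsP; exists (b, c).
pose sg b := bil G w b / bil G v b.
pose u b := w - sg b *: v.
have ub b : b \in B' -> bil G (u b) b = 0.
  by rewrite mem_filter => /andP[vb _]; rewrite /u /sg bilBl bilZl divfK // subrr.
pose top b x := x \in S /\ forall p, p \in S -> bil G (u b) p <= bil G (u b) x.
have ends b : b \in B' -> exists xy : 'rV[K]_n * 'rV[K]_n,
    [/\ top b xy.1, top b xy.2 & m b * `|bil G v b| <= bil G v xy.1 - bil G v xy.2].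
  move=> bB'; have bB : b \in B by move: bB'; rewrite mem_filter => /andP[].
  have [p pS hp] := seq_argmax (bil G (u b)) p0S.
  have [t1 [t2 [t1S t2S t12]]] := hS b p bB pS.
  have tp t : p + t *: b \in S -> top b (p + t *: b).
    move=> tS; split=> // p' p'S; rewrite bilDr bilZr ub // mulr0 addr0; exact: hp.
  have md : 0 <= m b by exact: m0.
  case: (ger0P (bil G v b)) => vb.
    exists (p + t1 *: b, p + t2 *: b); split => /=; [exact: tp|exact: tp|].
    rewrite !bilDr !bilZr; nra.
  exists (p + t2 *: b, p + t1 *: b); split => /=; [exact: tp|exact: tp|].
  rewrite !bilDr !bilZr; nra.
(* Adding the two maximality inequalities gives [(sg b - sg c) * (v, y - x) >= 0]. *)
have order b c x y : sg c < sg b -> top b x -> top c y -> bil G v x <= bil G v y.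
  move=> bc [xS hx] [yS hy].
  have := hx y yS; have := hy x xS; rewrite /u !bilBl !bilZl => h1 h2.
  rewrite -subr_ge0 -(@pmulr_rge0 _ (sg b - sg c)) ?subr_gt0 //; nra.
pose r b c := sg c <= sg b.
have tr : transitive r by move=> y x z; rewrite /r => h1 h2; exact: le_trans h2 h1.
have tot : total r by move=> x y; rewrite /r orbC le_total.
(* Slopes decrease along the list, so the covered intervals follow one another to the right and
   their lengths add up. *)
have main l b : path r b l -> uniq (b :: l) -> {subset b :: l <= B'} ->
    forall y, top b y -> (exists2 x, top b x & m b * `|bil G v b| <= bil G v x - bil G v y) ->
    exists2 x, x \in S & \sum_(c <- b :: l) m c * `|bil G v c| <= bil G v x - bil G v y.
  elim: l b => [|c l IH] b pl ul sl y ty [x tx hx].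
    by exists x; [case: tx|rewrite big_seq1].
  have cB' : c \in B' by apply: sl; rewrite !inE eqxx orbT.
  have bB' : b \in B' by apply: sl; rewrite mem_head.
  have [[x' y'] [/= tx' ty' hxy']] := ends c cB'.
  move: pl => /= /andP[rbc pl]; move: ul; rewrite cons_uniq => /andP[bcl ul].
  have [||x'' x''S hx''] := IH c pl ul _ y' ty'; first by move=> d dl; apply: sl; rewrite inE dl orbT.
    by exists x'.
  exists x'' => //; rewrite big_cons.
  have sbc : sg c < sg b.
    rewrite lt_neqAle; apply/andP; split=> //.
    have := cB'; have := bB'; rewrite !mem_filter => /andP[vb bB] /andP[vc cB].
    have /(hw b c bB' cB') : b != c by apply: contraNneq bcl => ->; rewrite mem_head.
    apply: contra => /eqP; rewrite /sg => e; rewrite -(divfK vc (bil G w c)) e.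
    by rewrite mulrA (mulrC (bil G v b)) divfK // mulrC.
  have := order _ _ _ _ sbc tx ty'; lra.
case E: (sort r B') (introT permPl (perm_sort r B')) (sort_sorted tot B') => [|b l] pm so.
  have /perm_size/esym/size0nil -> := pm.
  by exists p0, p0; rewrite big_nil subrr bil0r.
have bB' : b \in B' by rewrite -(perm_mem pm) mem_head.
have [[x y] [/= tx ty hxy]] := ends b bB'.
have [|||x' x'S h] := main l b so _ _ y ty.
- by rewrite (perm_uniq pm) filter_uniq.
- by move=> c; rewrite (perm_mem pm).
- by exists x.
exists x', y; split=> //; first by case: ty.
by rewrite bilBr -(perm_big _ pm).
Qed.

End Euclidean.

(** * Exponential sums and string conditions *)

Section ExponentialSums.
Variable K : realType.

Lemma sum_horner (I : Type) (r : seq I) (a Y : I -> K[i]) (m : nat) (p : {poly K[i]}) :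
  (forall k, (k < m)%N -> \sum_(i <- r) a i * Y i ^+ k = 0) -> (size p <= m)%N ->
  \sum_(i <- r) a i * p.[Y i] = 0.
Proof.
move=> h sp.
under eq_bigr do rewrite (horner_coef_wide _ sp) mulr_sumr.
rewrite exchange_big big1 //= => k _.
under eq_bigr do rewrite mulrCA.
by rewrite -mulr_sumr h // mulr0.
Qed.

(** Natural numbers [t] suffice: they give the power moments at the nodes exp(l_i), and a polynomial
    vanishing at every node but exp(l0) isolates one exponent. *)
Lemma expR_sum_eq0 (I : eqType) (r : seq I) (a : I -> K[i]) (l : I -> K) (l0 : K) :
  (forall t : K, \sum_(i <- r) a i * (expR (t * l i))%:C%C = 0) ->
  \sum_(i <- r | l i == l0) a i = 0.
Proof.
move=> h.
pose Y i := (expR (l i))%:C%C : K[i].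
pose y0 := (expR l0)%:C%C : K[i].
pose p := \prod_(y <- [seq Y i | i <- r] | y != y0) ('X - y%:P).
have hp : \sum_(i <- r) a i * p.[Y i] = 0.
  apply: (@sum_horner _ _ _ _ (size p)) => // k _; rewrite -[RHS](h k%:R).
  by apply: eq_bigr => i _; rewrite /Y -rmorphXn /= -expRM_natl.
have py0 : p.[y0] != 0.
  rewrite horner_prod prodf_seq_neq0; apply/allP => y _; apply/implyP => yy.
  by rewrite hornerXsubC subr_eq0 eq_sym.
apply: (mulIf py0); rewrite mul0r -[RHS]hp mulr_suml [in RHS](bigID (fun i => l i == l0)) /=.
rewrite [X in _ = _ + X]big1_seq ?addr0; last first.
  move=> i /andP[li ir]; rewrite horner_prod (_ : \prod_(_ <- _ | _) _ = 0) ?mulr0 //.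
  apply/eqP; rewrite prodf_seq_eq0; apply/hasP; exists (Y i); first exact: map_f.
  rewrite hornerXsubC subrr eqxx andbT.
  by apply: contra li => /eqP /complexI /expR_inj ->.
by apply: eq_bigr => i /eqP li; rewrite /Y li.
Qed.


(** Vandermonde independence: with at most [m] nonzero coefficients, the polynomial vanishing at the
    nodes of all of them except [i0] would have degree below [m] and a nonzero pairing. *)
Lemma count_support (I : eqType) (r : seq I) (a b Y : I -> K[i]) (m : nat) i0 :
  uniq r -> {in r &, injective Y} -> (forall i, i \in r -> b i != 0) ->
  (forall p : {poly K[i]}, (size p <= m)%N -> \sum_(i <- r) a i * b i * p.[Y i] = 0) ->
  i0 \in r -> a i0 != 0 -> (m < size [seq i <- r | (a i != 0)%R])%N.
Proof.
move=> ur inj b0 h i0r ai0; rewrite ltnNge; apply/negP => sm.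
pose r' := [seq i <- r | a i != 0].
pose p := \prod_(i <- rem i0 r') ('X - (Y i)%:P).
have i0r' : i0 \in r' by rewrite mem_filter ai0.
have sp : (size p <= m)%N.
  rewrite size_prod_XsubC size_rem // prednK //.
  by move: i0r'; case: (r').
have := h p sp; rewrite (bigD1_seq i0) //= big1_seq ?addr0.
  move=> /eqP; rewrite !mulf_eq0 (negPf ai0) (negPf (b0 _ i0r)) /= horner_prod prodf_seq_eq0.
  move=> /hasP[j]; rewrite mem_rem_uniq ?filter_uniq // !inE mem_filter => /and3P[ji _ jr].
  rewrite hornerXsubC subr_eq0 => /eqP /inj e; move: ji; rewrite e ?eqxx //.
move=> i /andP[ii0 ir]; case: (eqVneq (a i) 0) => [->|ai]; first by rewrite !mul0r.
rewrite horner_prod (_ : \prod_(_ <- _) _ = 0) ?mulr0 //.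
apply/eqP; rewrite prodf_seq_eq0; apply/hasP; exists i.
  by rewrite mem_rem_uniq ?filter_uniq // !inE ii0 mem_filter ai.
by rewrite hornerXsubC subrr eqxx.
Qed.

(** Pigeonhole between the smallest and the largest element. *)
Lemma spread_ints (r : seq int) (m : nat) : uniq r -> (m < size r)%N ->
  exists i j, [/\ i \in r, j \in r & m%:Z <= i - j].
Proof.
move=> ur sr.
have [i0 i0r] : exists i, i \in r by case: (r) sr => // i r' _; exists i; rewrite mem_head.
have h (f : int -> int) : exists2 i, i \in r & forall j, j \in r -> f j <= f i.
  elim: (r) i0 i0r {ur sr} => [|a [|b s] IH] // i0 _.
    by exists a; rewrite ?mem_head // => p'; rewrite inE => /eqP->.
  have [p ps hp] := IH b (mem_head _ _).
  case: (lerP (f a) (f p)) => e.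
    exists p; first by rewrite inE ps orbT.
    by move=> p'; rewrite inE => /orP[/eqP-> //|/hp].
  exists a; first exact: mem_head.
  by move=> p'; rewrite inE => /orP[/eqP-> //|/hp h']; exact: le_trans h' (ltW e).
have [i ir hi] := h id; have [j jr hj] := h -%R.
exists i, j; split => //; rewrite leNgt; apply/negP => lt.
have sub : {subset r <= [seq j + k%:Z | k <- iota 0 m]}.
  move=> k kr; apply/mapP; have := hi k kr; have := hj k kr; rewrite lerN2 => h1 h2.
  exists `|k - j|%N; last by rewrite gez0_abs ?subr_ge0 //; ring.
  rewrite mem_iota add0n /= -ltz_nat gez0_abs ?subr_ge0 //.
  by apply: le_lt_trans lt; rewrite lerB.
have := uniq_leq_size ur sub; rewrite size_map size_iota leqNgt sr //.
Qed.

End ExponentialSums.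

(** * Powers and brackets of q *)

Section Qpow.
Context (K : realType) (logq : K[i]).
Local Notation qp := (qpow logq).
Local Notation br := (qbracket logq).
Implicit Types (a b u : K[i]).

Lemma qpowD a b : qp (a + b) = qp a * qp b.
Proof. by rewrite /qpow mulrDl cexpD. Qed.

Lemma qpow0 : qp 0 = 1.
Proof. by rewrite /qpow mul0r cexp0. Qed.

Lemma qpow_neq0 a : qp a != 0.
Proof. exact: cexp_neq0. Qed.

Lemma qpowN a : qp (- a) = (qp a)^-1.
Proof. by rewrite /qpow mulNr cexpN. Qed.

Lemma qpowMn a k : qp (a *+ k) = qp a ^+ k.
Proof. by rewrite /qpow -cexpMn mulrnAl. Qed.

Lemma qpow_nat k : qp k%:R = cexp logq ^+ k.
Proof. by rewrite -cexpMn /qpow mulr_natl. Qed.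

Lemma qbracketN a : br (- a) = - br a.
Proof. by rewrite /qbracket opprK opprB. Qed.

Lemma qbracket0 : br 0 = 0.
Proof. by rewrite /qbracket oppr0 subrr. Qed.

Lemma qbracket_eq0 a : (br a == 0) = (qp (2 * a) == 1).
Proof.
rewrite /qbracket subr_eq0 -(inj_eq (mulfI (qpow_neq0 a))) -!qpowD subrr qpow0.
by rewrite mulr2n mulrDl mul1r.
Qed.

(** The companion 2 cos of the bracket 2i sin: [[s u]] is [[u]] times a polynomial of degree [s - 1]
    in [qtrace u], as for Chebyshev polynomials of the second kind. *)
Definition qtrace u := qp u + qp (- u).

Lemma qbracketM_qtrace a b : br a * qtrace b = br (a + b) + br (a - b).
Proof.
rewrite /qbracket /qtrace !opprD opprK !qpowD; ring.
Qed.

Lemma qtraceB a b : qtrace a - qtrace b = br ((a + b) / 2) * br ((a - b) / 2).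
Proof.
rewrite /qbracket /qtrace mulrBl !mulrBr -!qpowD.
have -> : (a + b) / 2 + (a - b) / 2 = a by field.
have -> : (a + b) / 2 - (a - b) / 2 = b by field.
have -> : - ((a + b) / 2) + (a - b) / 2 = - b by field.
have -> : - ((a + b) / 2) - (a - b) / 2 = - a by field.
by ring.
Qed.

(** The product-to-sum formula trades a factor [qtrace] for shifts of [s] by one in both directions,
    so the [m] bracket conditions give all polynomial moments of degree below [m]. *)
Lemma qbracket_sum_horner (I : Type) (r : seq I) (a u : I -> K[i]) (m : nat) (p : {poly K[i]}) :
  (forall s, (1 <= s <= m)%N -> \sum_(i <- r) a i * br (s%:R * u i) = 0) ->
  (size p <= m)%N -> \sum_(i <- r) a i * br (u i) * p.[qtrace (u i)] = 0.
Proof.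
move=> h; apply: sum_horner.
have {}h k s : (1 <= s)%N -> (s + k <= m)%N ->
    \sum_(i <- r) a i * br (s%:R * u i) * qtrace (u i) ^+ k = 0.
  elim: k s => [|k IH] s s1 sk.
    by under eq_bigr do rewrite expr0 mulr1; rewrite h // s1 -(addn0 s).
  have e i : a i * br (s%:R * u i) * qtrace (u i) ^+ k.+1 =
      a i * br (s.+1%:R * u i) * qtrace (u i) ^+ k + a i * br (s.-1%:R * u i) * qtrace (u i) ^+ k.
    rewrite exprS mulrA -(mulrA (a i)) qbracketM_qtrace mulrDr mulrDl.
    have -> : s%:R * u i + u i = s.+1%:R * u i by rewrite -natr1; ring.
    have -> // : s%:R * u i - u i = s.-1%:R * u i.
    by rewrite -{1}(prednK s1) -natr1; ring.
  under eq_bigr do rewrite e; rewrite big_split /= IH ?add0r //; last by rewrite addSnnS.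
  (* For [s = 1] the downward shift ends at [[0] = 0]. *)
  case: s s1 sk {e} => // -[|s] _ sk /=; last by rewrite IH // (leq_trans _ sk) // addnS !addSn leqW.
  by rewrite big1 // => i _; rewrite mul0r qbracket0 mulr0 mul0r.
move=> k km; rewrite -[RHS](h k 1%N) //; apply: eq_bigr => i _; by rewrite mul1r.
Qed.

Hypothesis hq : forall k : nat, (0 < k)%N -> cexp logq ^+ k != 1.

Lemma logq_neq0 : logq != 0.
Proof. by apply: contra (hq (ltn0Sn 0)) => /eqP->; rewrite expr1 cexp0. Qed.

Lemma qpow_int_eq1 (k : int) : (qp k%:~R == 1) = (k == 0).
Proof.
case: k => [[|k]|k]; first by rewrite qpow0 !eqxx.
  by rewrite -pmulrn qpow_nat (negPf (hq _)).
by rewrite NegzE mulrNz qpowN -pmulrn qpow_nat invr_eq1 (negPf (hq _)).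
Qed.

End Qpow.

Section Complexify.
Context (K : realType) (n : nat).
Implicit Types (u v : 'rV[K]_n) (t : K).
Local Notation cx := (@complexify K 1 n).

Lemma complexifyD u v : cx (u + v) = cx u + cx v.
Proof. by rewrite /complexify map_mxD. Qed.

Lemma complexifyB u v : cx (u - v) = cx u - cx v.
Proof. by rewrite /complexify map_mxB. Qed.

Lemma complexifyN u : cx (- u) = - cx u.
Proof. by rewrite /complexify map_mxN. Qed.

Lemma complexifyZ t u : cx (t *: u) = t%:C%C *: cx u.
Proof. by rewrite /complexify map_mxZ. Qed.

Lemma complexify0 : cx 0 = 0.
Proof. by rewrite /complexify map_mx0. Qed.

Lemma complexify_sum (I : Type) (r : seq I) (P : pred I) (f : I -> 'rV[K]_n) :
  cx (\sum_(i <- r | P i) f i) = \sum_(i <- r | P i) cx (f i).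
Proof.
by elim/big_rec2: _ => [|i y x _ <-]; rewrite ?complexify0 ?complexifyD.
Qed.

End Complexify.

(** * Strings of exponents and the width of quasi-invariant functions *)

Section StringConditions.
Context (K : realType) (n : nat) (G : 'M[K]_n) (logq : K[i]).
Hypothesis hG : scalar_product G.
Hypothesis hq : forall k : nat, (0 < k)%N -> cexp logq ^+ k != 1.
Implicit Types (u v w nu a b : 'rV[K]_n) (x y z : 'rV[K[i]]_n) (S : seq 'rV[K]_n).
Local Notation cx := (@complexify K 1 n).
Local Notation qp := (qpow logq).
Local Notation br := (qbracket logq).
Local Notation cv := (coroot G).

Lemma cbil_complexify u v : cbil G (cx u) (cx v) = (bil G u v)%:C%C.
Proof.
by rewrite /cbil /bil /complexify -map_mxM matrix.map_trmx -map_mxM mxE.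
Qed.

Lemma cbilC x y : cbil G x y = cbil G y x.
Proof.
apply: bil_sym; by rewrite /complexify matrix.map_trmx; case: hG => ->.
Qed.

Lemma cbilDl x y z : cbil G (x + y) z = cbil G x z + cbil G y z.
Proof. exact: bilDl. Qed.
Lemma cbilDr x y z : cbil G z (x + y) = cbil G z x + cbil G z y.
Proof. exact: bilDr. Qed.
Lemma cbilBl x y z : cbil G (x - y) z = cbil G x z - cbil G y z.
Proof. exact: bilBl. Qed.
Lemma cbilBr x y z : cbil G z (x - y) = cbil G z x - cbil G z y.
Proof. exact: bilBr. Qed.
Lemma cbilZl t x z : cbil G (t *: x) z = t * cbil G x z.
Proof. exact: bilZl. Qed.
Lemma cbilZr t x z : cbil G z (t *: x) = t * cbil G z x.
Proof. exact: bilZr. Qed.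

Definition EE y z := qp (2 * cbil G y z).

Lemma EEDl x y z : EE (x + y) z = EE x z * EE y z.
Proof. by rewrite /EE cbilDl mulrDr qpowD. Qed.
Lemma EEDr x y z : EE z (x + y) = EE z x * EE z y.
Proof. by rewrite /EE cbilDr mulrDr qpowD. Qed.
Lemma EEC x y : EE x y = EE y x.
Proof. by rewrite /EE cbilC. Qed.
Lemma EE_neq0 x y : EE x y != 0.
Proof. exact: qpow_neq0. Qed.
Lemma EE0l x : EE 0 x = 1.
Proof. by rewrite /EE /cbil bil0l mulr0 qpow0. Qed.

(** Division by [logq] turns powers of q into real exponentials, whatever the modulus of q; limits
    and genericity are taken along these lines. *)
Lemma EE_line u w t : EE (cx u) ((t%:C%C / logq) *: cx w) = (expR (t * (2 * bil G u w)))%:C%C.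
Proof.
rewrite /EE cbilZr cbil_complexify -cexp_real /qpow; congr cexp.
rewrite !rmorphM /= rmorph_nat; field.
exact: logq_neq0 hq.
Qed.

Lemma coroot_neq0 a : a != 0 -> cv a != 0.
Proof.
move=> a0; rewrite /coroot scaler_eq0 negb_or a0 andbT mulf_neq0 ?pnatr_eq0 //.
by rewrite invr_eq0 bil_neq0.
Qed.

Lemma bil_coroot_self a : a != 0 -> bil G (cv a) a = 2.
Proof. by move=> a0; rewrite /coroot bilZl divfK // bil_neq0. Qed.

Lemma corootK a : cv (cv a) = a.
Proof.
case: (eqVneq a 0) => [->|a0]; first by rewrite /coroot !scaler0.
rewrite {1}/coroot /coroot !bilZl !bilZr scalerA.
rewrite -[RHS]scale1r; congr (_ *: _).
by field; exact: bil_neq0.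
Qed.

Lemma bil_coroot_eq0 u a : a != 0 -> (bil G u (cv a) == 0) = (bil G u a == 0).
Proof.
move=> a0; rewrite /coroot bilZr mulf_eq0 mulf_eq0 pnatr_eq0 invr_eq0.
by rewrite (negPf (bil_neq0 hG a0)).
Qed.

(** Boolean, so that it can select the terms of a finite sum. *)
Definition inZ b d : bool := `[< exists k : int, d = k%:~R *: b >].

Definition quasi_invariant a (m : nat) (f : 'rV[K[i]]_n -> K[i]) := forall s : nat,
  (1 <= s <= m)%N -> forall z, qp (2 * cbil G (cx (cv a)) z) = 1 ->
    f (z + cx ((s%:R / 2) *: a)) = f (z - cx ((s%:R / 2) *: a)).

(* The hypothesis is only used on (a^vee, z) = k pi i / log q for k = 0, 1; combining
   both values of k separates the classes modulo Z a^vee inside a class modulo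
   Z a^vee / 2. *)
Lemma string_vanishing S (b : 'rV[K]_n -> K[i]) x a nu0 : a != 0 ->
  (forall z, qp (2 * cbil G (cx (cv a)) z) = 1 -> \sum_(nu <- S) b nu * EE (x + cx nu) z = 0) ->
  (forall nu, nu \in S -> bil G (nu - nu0) a \is a Num.int) ->
  \sum_(nu <- S | inZ (cv a) (nu - nu0)) b nu = 0.
Proof.
move=> a0 van hint.
(* [w] will be orthogonal to [a] but to no difference that is not a multiple of [a], so the real
   exponentials in [t] separate the lines in direction [a]; the sign [ph] separates the two classes
   left on one line. *)
pose D := [seq d <- [seq nu - nu0 | nu <- S] | orth_proj G a d != 0].
have [w [wa _ wD]] : exists w, [/\ bil G w a = bil G 0 a,
   forall d, d \in [::] -> bil G 0 d != 0 -> Num.sg (bil G w d) = Num.sg (bil G 0 d) &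
   forall d, d \in D -> bil G w d != 0].
  by apply: generic_near => // d; rewrite mem_filter => /andP[].
rewrite bil0l in wa.
have lq := logq_neq0 hq.
have wcv : bil G w (cv a) = 0 by apply/eqP; rewrite bil_coroot_eq0 // wa.
pose p := (pi *i)%C : K[i].
pose zz (k : nat) t : 'rV[K[i]]_n := (t%:C%C / logq) *: cx w + (k%:R * p / (2 * logq)) *: cx a.
pose ph nu := cexp (p * (bil G (nu - nu0) a)%:C%C).
have e0 (k : nat) nu t : EE (x + cx nu) (zz k t) = EE x (zz k t) * cexp (k%:R * p * (bil G nu0 a)%:C%C)
    * (ph nu ^+ k * (expR (t * (2 * bil G nu w)))%:C%C).
  rewrite EEDl -!mulrA; congr (_ * _).
  rewrite /zz EEDr EE_line mulrC mulrA; congr (_ * _).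
  rewrite /EE cbilZr cbil_complexify /ph -cexpMn -cexpD /qpow bilBl rmorphB /=; congr cexp.
  by rewrite -mulr_natl; field.
have eq1 (k : nat) t : \sum_(nu <- S) b nu * ph nu ^+ k * (expR (t * (2 * bil G nu w)))%:C%C = 0.
  have /van h : qp (2 * cbil G (cx (cv a)) (zz k t)) = 1.
    rewrite /zz cbilDr !cbilZr !cbil_complexify bilC // wcv bil_coroot_self //.
    rewrite rmorph0 mulr0 add0r rmorph_nat.
    have -> : 2 * (k%:R * p / (2 * logq) * 2) = (2 * k)%:R * p / logq by rewrite natrM; field.
    rewrite /qpow divfK // mulr_natl cexpMn exprM cexp_ipi sqrrN expr1n expr1n //.
  pose cst := EE x (zz k t) * cexp (k%:R * p * (bil G nu0 a)%:C%C).
  have cst0 : cst != 0 by rewrite mulf_neq0 ?EE_neq0 ?cexp_neq0.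
  apply: (mulfI cst0); rewrite mulr0 -[RHS]h mulr_sumr; apply: eq_bigr => nu _.
  by rewrite e0 -/cst; ring.
have eq2 k := @expR_sum_eq0 _ _ S (fun nu => b nu * ph nu ^+ k) (fun nu => 2 * bil G nu w) (2 * bil G nu0 w) (eq1 k).
have := congr2 +%R (eq2 0%N) (eq2 1%N); rewrite addr0 -big_split /= => eq3.
have ph1 nu : nu \in S -> ph nu = 1 \/ ph nu = -1.
  move=> nuS; rewrite /ph; have /intrP[k ->] := hint nu nuS.
  have h (k' : nat) : cexp (p * (k'%:R)%:C%C) = 1 \/ cexp (p * (k'%:R)%:C%C) = -1.
    rewrite rmorph_nat mulr_natr cexpMn cexp_ipi -signr_odd.
    by case: odd; [right; rewrite expr1|left; rewrite expr0].
  case: k => k; first by rewrite -pmulrn; exact: h.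
  rewrite NegzE mulrNz -pmulrn rmorphN mulrN cexpN.
  by case: (h k.+1) => ->; [left; rewrite invr1|right; rewrite invrN1].
have iff nu : nu \in S -> inZ (cv a) (nu - nu0) = (2 * bil G nu w == 2 * bil G nu0 w) && (ph nu == 1).
  move=> nuS; rewrite (inj_eq (mulfI _)) ?pnatr_eq0 // -subr_eq0 -bilBl.
  apply/idP/idP => [/asboolP[k e]|/andP[e1 e2]].
    rewrite e bilZl bilC // wcv mulr0 eqxx /= /ph e bilZl bil_coroot_self //.
    have h (k' : nat) : cexp (p * (k'%:R * 2)%:C%C) = 1.
      rewrite -natrM rmorph_nat mulr_natr cexpMn cexp_ipi mulnC exprM sqrrN !expr1n //.
    case: (k) => k'; first by rewrite -pmulrn h.
    by rewrite NegzE mulrNz -pmulrn mulNr rmorphN mulrN cexpN h invr1.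
  have op : orth_proj G a (nu - nu0) = 0.
    apply/eqP; apply: contraLR e1 => op; rewrite bilC // wD // mem_filter op.
    by apply/mapP; exists nu.
  have : bil G (nu - nu0) a / 2 \is a Num.int.
    apply: cexp_2ipi_eq1; move/eqP: e2; rewrite /ph => <-; congr cexp.
    apply/eqP; rewrite eq_complex /= !mul0r mulr0 subr0 eqxx /= add0r.
    by apply/eqP; field.
  move=> /intrP[k ek]; apply/asboolP; exists k.
  move/eqP: op; rewrite /orth_proj subr_eq0 => /eqP ->; rewrite -ek /coroot scalerA.
  by congr (_ *: _); field; rewrite bil_neq0.
have tw : (2 : K[i]) != 0 by rewrite pnatr_eq0.
apply: (mulfI tw); rewrite mulr0 -[RHS]eq3 mulr_sumr big_seq_cond [RHS]big_seq_cond.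
rewrite [RHS](bigID (fun nu => ph nu == 1)) /= [X in _ = _ + X]big1 ?addr0.
  apply: eq_big => nu.
    by case nuS: (nu \in S); rewrite //= iff.
  by move=> /andP[nuS]; rewrite iff // => /andP[_ /eqP->]; rewrite expr0 expr1; ring.
move=> nu /andP[/andP[nuS _]]; case: (ph1 _ nuS) => ->; first by rewrite eqxx.
by move=> _; rewrite expr0 expr1; ring.
Qed.

(** Shifting [z] by [s a / 2] multiplies the term of [nu] by [q^(s (x + nu, a))]; the difference of
    the two shifts is a sum with brackets, to which [string_vanishing] applies. *)
Lemma string_relation S (c : 'rV[K]_n -> K[i]) x a m f nu0 s :
  a != 0 -> (forall z, f z = \sum_(nu <- S) c nu * EE (x + cx nu) z) ->
  quasi_invariant a m f ->
  (forall nu, nu \in S -> bil G (nu - nu0) a \is a Num.int) -> (1 <= s <= m)%N ->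
  \sum_(nu <- S | inZ (cv a) (nu - nu0)) c nu * br (s%:R * cbil G (x + cx nu) (cx a)) = 0.
Proof.
move=> a0 ef qi hint sm; apply: (string_vanishing (x := x)) => // z /(qi s sm z).
rewrite !ef => /eqP; rewrite -subr_eq0 -sumrB => /eqP e; rewrite -[RHS]e; apply: eq_bigr => nu _.
rewrite (EEDr z (cx _)) (EEDr z (- cx _)) -!mulrBr -mulrA; congr (_ * _).
rewrite mulrC; congr (_ * _).
rewrite -complexifyN -scaleNr /EE !complexifyZ !cbilZr /qbracket; congr (qp _ - qp _).
  by rewrite rmorphM /= fmorphV !rmorph_nat; field.
by rewrite rmorphN rmorphM /= fmorphV !rmorph_nat; field.
Qed.

(** With [u = (x + nu, a)] this gives [[u] != 0] and, along a string, distinct values [qtrace u]: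
    [qtraceB] factors their differences, and the factor with [u - u'] is nonzero because q is not a
    root of unity. *)
Definition string_generic S x a := forall nu nu', nu \in S -> nu' \in S ->
  qp (2 * cbil G x (cx a) + (bil G (nu + nu') a)%:C%C) != 1.

Lemma string_support S (c : 'rV[K]_n -> K[i]) x a m nu0 :
  uniq S -> a != 0 -> string_generic S x a ->
  (forall s, (1 <= s <= m)%N ->
  \sum_(nu <- S | inZ (cv a) (nu - nu0)) c nu * br (s%:R * cbil G (x + cx nu) (cx a)) = 0) ->
  nu0 \in S -> c nu0 != 0 ->
  (m < size [seq nu <- S | inZ (cv a) (nu - nu0) && (c nu != 0)%R])%N.
Proof.
move=> uS a0 gen h nu0S c0.
pose r := [seq nu <- S | inZ (cv a) (nu - nu0)].
have -> : [seq nu <- S | inZ (cv a) (nu - nu0) && (c nu != 0)] = [seq nu <- r | c nu != 0].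
  by rewrite /r -filter_predI; apply: eq_filter => nu /=; rewrite andbC.
pose u nu := cbil G (x + cx nu) (cx a).
apply: (@count_support _ _ r c (fun nu => br (u nu)) (fun nu => qtrace logq (u nu)) m nu0) => //.
- by rewrite filter_uniq.
- move=> nu nu'; rewrite !mem_filter => /andP[/asboolP[k ek] nuS] /andP[/asboolP[k' ek'] nuS'].
  move=> /eqP; rewrite -subr_eq0 qtraceB mulf_eq0 !qbracket_eq0.
  have -> : 2 * ((u nu + u nu') / 2) = 2 * cbil G x (cx a) + (bil G (nu + nu') a)%:C%C.
    by rewrite /u !cbilDl !cbil_complexify bilDl rmorphD /=; field.
  rewrite (negPf (gen _ _ nuS nuS')) /=.
  have -> : 2 * ((u nu - u nu') / 2) = ((k - k') *+ 2)%:~R.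
    have -> : 2 * ((u nu - u nu') / 2) = u nu - u nu' by field.
    rewrite /u -cbilBl opprD addrACA subrr add0r -complexifyB cbil_complexify.
    rewrite (_ : nu - nu' = (k - k')%:~R *: cv a); last first.
      by rewrite intrB scalerBl -ek -ek' opprB addrA subrK.
    by rewrite bilZl bil_coroot_self // rmorphM /= rmorph_int rmorph_nat rmorphMn /= mulr_natr.
  rewrite qpow_int_eq1 // mulrn_eq0 /= subr_eq0 => /eqP kk.
  by apply: (addIr (- nu0)); rewrite ek ek' kk.
- move=> nu; rewrite mem_filter => /andP[_ nuS]; rewrite qbracket_eq0.
  have -> : 2 * u nu = 2 * cbil G x (cx a) + (bil G (nu + nu) a)%:C%C.
    by rewrite /u !cbilDl !cbil_complexify bilDl rmorphD /=; ring.
  exact: gen.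
- move=> p sp; rewrite big_filter -big_filter; apply: qbracket_sum_horner sp.
  by move=> s sm; rewrite big_filter; exact: h.
- by rewrite mem_filter nu0S andbT; apply/asboolP; exists 0; rewrite subrr scale0r.
Qed.

Lemma string_spread S (P : pred 'rV[K]_n) b m nu0 : uniq S -> b != 0 ->
  (m < size [seq nu <- S | inZ b (nu - nu0) && P nu])%N ->
  exists k l : int, [/\ nu0 + k%:~R *: b \in [seq nu <- S | P nu],
    nu0 + l%:~R *: b \in [seq nu <- S | P nu] & m%:R <= k%:~R - l%:~R :> K].
Proof.
move=> uS b0 sz.
pose r := [seq nu <- S | inZ b (nu - nu0) && P nu].
have hr nu : nu \in r -> exists k : int, nu = nu0 + k%:~R *: b.
  by rewrite mem_filter => /andP[/andP[/asboolP[k e] _] _]; exists k; rewrite -e addrC subrK.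
pose kk nu : int := xget 0 [set k : int | nu = nu0 + k%:~R *: b].
have kkP nu : nu \in r -> nu = nu0 + (kk nu)%:~R *: b.
  by move=> /hr h; apply: (xgetPex 0 h).
have [||i [j [/mapP[x xr ->] /mapP[y yr ->] le]]] := @spread_ints [seq kk nu | nu <- r] m.
- rewrite map_inj_in_uniq ?filter_uniq // => x y xr yr e.
  by rewrite (kkP x xr) (kkP y yr) e.
- by rewrite size_map.
exists (kk x), (kk y); split.
- by rewrite -kkP //; move: xr; rewrite !mem_filter => /andP[/andP[_ ->] ->].
- by rewrite -kkP //; move: yr; rewrite !mem_filter => /andP[/andP[_ ->] ->].
- by rewrite -intrB pmulrn ler_int.
Qed.

Lemma width_roots v (B : seq 'rV[K]_n) (m : 'rV[K]_n -> nat) S nu0 :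
  uniq B -> {in B, forall a, a != 0} ->
  (forall a b, a \in B -> b \in B -> a != b -> bil G v a != 0 ->
    bil G v a *: b - bil G v b *: a != 0) ->
  nu0 \in S ->
  (forall a nu, a \in B -> nu \in S -> exists t1 t2,
     [/\ nu + t1 *: cv a \in S, nu + t2 *: cv a \in S & (m a)%:R <= t1 - t2]) ->
  exists x y : 'rV[K]_n, [/\ x \in S, y \in S &
    \sum_(a <- B) (m a)%:R * `|bil G v (cv a)| <= bil G v (x - y)].
Proof.
move=> uB B0 indep nu0S h.
have [| | | |x [y [xS yS le]]] := @width_strings _ _ _ hG v (map cv B) (fun b => (m (cv b))%:R) S nu0 _ nu0S.
- by rewrite map_inj_uniq //; exact: can_inj corootK.
- move=> _ _ /mapP[a aB ->] /mapP[b bB ->] ab va.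
  have vab : bil G v a != 0 by rewrite -bil_coroot_eq0 // B0.
  have ab' : a != b by apply: contra ab => /eqP->.
  have := indep a b aB bB ab' vab; apply: contra => e.
  move: e; rewrite /coroot !bilZr !scalerA.
  rewrite [2 / bil G a a * _]mulrC [2 / bil G b b * _]mulrC -!mulrA.
  rewrite [_ * (2 / bil G b b)]mulrC [2 / bil G b b * _]mulrC => /eqP e.
  have ka : 2 / bil G a a != 0 by rewrite mulf_neq0 ?pnatr_eq0 // invr_eq0 bil_neq0 // B0.
  have kb : 2 / bil G b b != 0 by rewrite mulf_neq0 ?pnatr_eq0 // invr_eq0 bil_neq0 // B0.
  have : (2 / bil G a a * (2 / bil G b b)) *: (bil G v a *: b - bil G v b *: a) = 0.
    rewrite -[RHS]e scalerBr !scalerA; congr (_ *: _ - _ *: _); ring.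
  by move=> /eqP; rewrite scaler_eq0 mulf_eq0 (negPf ka) (negPf kb).
- by move=> b _; rewrite ler0n.
- by move=> _ nu /mapP[a aB ->] nuS; rewrite corootK; exact: h.
exists x, y; split=> //; move: le; rewrite big_map.
by under eq_bigr do rewrite corootK.
Qed.

(** It serves to prove vanishing: exponents confined to a polytope of exactly this width must reach
    its extreme face, where the coefficients are known to be 0. *)
Theorem quasi_invariant_width S (c : 'rV[K]_n -> K[i]) x f v
    (B : seq 'rV[K]_n) (m : 'rV[K]_n -> nat) nu0 :
  uniq S -> (forall z, f z = \sum_(nu <- S) c nu * EE (x + cx nu) z) ->
  uniq B -> {in B, forall a, a != 0} ->
  (forall a b, a \in B -> b \in B -> a != b -> bil G v a != 0 ->
    bil G v a *: b - bil G v b *: a != 0) ->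
  (forall a, a \in B -> string_generic S x a) ->
  (forall a nu nu', a \in B -> nu \in S -> nu' \in S -> bil G (nu - nu') a \is a Num.int) ->
  (forall a, a \in B -> quasi_invariant a (m a) f) ->
  nu0 \in S -> c nu0 != 0 ->
  exists mu nu, [/\ (mu \in S) && (c mu != 0), (nu \in S) && (c nu != 0) &
    \sum_(a <- B) (m a)%:R * `|bil G v (cv a)| <= bil G v (mu - nu)].
Proof.
move=> uS ef uB B0 indep gen hint qi nu0S c0.
have [||x' [y' [xS yS le]]] := @width_roots v B m [seq nu <- S | c nu != 0] nu0 uB B0 indep.
- by rewrite mem_filter c0.
- move=> a nu aB; rewrite mem_filter => /andP[cnu nuS].
  have [||k [l [kS lS kl]]] := @string_spread S (fun nu => c nu != 0) (cv a) (m a) nu uS.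
  - by rewrite coroot_neq0 // B0.
  - apply: (string_support uS (B0 a aB) (gen a aB)) => // s sm.
    apply: (string_relation (B0 a aB) ef (qi a aB)) => // nu' nu'S; exact: hint.
  by exists k%:~R, l%:~R.
by exists x', y'; move: xS yS; rewrite !mem_filter => /andP[-> ->] /andP[-> ->].
Qed.

(** [q^(2 (x, a))] acquires the factor [exp(2 t (w, a))], injective in [t], so each root and pair of
    exponents excludes at most one parameter. *)
Lemma string_generic_line S (B : seq 'rV[K]_n) x w : (forall a, a \in B -> bil G w a != 0) ->
  exists bad : seq K, forall t, t \notin bad ->
    forall a, a \in B -> string_generic S (x + t%:C%C *: (logq^-1 *: cx w)) a.
Proof.
move=> hw.
pose Z a nu nu' := qp (2 * cbil G x (cx a) + (bil G (nu + nu') a)%:C%C).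
(* Solves [Z exp(2 t (w, a)) = 1]; if [Z^-1] is not a positive real there is no solution, and the
   value is a harmless extra exclusion. *)
pose tt a nu nu' := ln (complex.Re (Z a nu nu')^-1) / (2 * bil G w a).
exists (flatten [seq [seq tt a p.1 p.2 | p <- [seq (nu, nu') | nu <- S, nu' <- S]] | a <- B]).
move=> t tb a aB nu nu' nuS nuS'; apply: contra tb => /eqP e.
apply/flattenP; exists [seq tt a p.1 p.2 | p <- [seq (nu, nu') | nu <- S, nu' <- S]].
  by apply/mapP; exists a.
apply/mapP; exists (nu, nu'); first by apply/allpairsP; exists (nu, nu').
have wa := hw a aB.
have : Z a nu nu' * (expR (t * (2 * bil G w a)))%:C%C = 1.
  rewrite -e -EE_line scalerA [in RHS]cbilDl mulrDr addrAC [in RHS]qpowD /Z; congr (_ * _).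
  by rewrite /EE cbilZr cbilZl.
move=> /(canRL (mulKf (qpow_neq0 _ _))); rewrite mulr1 => eZ.
by rewrite /tt /= -eZ /= expRK mulfK // mulf_neq0 ?pnatr_eq0.
Qed.

(** Extends to every [x] what is proved under [string_generic]. The direction [w] is a parameter, so
    that the line can be kept inside a hyperplane. *)
Lemma generic_zero S (B : seq 'rV[K]_n) w f x : ccont f -> (forall a, a \in B -> bil G w a != 0) ->
  (forall t : K, let y := x + t%:C%C *: (logq^-1 *: cx w) in
     (forall a, a \in B -> string_generic S y a) -> f y = 0) -> f x = 0.
Proof.
move=> fc hw h; have [bad hb] := @string_generic_line S B x w hw.
by apply: (line_identity (w := logq^-1 *: cx w) (bad := bad) fc) => t /hb; exact: h.
Qed.

End StringConditions.

(** * The polytope *)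

Definition invariant_multiplicity (K : realType) (n : nat) (G : 'M[K]_n)
    (R : {fset 'rV[K]_n}) (m : 'rV[K]_n -> nat) : Prop :=
  forall a b, a \in R -> b \in R -> m (reflection G a b) = m b.

Section RootData.
Context (K : realType) (n : nat) (G : 'M[K]_n) (R : {fset 'rV[K]_n}) (m : 'rV[K]_n -> nat).
Hypothesis hG : scalar_product G.
Hypothesis hR : root_system G R.
Hypothesis hred : reduced R.
Hypothesis hm : invariant_multiplicity G R m.
Implicit Types (a b u v w nu : 'rV[K]_n).
Local Notation cv := (coroot G).
Local Notation s_ := (reflection G).

Lemma root_neq0 a : a \in R -> a != 0.
Proof. by move=> aR; apply: contraTneq aR => ->; case: hR. Qed.

Lemma reflection_self a : a != 0 -> s_ a a = - a.
Proof.
move=> a0; rewrite /reflection bilC // bil_coroot_self // scaler_nat mulr2n.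
by rewrite opprD addrA subrr add0r.
Qed.

Lemma reflection_bil a u w : a != 0 -> bil G (s_ a u) (s_ a w) = bil G u w.
Proof.
move=> a0; rewrite /reflection !bilBl !bilBr !bilZl ?bilZr /coroot ?bilZr.
rewrite (bilC hG a w); field; exact: bil_neq0.
Qed.

Lemma reflectionK a : a != 0 -> involutive (s_ a).
Proof.
move=> a0 u; rewrite {1}/reflection.
have -> : bil G (s_ a u) (cv a) = - bil G u (cv a).
  by rewrite /reflection bilBl bilZl (bilC hG a) bil_coroot_self //; ring.
by rewrite scaleNr opprK /reflection subrK.
Qed.

Lemma corootN a : cv (- a) = - cv a.
Proof. by rewrite /coroot bilNl bilNr opprK scalerN. Qed.

Lemma coroot_reflection a b : a != 0 -> cv (s_ a b) = s_ a (cv b).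
Proof.
move=> a0; rewrite {1}/coroot reflection_bil // /reflection scalerBr scalerA.
by rewrite -bilZl.
Qed.

Lemma root_opp a : (- a \in R) = (a \in R).
Proof.
have h c : c \in R -> - c \in R.
  by move=> cR; rewrite -reflection_self ?root_neq0 //; case: hR => _ _ /(_ c c cR cR).
by apply/idP/idP => /h //; rewrite opprK.
Qed.

Lemma mult_opp a : a \in R -> m (- a) = m a.
Proof. by move=> aR; rewrite -reflection_self ?root_neq0 // hm. Qed.

Lemma cartan_int a b : a \in R -> b \in R -> bil G b (cv a) \is a Num.int.
Proof. by case: hR => _ _ _; apply. Qed.

Lemma root_proportional a b t : a \in R -> b \in R -> b = t *: a -> b = a \/ b = - a.
Proof.
move=> aR bR e; have := @hred a t aR; rewrite -e => /(_ bR)[] t1.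
  by left; rewrite e t1 scale1r.
by right; rewrite e t1 scaleN1r.
Qed.

Lemma perm_opp : perm_eq [seq - a | a <- R] R.
Proof.
apply: uniq_perm; first by rewrite (map_inj_uniq oppr_inj) fset_uniq.
  exact: fset_uniq.
move=> a; apply/mapP/idP => [[b bR ->]|aR]; first by rewrite root_opp.
by exists (- a); rewrite ?opprK // root_opp.
Qed.

Lemma perm_reflection b : b \in R -> perm_eq [seq s_ b a | a <- R] R.
Proof.
move=> bR; have b0 := root_neq0 bR.
apply: uniq_perm; first by rewrite (map_inj_uniq (can_inj (reflectionK b0))) fset_uniq.
  exact: fset_uniq.
have st a : a \in R -> s_ b a \in R by case: hR => _ _ h _ aR; exact: h.
move=> a; apply/mapP/idP => [[c cR ->]|aR]; first exact: st.
by exists (s_ b a); rewrite ?reflectionK // st.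
Qed.

Definition regular v := forall a, a \in R -> bil G v a != 0.

(** For regular [v] a vertex of the polytope. On walls the roots orthogonal to [v] drop out, and it
    is the centre of the face on which [(v, .)] is maximal. *)
Definition rho v : 'rV[K]_n := 2^-1 *: \sum_(a <- R | 0 < bil G v a) (m a)%:R *: cv a.

(** Signed sums over one fixed positive system make half-sums of different chambers comparable term
    by term. *)
Lemma sum_positive_odd u v (F : 'rV[K]_n -> 'rV[K]_n) : regular v ->
  (forall a, a \in R -> F (- a) = - F a) ->
  \sum_(a <- R | 0 < bil G u a) F a = \sum_(a <- R | 0 < bil G v a) Num.sg (bil G u a) *: F a.
Proof.
move=> rv oF.
rewrite (bigID (fun a => 0 < bil G v a)) /= [X in _ + X](_ : _ =
   \sum_(a <- R | (bil G u a < 0) && (0 < bil G v a)) - F a); last first.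
  rewrite -(perm_big _ perm_opp) /= big_map big_seq_cond [RHS]big_seq_cond.
  apply: eq_big => [a|a /andP[aR _]]; last exact: oF.
  case aR: (a \in R) => //=; rewrite !bilNr oppr_gt0; congr (_ && _).
  by rewrite oppr_gt0 -leNgt le_eqVlt eq_sym (negPf (rv a aR)).
rewrite [RHS](bigID (fun a => 0 < bil G u a)) /=; congr (_ + _).
  rewrite big_mkcond [RHS]big_mkcond; apply: eq_bigr => a _; rewrite andbC.
  by case: ifP => // /andP[_ ua]; rewrite gtr0_sg // scale1r.
rewrite big_mkcond [RHS]big_mkcond; apply: eq_bigr => a _; rewrite andbC -leNgt.
rewrite le_eqVlt orbC; case: (ltrgt0P (bil G u a)) => /= ua; case: (0 < _) => //=.
  by rewrite ltr0_sg // scaleN1r.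
by rewrite ua sgr0 scale0r.
Qed.

Lemma rhoE u v : regular v ->
  rho u = 2^-1 *: \sum_(a <- R | 0 < bil G v a) Num.sg (bil G u a) *: ((m a)%:R *: cv a).
Proof.
move=> rv; congr (_ *: _); apply: sum_positive_odd => // a aR.
by rewrite mult_opp // corootN scalerN.
Qed.

Lemma bil_coroot_gt0 v a : a \in R -> (0 < bil G v (cv a)) = (0 < bil G v a).
Proof.
move=> aR; have a0 := bil_gt0 hG (root_neq0 aR).
by rewrite /coroot bilZr pmulr_rgt0 // divr_gt0.
Qed.

Lemma bil_coroot_sg v a : a \in R -> Num.sg (bil G v (cv a)) = Num.sg (bil G v a).
Proof.
move=> aR; have a0 := bil_gt0 hG (root_neq0 aR).
by rewrite /coroot bilZr sgrM gtr0_sg ?mul1r // divr_gt0.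
Qed.

(** The width of the polytope in direction [u], in the form in which the width estimate produces
    it. *)
Lemma bil_rho u v : regular v ->
  2 * bil G u (rho u) = \sum_(a <- R | 0 < bil G v a) (m a)%:R * `|bil G u (cv a)|.
Proof.
move=> rv; rewrite (rhoE u rv) bilZr mulrA divff ?mul1r ?pnatr_eq0 // bil_sumr.
rewrite big_seq_cond [RHS]big_seq_cond; apply: eq_bigr => a /andP[aR _].
by rewrite 2!bilZr normrEsg bil_coroot_sg //; ring.
Qed.

Definition wall u b := bil G u b = 0 /\
  forall a, a \in R -> a != b -> a != - b -> bil G u a != 0.

Lemma wall_exists b : b \in R -> exists u, wall u b.
Proof.
move=> bR; have b0 := root_neq0 bR.
have [|u [ub _ uD]] := @generic_near _ _ _ hG b 0 [::] [seq a <- R | (a != b) && (a != - b)].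
  move=> a; rewrite mem_filter => /andP[/andP[ab anb] aR].
  rewrite /orth_proj subr_eq0; apply/negP => /eqP e.
  by case: (root_proportional bR aR e) => e'; move: ab anb; rewrite e' eqxx.
exists u; split; first by rewrite ub bil0l.
by move=> a aR ab anb; apply: uD; rewrite mem_filter ab anb.
Qed.

Lemma wall_reflection u b a : b != 0 -> bil G u b = 0 -> bil G u (s_ b a) = bil G u a.
Proof. by move=> b0 ub; rewrite /reflection bilBr bilZr ub mulr0 subr0. Qed.

(** The reflection in [b] fixes [u] and permutes the roots positive on [u], so the product with [b]
    equals its own negative. *)
Lemma reflection_rho u b : b \in R -> bil G u b = 0 -> bil G (rho u) b = 0.
Proof.
move=> bR ub; have b0 := root_neq0 bR.
have e : bil G (rho u) b = - bil G (rho u) b.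
  rewrite /rho !bilZl -mulrN; congr (_ * _); rewrite !bil_suml -sumrN.
  rewrite -[LHS](perm_big _ (perm_reflection bR)) /= big_map.
  rewrite big_seq_cond [RHS]big_seq_cond; apply: eq_big => [a|a /andP[aR _]].
    by rewrite wall_reflection.
  rewrite [LHS]bilZl [in RHS]bilZl hm // coroot_reflection // -mulrN; congr (_ * _).
  have -> : bil G (s_ b (cv a)) b = - bil G (s_ b (cv a)) (s_ b b).
    by rewrite reflection_self // bilNr opprK.
  by rewrite reflection_bil.
lra.
Qed.

Definition close_to u b v := forall a, a \in R -> a != b -> a != - b ->
  Num.sg (bil G v a) = Num.sg (bil G u a).

(** [rho u] is the midpoint of an edge in direction [b^\vee]; the two chambers adjacent to the wall
    give its end points. *)
Lemma rho_wall u b v : b \in R -> wall u b -> close_to u b v -> 0 < bil G v b ->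
  rho v = rho u + ((m b)%:R / 2) *: cv b.
Proof.
move=> bR [ub uw] cl vb.
have rv : regular v.
  move=> a aR; case: (eqVneq a b) => [->|ab]; first by rewrite lt0r_neq0.
  case: (eqVneq a (- b)) => [->|anb]; first by rewrite bilNr oppr_eq0 lt0r_neq0.
  by rewrite -sgr_eq0 cl // sgr_eq0 uw.
rewrite (rhoE u rv) (rhoE v rv) !(big_rem b bR) /= vb ub sgr0 scale0r add0r gtr0_sg // scale1r.
rewrite scalerDr addrC; congr (_ + _); last by rewrite scalerA mulrC.
congr (_ *: _); rewrite big_seq_cond [RHS]big_seq_cond; apply: eq_bigr => a /andP[].
rewrite mem_rem_uniq ?fset_uniq // !inE => /andP[ab aR] va; rewrite cl //.
by apply: contraTneq va => ->; rewrite bilNr oppr_gt0 -leNgt ltW.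
Qed.

Lemma close_opp u b v : close_to u b v -> close_to u (- b) v.
Proof. by move=> h a aR; rewrite opprK => a1 a2; exact: h. Qed.

Lemma wall_opp u b : wall u b -> wall u (- b).
Proof.
move=> [ub h]; split; first by rewrite bilNr ub oppr0.
by move=> a aR a1; rewrite opprK => a2; exact: h.
Qed.

(** Compare with the midpoint [rho u] of an edge in direction [b], which is orthogonal to [b]. A
    root changing sign contributes an integer, and the one of [b], [- b] that is positive on [v]
    contributes [m b] up to sign, since [(b^\vee, b) = 2] absorbs the factor 1/2. *)
Lemma rho_coweight v : regular v -> coweight_lattice G R (rho v).
Proof.
move=> rv b bR; have [u wu] := wall_exists bR.
have e : bil G (rho v) b = bil G (rho v) b - bil G (rho u) b.
  by rewrite (reflection_rho bR (proj1 wu)) subr0.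
rewrite e (rhoE v rv) (rhoE u rv) !bilZl -mulrBr !bil_suml -sumrB mulr_sumr.
rewrite big_seq_cond; apply: rpred_sum => a /andP[aR va].
rewrite !(bilZl _ (Num.sg _)) gtr0_sg // mul1r bilZl.
have ci : bil G (cv a) b \is a Num.int by rewrite bilC // cartan_int.
have nI k : (k%:R : K) \is a Num.int by rewrite rpred_nat.
case: (eqVneq (bil G u a) 0) => [ua|ua].
  have ab : a = b \/ a = - b.
    case: (eqVneq a b) => [->|ab]; first by left.
    case: (eqVneq a (- b)) => [->|anb]; first by right.
    by have := (proj2 wu) a aR ab anb; rewrite ua eqxx.
  rewrite ua sgr0 mul0r subr0.
  have : bil G (cv a) b = 2 \/ bil G (cv a) b = -2.
    case: ab => ->; rewrite ?corootN ?bilNl bil_coroot_self ?root_neq0 //; by [left|right].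
  case=> ->; last rewrite mulrN mulrN.
    by rewrite mulrCA mulVf ?mulr1 // pnatr_eq0.
  by rewrite mulrCA mulVf ?mulr1 ?rpredN // pnatr_eq0.
have /orP[] : (0 < bil G u a) || (bil G u a < 0) by move: ua; rewrite neq_lt orbC.
  by move=> h; rewrite gtr0_sg // mul1r subrr mulr0 rpred0.
move=> h; rewrite ltr0_sg //.
rewrite (_ : 2^-1 * _ = (m a)%:R * bil G (cv a) b); first exact: rpredM.
by field.
Qed.

Lemma big_positive_roots v (T : Type) (idx : T) (op : Monoid.com_law idx) (F : 'rV[K]_n -> T) :
  \big[op/idx]_(a <- [fset a in R | 0 < bil G v a]%fset) F a =
  \big[op/idx]_(a <- R | 0 < bil G v a) F a.
Proof.
rewrite -[RHS]big_filter; apply: perm_big; apply: uniq_perm; rewrite ?fset_uniq ?filter_uniq //.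
by move=> a; rewrite mem_filter !inE /= andbC.
Qed.

Section Polytope.
Variable v0 : 'rV[K]_n.
Hypothesis rv0 : regular v0.
Let Rp := [fset a in R | 0 < bil G v0 a]%fset.

Lemma positive_rootsP a : (a \in Rp) = (a \in R) && (0 < bil G v0 a).
Proof. by rewrite !inE. Qed.

Lemma rho_veeE : rho_vee G Rp m = rho v0.
Proof. by rewrite /rho_vee big_positive_roots. Qed.

(** The polytope is a zonotope centred at 0: [rho_vee] is absorbed by shifting each [l a] by
    [m a / 2]. *)
Lemma polytopeP nu : polytope G Rp m nu -> exists2 c : 'rV[K]_n -> K,
  (forall a, a \in Rp -> `|c a| <= (m a)%:R / 2) & nu = \sum_(a <- Rp) c a *: cv a.
Proof.
move=> [l hl ->]; exists (fun a => (m a)%:R / 2 - l a).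
  by move=> a /hl /andP[l0 lm]; rewrite ler_norml; apply/andP; split; lra.
rewrite /rho_vee scaler_sumr -sumrB; apply: eq_bigr => a _.
by rewrite scalerBl scalerA mulrC.
Qed.

Lemma polytope_bound v nu : polytope G Rp m nu -> `|bil G v nu| <= bil G v (rho v).
Proof.
move=> /polytopeP[c hc ->].
have := bil_rho v rv0; rewrite -big_positive_roots => e.
have -> : bil G v (rho v) = \sum_(a <- Rp) (m a)%:R / 2 * `|bil G v (cv a)|.
  by under eq_bigr do rewrite mulrAC; rewrite -mulr_suml -e; field.
rewrite bil_sumr; apply: (le_trans (ler_norm_sum _ _ _)).
rewrite big_seq [leRHS]big_seq; apply: ler_sum => a aR.
by rewrite bilZr normrM ler_wpM2r // hc.
Qed.

(** Equality in [polytope_bound] forces every coefficient with [(v, a) != 0] to its extreme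
    value. *)
Lemma polytope_face v nu : polytope G Rp m nu -> bil G v nu = bil G v (rho v) ->
  exists2 c : 'rV[K]_n -> K, (forall a, a \in Rp -> `|c a| <= (m a)%:R / 2) &
   nu = rho v + \sum_(a <- Rp | bil G v a == 0) c a *: cv a.
Proof.
move=> /polytopeP[c hc e] top; exists c => //.
have hs := bil_rho v rv0; rewrite -big_positive_roots in hs.
have {hs} : \sum_(a <- Rp) ((m a)%:R / 2 * `|bil G v (cv a)| - c a * bil G v (cv a)) = 0.
  rewrite sumrB -[X in _ - X](_ : bil G v nu = _); last first.
    by rewrite e bil_sumr; apply: eq_bigr => a _; rewrite bilZr.
  under eq_bigr do rewrite mulrAC; rewrite -mulr_suml -hs top; by field.
move=> /eqP; rewrite big_seq psumr_eq0; last first.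
  move=> a aR; rewrite subr_ge0; apply: (le_trans (ler_norm _)).
  by rewrite normrM ler_wpM2r // hc.
move=> /allP h0.
have hc' a : a \in Rp -> bil G v a != 0 -> c a = (m a)%:R / 2 * Num.sg (bil G v a).
  move=> aRp va; have aR : a \in R by move: aRp; rewrite positive_rootsP => /andP[].
  have := h0 a aRp; rewrite aRp /= subr_eq0 normrEsg bil_coroot_sg // mulrA => /eqP.
  by move/mulIf => <- //; rewrite bil_coroot_eq0 ?root_neq0.
rewrite (rhoE v rv0) -big_positive_roots e (bigID (fun a => bil G v a == 0)) /= addrC.
congr (_ + _); rewrite scaler_sumr [RHS](bigID (fun a => bil G v a == 0)) /=.
rewrite [X in _ = X + _]big1 ?add0r; last by move=> a /eqP->; rewrite sgr0 scale0r scaler0.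
rewrite big_seq_cond [RHS]big_seq_cond; apply: eq_bigr => a /andP[aR va].
by rewrite hc' // !scalerA; congr (_ *: _); ring.
Qed.

Lemma polytope_vertex v nu : regular v -> polytope G Rp m nu ->
  bil G v nu = bil G v (rho v) -> nu = rho v.
Proof.
move=> rv pn top; have [c _ ->] := polytope_face pn top.
rewrite big_seq_cond big1 ?addr0 // => a /andP[].
by rewrite positive_rootsP => /andP[aR _] /eqP va; have := rv a aR; rewrite va eqxx.
Qed.

Lemma polytope_edge u b nu : b \in R -> wall u b -> polytope G Rp m nu ->
  bil G u nu = bil G u (rho u) ->
  exists2 t, `|t| <= (m b)%:R / 2 & nu = rho u + t *: cv b.
Proof.
move=> bR [ub uw] pn top; have [c hc ->] := polytope_face pn top.
have [b' b'R b'b] : exists2 b', b' \in Rp & b' = b \/ b' = - b.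
  case: (ltrgt0P (bil G v0 b)) => vb.
  - by exists b; [rewrite positive_rootsP bR|left].
  - by exists (- b); [rewrite positive_rootsP root_opp bR bilNr oppr_gt0|right].
  - by have := rv0 bR; rewrite vb eqxx.
have ub' : bil G u b' = 0 by case: b'b => ->; rewrite ?bilNr ub ?oppr0.
have b'R' : b' \in R by move: b'R; rewrite positive_rootsP => /andP[].
have -> : \sum_(a <- Rp | bil G u a == 0) c a *: cv a = c b' *: cv b'.
  rewrite (big_rem b' b'R) /= ub' eqxx big_seq_cond big1 ?addr0 //.
  move=> a /andP[]; rewrite mem_rem_uniq ?fset_uniq // !inE /= => /andP[ab' /andP[aR va]] /eqP ua.
  have : a = b \/ a = - b.
    case: (eqVneq a b) => [->|ab]; first by left.
    case: (eqVneq a (- b)) => [->|anb]; first by right.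
    by have := uw a aR ab anb; rewrite ua eqxx.
  move: b'R ab'; rewrite positive_rootsP => /andP[_].
  case: b'b => -> h ab' [] e; move: ab' va h; rewrite e ?eqxx // ?bilNr ?oppr_gt0 => _ h1 h2.
    by have := lt_trans h1 h2; rewrite ltxx.
  by have := lt_trans h1 h2; rewrite ltxx.
have mb : m b' = m b by case: b'b => ->; rewrite ?mult_opp.
have hcb := hc b' b'R; rewrite mb in hcb.
case: b'b => eb; first by exists (c b') => //; rewrite eb.
by exists (- c b'); rewrite ?normrN // eb corootN scalerN scaleNr.
Qed.

Lemma rho_polytope v : polytope G Rp m (rho v).
Proof.
exists (fun a => (m a)%:R / 2 * (1 - Num.sg (bil G v a))).
  move=> a _; have m0 : 0 <= (m a)%:R :> K by rewrite ler0n.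
  case: sgrP => _; apply/andP; split; lra.
rewrite (rhoE v rv0) -big_positive_roots /rho_vee !scaler_sumr -sumrB; apply: eq_bigr => a _.
by rewrite !scalerA -scalerBl; congr (_ *: _); ring.
Qed.

End Polytope.
End RootData.

Lemma seq_uniform (T : eqType) (s : seq T) (P : T -> nat -> Prop) :
  (forall a k l, (k <= l)%N -> P a k -> P a l) -> (forall a, a \in s -> exists k, P a k) ->
  exists k, forall a, a \in s -> P a k.
Proof.
move=> mono; elim: s => [|a s IH] h; first by exists 0%N.
have [|k hk] := IH; first by move=> b bs; apply: h; rewrite inE bs orbT.
have [l hl] := h a (mem_head _ _).
exists (maxn k l) => b; rewrite inE => /orP[/eqP->|bs].
  exact: mono (leq_maxr _ _) hl.
exact: mono (leq_maxl _ _) (hk b bs).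
Qed.

(** * Lattice points, integral vectors and the dual root system *)

Section RootDataLattice.
Context (K : realType) (n : nat) (G : 'M[K]_n) (R : {fset 'rV[K]_n}) (m : 'rV[K]_n -> nat).
Hypothesis hG : scalar_product G.
Hypothesis hR : root_system G R.
Hypothesis hred : reduced R.
Hypothesis hm : invariant_multiplicity G R m.
Implicit Types (a b u v w nu : 'rV[K]_n).
Local Notation cv := (coroot G).
Local Notation cx := (@complexify K 1 n).

Lemma span_coef (s : seq 'rV[K]_n) v : uniq s -> v \in <<s>>%VS ->
  exists f : 'rV[K]_n -> K, v = \sum_(a <- s) f a *: a.
Proof.
elim: s v => [|a s IH] v.
  by rewrite span_nil memv0 => _ /eqP->; exists (fun=> 0); rewrite big_nil.
rewrite cons_uniq span_cons => /andP[aS us] /memv_addP[w /vlineP[k ->] [w' w's ->]].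
have [f ef] := IH w' us w's.
exists (fun b => if b == a then k else f b); rewrite big_cons eqxx; congr (_ + _).
rewrite ef big_seq [RHS]big_seq; apply: eq_bigr => b bs.
by rewrite ifN //; apply: contraNneq aS => <-.
Qed.

Lemma coroot_span v : exists f : 'rV[K]_n -> K, v = \sum_(a <- R) f a *: cv a.
Proof.
have [|f ef] := @span_coef R v (fset_uniq R).
  by case: hR => _ -> _ _; rewrite memvf.
exists (fun a => f a * (bil G a a / 2)); rewrite ef big_seq [RHS]big_seq.
apply: eq_bigr => a aR; rewrite /coroot scalerA; congr (_ *: _).
by field; rewrite bil_neq0 // (root_neq0 hR).
Qed.

Lemma root_bil_inj u w : (forall a, a \in R -> bil G u a = bil G w a) -> u = w.
Proof.
move=> h; apply/eqP; rewrite -subr_eq0; apply: contraT => /(bil_gt0 hG).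
have [f {2}->] := coroot_span (u - w).
rewrite bil_sumr big_seq big1 ?ltxx // => a aR.
by rewrite /coroot !bilZr bilBl h // subrr !mulr0.
Qed.

Lemma gram_unit : G \in unitmx.
Proof.
rewrite -row_free_unit; apply/inj_row_free => v hv; apply/eqP; apply: contraT => /(bil_gt0 hG).
by rewrite /bil hv mul0mx mxE ltxx.
Qed.

(** The family of coroots is redundant; any linear choice of coordinates lets an arbitrary [x] be
    reached by moving in one coroot direction after another. *)
Lemma coroot_coordinates : exists t : 'rV[K]_n -> 'rV[K]_n,
  forall x : 'rV[K[i]]_n, x = \sum_(a <- R) cbil G (cx (t a)) x *: cx (cv a).
Proof.
have /boolp.choice[f hf] : forall j : 'I_n, exists f : 'rV[K]_n -> K,
    delta_mx 0 j = \sum_(a <- R) f a *: cv a by move=> j; exact: coroot_span.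
exists (fun a => (\row_j f j a) *m invmx G) => x.
rewrite {1}[x]row_sum_delta.
have e a : cbil G (cx ((\row_j f j a) *m invmx G)) x = \sum_j x 0 j * (f j a)%:C%C.
  rewrite /cbil /bil /complexify -map_mxM mulmxKV ?gram_unit // mxE.
  by apply: eq_bigr => j _; rewrite !mxE mulrC.
under [RHS]eq_bigr do rewrite e scaler_suml.
rewrite exchange_big; apply: eq_bigr => j _ /=.
have -> : delta_mx 0 j = cx (delta_mx 0 j) by rewrite /complexify map_delta_mx.
rewrite hf complexify_sum scaler_sumr; apply: eq_bigr => a _.
by rewrite complexifyZ scalerA.
Qed.

(** A large multiple of [v] is rounded in its coroot coordinates; the error on a root stays below
    [C], too small to change a sign. Integrality turns exponential sums along [v'] into polynomials
    in one real exponential, as [low_dense] requires. *)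
Lemma integral_regular v : regular G R v -> exists v', [/\ regular G R v',
   forall mu, (forall a, a \in R -> bil G mu (cv a) \is a Num.int) -> bil G v' mu \is a Num.int &
   forall a, a \in R -> (0 < bil G v' a) = (0 < bil G v a)].
Proof.
move=> rv; have [f ef] := coroot_span v.
pose C := 1 + \sum_(a <- R) \sum_(b <- R) `|bil G (cv b) a|.
have C0 a : a \in R -> \sum_(b <- R) `|bil G (cv b) a| < C.
  move=> aR; rewrite /C [X in _ < 1 + X](big_rem a aR) /=.
  by rewrite addrCA ltrDl ltr_pwDl // sumr_ge0 // => ? _; exact: sumr_ge0.
have Cp : 0 < C.
  by rewrite ltr_pwDl // sumr_ge0 // => ? _; exact: sumr_ge0.
have [N hN] : exists N : nat, forall a, a \in R -> C <= N%:R * `|bil G v a|.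
  apply: (@seq_uniform _ R (fun a N => C <= N%:R * `|bil G v a|)).
    by move=> a k l kl h; apply: (le_trans h); rewrite ler_wpM2r // ler_nat.
  move=> a aR; exists (Num.truncn (C / `|bil G v a|)).+1.
  by rewrite -ler_pdivrMr ?normr_gt0 ?rv // ltW // truncnS_gt.
pose v' := \sum_(b <- R) (Num.floor (N%:R * f b))%:~R *: cv b.
have close a : a \in R -> `|N%:R * bil G v a - bil G v' a| < C.
  move=> aR; apply: le_lt_trans (C0 a aR).
  rewrite ef /v' !bil_suml mulr_sumr -sumrB; apply: (le_trans (ler_norm_sum _ _ _)).
  apply: ler_sum => b _; rewrite [X in _ * X]bilZl [X in _ - X]bilZl mulrA -mulrBl normrM.
  rewrite ler_piMl //.
  have /andP[h1 h2] := floor_itv (N%:R * f b); rewrite intrD1 in h2.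
  by rewrite ler_norml; apply/andP; split; lra.
have sgn a : a \in R -> (bil G v' a != 0) /\ (0 < bil G v' a) = (0 < bil G v a).
  move=> aR; have := close a aR; rewrite ltr_norml => /andP[h1 h2].
  have N0 : 0 <= N%:R :> K by rewrite ler0n.
  have := hN a aR; case: (ltrgt0P (bil G v a)) (rv a aR) => // va _ h3.
    have p : 0 < bil G v' a by lra.
    by rewrite p lt0r_neq0.
  have p : bil G v' a < 0 by lra.
  by rewrite ltr0_neq0 // ltNge ltW.
exists v'; split.
- by move=> a aR; case: (sgn a aR).
- move=> mu hmu; rewrite /v' bil_suml big_seq; apply: rpred_sum => b bR.
  by rewrite bilZl rpredM ?intr_int // bilC // hmu.
- by move=> a aR; case: (sgn a aR).
Qed.

(** A coweight is determined by its products with the roots, which are integers and bounded on the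
    polytope. *)
Lemma coweight_polytope_finite v0 : regular G R v0 -> finite_set
  (polytope G [fset a in R | 0 < bil G v0 a]%fset m `&` coweight_lattice G R).
Proof.
move=> rv0; set A := (_ `&` _).
have [M hM] : exists M : nat, forall a, a \in R -> bil G a (rho G R m a) < M%:R.
  apply: (@seq_uniform _ R (fun a M => bil G a (rho G R m a) < M%:R)).
    by move=> a k l kl h; apply: (lt_le_trans h); rewrite ler_nat.
  by move=> a aR; exists (Num.truncn (bil G a (rho G R m a))).+1; rewrite truncnS_gt.
pose P (f : {ffun R -> 'I_(M + M).+1}) nu := A nu /\ forall a : R, bil G nu (val a) = (f a)%:R - M%:R.
pose h f := xget 0 (P f).
apply: (@sub_finite_set _ _ (h @` setT)); last exact: finite_image.
move=> nu Anu; have [Pnu Lnu] := Anu.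
have hk (a : R) : exists k : 'I_(M + M).+1, bil G nu (val a) = k%:R - M%:R.
  have /intrP[k ek] := Lnu _ (valP a).
  have : `|bil G nu (val a)| < M%:R.
    by rewrite bilC //; apply: le_lt_trans (hM _ (valP a)); exact: (polytope_bound hG hR hm rv0).
  rewrite ek -intr_norm [M%:R]pmulrn ltr_int => hlt.
  have k0 : 0 <= k + M%:Z.
    by move: hlt; rewrite ltr_norml => /andP[h1 _]; rewrite -lerBlDr sub0r ltW.
  have kM : (absz (k + M%:Z)%R < (M + M).+1)%N.
    rewrite -ltz_nat gez0_abs //; move: hlt; rewrite ltr_norml => /andP[_ h2].
    by rewrite -addn1 !PoszD; lra.
  exists (Ordinal kM); rewrite /= -[X in X%:R - _]/(absz (k + M%:Z)).
  by rewrite [X in _ = X - _]pmulrn gez0_abs // rmorphD /= addrK.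
have /boolp.choice[f hf] := hk.
pose F : {ffun R -> 'I_(M + M).+1} := [ffun a => f a].
have PF : P F nu by split=> // a; rewrite ffunE.
exists F => //; have [_ e] : P F (h F) by apply: (xgetPex 0); exists nu.
by apply: root_bil_inj => a aR; rewrite -[a]/(val [` aR]%fset) e hf ffunE.
Qed.

Lemma dual_rootsP b : (b \in dual_roots G R) = (cv b \in R).
Proof.
apply/imfsetP/idP => [[a /= aR ->]|bR]; first by rewrite corootK.
by exists (cv b) => //; rewrite corootK.
Qed.

Lemma coroot_dual a : a \in R -> cv a \in dual_roots G R.
Proof. by move=> aR; rewrite dual_rootsP corootK. Qed.

Lemma reflection_coroot a u : a != 0 -> reflection G (cv a) u = reflection G a u.
Proof.
move=> a0; rewrite /reflection corootK // /coroot bilZr !scalerA.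
by congr (_ - _ *: _); ring.
Qed.

Lemma dual_root_system : root_system G (dual_roots G R).
Proof.
split.
- by rewrite dual_rootsP /coroot scaler0; case: hR.
- apply/vspaceP => v; rewrite memvf; have [f ->] := coroot_span v.
  rewrite big_seq; apply: memv_suml => a aR; apply: memvZ; apply: memv_span.
  exact: coroot_dual.
- move=> a b; rewrite !dual_rootsP => aR bR; rewrite -(corootK hG a) reflection_coroot ?(root_neq0 hR) //.
  rewrite coroot_reflection ?(root_neq0 hR) //.
  by case: hR => _ _ h _; exact: h.
- move=> a b; rewrite !dual_rootsP => aR bR.
  rewrite -{1}(corootK hG b) bilC //; exact: (cartan_int hR).
Qed.

Lemma dual_reduced : reduced (dual_roots G R).
Proof.
move=> b t; rewrite !dual_rootsP => bR tbR.
have b0 := root_neq0 hR bR.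
have t0 : t != 0.
  apply: contraTneq tbR => ->; rewrite scale0r /coroot scaler0.
  by case: hR.
have : t^-1 *: cv b \in R.
  rewrite (_ : _ *: _ = cv (t *: b)) // /coroot bilZl bilZr !scalerA; congr (_ *: _).
  have b0' : b != 0 by apply: contra b0 => /eqP->; rewrite /coroot scaler0.
  by field; rewrite t0 bil_neq0.
by move=> /(hred bR)[] /(congr1 GRing.inv); rewrite invrK ?invrN1 ?invr1 => ->; [left|right].
Qed.

Lemma dual_invariant (m' : 'rV[K]_n -> nat) : (forall a, a \in R -> m' (cv a) = m a) ->
  invariant_multiplicity G (dual_roots G R) m'.
Proof.
move=> hm' a b; rewrite !dual_rootsP => aR bR.
rewrite -(corootK hG a) reflection_coroot ?(root_neq0 hR) //.
rewrite -{1}(corootK hG b) -coroot_reflection ?(root_neq0 hR) // hm'; last first.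
  by case: hR => _ _ h _; exact: h.
by rewrite hm // -hm' // corootK.
Qed.

Lemma dual_regular v : regular G R v -> regular G (dual_roots G R) v.
Proof.
move=> rv b; rewrite dual_rootsP => bR; rewrite -(corootK hG b) bil_coroot_eq0 ?(root_neq0 hR) //.
exact: rv.
Qed.

Lemma dual_positive v :
  dual_roots G [fset a in R | 0 < bil G v a]%fset = [fset b in dual_roots G R | 0 < bil G v b]%fset.
Proof.
apply/fsetP => b; apply/imfsetP/idP => [[a /=]|].
  rewrite !inE /= => /andP[aR va] ->.
  by rewrite coroot_dual //= (bil_coroot_gt0 hG hR).
rewrite !inE /= dual_rootsP => /andP[bR vb]; exists (cv b); last by rewrite corootK.
by rewrite /= !inE /= bR /= -(bil_coroot_gt0 hG hR) // corootK.
Qed.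

End RootDataLattice.

(** * Edge and vertex coefficients *)

Lemma big_nat_split2 (T : Type) (idx : T) (op : Monoid.com_law idx) (m j : nat)
    (P : pred nat) (F : nat -> T) : (0 < j)%N -> (j <= m)%N ->
  \big[op/idx]_(0 <= i < m.+1 | P i) F i =
  op (if P 0%N then F 0%N else idx) (op (if P j then F j else idx)
    (\big[op/idx]_(i <- [seq i <- index_iota 0 m.+1 | (i != 0%N) && (i != j)] | P i) F i)).
Proof.
move=> j0 jm.
have jF : j \in [seq i <- index_iota 0 m.+1 | i != 0%N].
  by rewrite mem_filter mem_index_iota /= ltnS jm -lt0n j0.
rewrite big_mkcond (bigD1_seq 0%N) ?mem_index_iota ?iota_uniq // -big_filter.
rewrite (bigD1_seq _ jF) ?filter_uniq ?iota_uniq // -[in LHS]big_filter -filter_predI.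
rewrite -[in LHS]big_mkcond; congr (op _ (op _ _)); congr bigop.
by apply: eq_filter => i /=; rewrite andbC.
Qed.

Section Brackets.
Context (K : realType) (n : nat) (G : 'M[K]_n) (logq : K[i]).
Hypothesis hG : scalar_product G.
Hypothesis hq : forall k : nat, (0 < k)%N -> cexp logq ^+ k != 1.
Local Notation br := (qbracket logq).
Implicit Types (x y : 'rV[K[i]]_n) (t : K[i]).

Lemma ccont_cbil y : ccont (fun x => cbil G y x).
Proof.
apply: (ccont_ext (@ccont_mulmx _ _ (complexify G *m y^T))) => x.
by rewrite (cbilC hG) /cbil /bil mulmxA.
Qed.

Lemma ccont_qpow (f : 'rV[K[i]]_n -> K[i]) : ccont f -> ccont (fun x => qpow logq (f x)).
Proof. by move=> fc; apply: ccont_cexp; apply: ccontM => //; exact: ccont_cst. Qed.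

Lemma ccont_EE y : ccont (fun x => EE G logq y x).
Proof.
apply: ccont_qpow; apply: ccontM; first exact: ccont_cst.
exact: ccont_cbil.
Qed.

Lemma ccont_br (f : 'rV[K[i]]_n -> K[i]) : ccont f -> ccont (fun x => br (f x)).
Proof.
move=> fc; apply: ccontB; apply: ccont_qpow => //.
by apply: (ccont_ext (ccontB (ccont_cst 0) fc)) => x; rewrite sub0r.
Qed.

Definition qprod (t : K[i]) (i j : nat) : K[i] := \prod_(i <= k < j) br (k%:R + t).

Lemma qprod_cat t i j k : (i <= j)%N -> (j <= k)%N -> qprod t i k = qprod t i j * qprod t j k.
Proof. by move=> ij jk; rewrite /qprod (big_cat_nat ij jk). Qed.

Lemma qprod_nat_neq0 i j : (0 < i)%N -> qprod 0 i j != 0.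
Proof.
move=> i0; rewrite /qprod prodf_seq_neq0; apply/allP => k; rewrite mem_index_iota => /andP[ik _].
rewrite /= addr0 qbracket_eq0 -natrM qpow_nat hq // muln_gt0 /=.
exact: leq_trans ik.
Qed.

Lemma ccont_qprod (f : 'rV[K[i]]_n -> K[i]) i j : ccont f -> ccont (fun x => qprod (f x) i j).
Proof.
move=> fc; apply: ccont_prod => k _; apply: ccont_br; apply: ccontD => //; exact: ccont_cst.
Qed.

Lemma qprod_recr t i j : (i <= j)%N -> qprod t i j.+1 = qprod t i j * br (j%:R + t).
Proof. by move=> ij; rewrite /qprod big_nat_recr. Qed.

Lemma qprod_nil t i : qprod t i i = 1.
Proof. by rewrite /qprod big_geq. Qed.

(** With [prod_differences] it evaluates the two products into which [qtraceB] splits the node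
    differences of the Lagrange interpolation on an edge. *)
Lemma prod_descending t k j : \prod_(0 <= i < (k + j).+1) br (t + k%:R - i%:R) =
  qprod t 1 k.+1 * br t * ((-1) ^+ j * qprod (- t) 1 j.+1).
Proof.
elim: j => [|j IH].
  rewrite addn0 qprod_nil expr0 !mulr1 big_nat_recr //= addrK; congr (_ * _).
  elim: k => [|k IH]; first by rewrite big_geq ?qprod_nil.
  rewrite qprod_recr // big_nat_recl // -IH mulrC; congr (_ * br _); last by ring.
  by apply: eq_bigr => i _; congr (br _); rewrite -[k.+1]addn1 -[i.+1]addn1 !natrD; ring.
rewrite addnS big_nat_recr // IH (qprod_recr _ (ltn0Sn j)) exprS /=.
have -> : br (t + k%:R - (k + j).+1%:R) = - br (j.+1%:R - t).
  by rewrite -qbracketN; congr (br _); rewrite -addnS natrD; ring.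
by move: ((-1) ^+ j) => sg; ring.
Qed.

Lemma prod_differences k j : \prod_(0 <= i < (k + j).+1 | i != j) br (i%:R - j%:R) =
  (-1) ^+ j * qprod 0 1 j.+1 * qprod 0 1 k.+1.
Proof.
elim: j => [|j IH].
  rewrite addn0 qprod_nil !mul1r big_mkcond big_nat_recl //= mul1r /qprod big_add1 /=.
  by apply: eq_bigr => i _; rewrite subr0 addr0.
rewrite addnS big_mkcond big_nat_recl //= -big_mkcond /=.
have -> : \prod_(0 <= i < (k + j).+1 | i.+1 != j.+1) br (i.+1%:R - j.+1%:R) =
          \prod_(0 <= i < (k + j).+1 | i != j) br (i%:R - j%:R).
  apply: eq_big => i; first by rewrite eqSS.
  by move=> _; congr (br _); rewrite -[i.+1]addn1 -[j.+1]addn1 !natrD; ring.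
rewrite IH (qprod_recr _ (ltn0Sn _)) exprS sub0r qbracketN addr0.
by move: ((-1) ^+ j) => sg; ring.
Qed.

(* Lagrange interpolation through all nodes but 0 and j solves the rank one conditions. *)
Lemma rank_one_relation (m : nat) (e : nat -> K[i]) (y : K[i]) :
  (forall s, (1 <= s <= m)%N ->
     \sum_(0 <= i < m.+1) e i * br (s%:R * (y + m%:R - i%:R *+ 2)) = 0) ->
  br y != 0 ->
  forall j, (j <= m)%N ->
  e j * qprod 0 1 j.+1 * qprod 0 1 (m - j).+1 * qprod y 1 (m - j).+1 * qprod (- y) 1 j.+1 =
  e 0%N * qprod 0 1 m.+1 * qprod y 1 m.+1.
Proof.
move=> h y0 j jm.
case: (posnP j) => [->|j0].
  by rewrite subn0 !qprod_nil !mulr1.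
pose u i := y + m%:R - i%:R *+ 2.
pose r := [seq i <- index_iota 0 m.+1 | (i != 0%N) && (i != j)].
(* Vanishes at all nodes except possibly those of 0 and [j]; it has [m - 1] factors, so its degree
   is below [m]. *)
pose p := \prod_(i <- r) ('X - (qtrace logq (u i))%:P).
have jI : j \in index_iota 0 m.+1 by rewrite mem_index_iota.
have oI : 0%N \in index_iota 0 m.+1 by rewrite mem_index_iota.
have uI : uniq (index_iota 0 m.+1) by rewrite iota_uniq.
have jF : j \in [seq i <- index_iota 0 m.+1 | i != 0%N] by rewrite mem_filter jI -lt0n j0.
have oF : 0%N \in [seq i <- index_iota 0 m.+1 | i != j] by rewrite mem_filter oI ltn_eqF.
have uF P : uniq [seq i <- index_iota 0 m.+1 | P i] by rewrite filter_uniq.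
have sp : (size p <= m)%N.
  rewrite size_prod_XsubC /r.
  have ur : uniq (0%N :: j :: r).
    rewrite /= !inE !mem_filter !eqxx /= !andbF orbF (ltn_eqF j0) /=.
    by rewrite filter_uniq // iota_uniq.
  have := uniq_leq_size ur (s2 := index_iota 0 m.+1); rewrite size_iota subn0 /= ltnS => -> //.
  by move=> i; rewrite !inE => /or3P[/eqP->|/eqP->|] //; rewrite mem_filter => /andP[].
have pX a : p.[qtrace logq (u a)] =
    (\prod_(i <- r) br (y + m%:R - a%:R - i%:R)) * \prod_(i <- r) br (i%:R - a%:R).
  rewrite horner_prod -big_split /=; apply: eq_bigr => i _; rewrite hornerXsubC qtraceB /u.
  by congr (br _ * br _); field.
have := @qbracket_sum_horner _ logq _ (index_iota 0 m.+1) e u m p h sp.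
rewrite (@big_nat_split2 _ 0 +%R m j xpredT _ j0 jm) /= [X in _ + (_ + X)]big1_seq ?addr0; last first.
  move=> i /= ir.
  rewrite horner_prod (_ : \prod_(_ <- _) _ = 0) ?mulr0 //.
  apply/eqP; rewrite prodf_seq_eq0; apply/hasP; exists i => //.
  by rewrite /= hornerXsubC subrr.
rewrite !pX => h1.
have T0 := @big_nat_split2 _ 1 *%R m j xpredT (fun i => br (y + m%:R - 0%:R - i%:R)) j0 jm.
have Tj := @big_nat_split2 _ 1 *%R m j xpredT (fun i => br (y + m%:R - j%:R - i%:R)) j0 jm.
have e1 : e 0%N * (\prod_(0 <= i < m.+1) br (y + m%:R - 0%:R - i%:R)) *
      (\prod_(i <- r) br (i%:R - 0%:R)) +
   e j * (\prod_(0 <= i < m.+1) br (y + m%:R - j%:R - i%:R)) *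
      (\prod_(i <- r) br (i%:R - j%:R)) = 0.
  rewrite T0 Tj /= -[RHS](mulr0 (br (y + m%:R - j%:R))) -[X in _ = _ * X]h1 /u.
  have -> : y + m%:R - 0%:R - j%:R = y + m%:R - j%:R by ring.
  have -> : y + m%:R - j%:R - 0%:R = y + m%:R - j%:R by ring.
  have -> : y + m%:R - 0%:R - 0%:R = y + m%:R - 0%:R *+ 2 by ring.
  have -> : y + m%:R - j%:R - j%:R = y + m%:R - j%:R *+ 2 by ring.
  by ring.
(* In both products multiplication by [[j]] restores, up to sign, the factor that [r] leaves out. *)
have W0 : \prod_(i <- r) br (i%:R - 0%:R) * br j%:R = qprod 0 1 m.+1.
  have := prod_differences m 0; rewrite addn0 expr0 qprod_nil !mul1r => <-.
  rewrite (@big_nat_split2 _ 1 *%R m j _ _ j0 jm) /= mul1r -lt0n j0 subr0 mulrC.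
  congr (_ * _); rewrite big_seq [RHS]big_seq_cond; apply: eq_bigl => i.
  by rewrite andbC mem_filter; case: eqP.
have Wj : \prod_(i <- r) br (i%:R - j%:R) * br j%:R =
    - ((-1) ^+ j * qprod 0 1 j.+1 * qprod 0 1 (m - j).+1).
  have := prod_differences (m - j) j; rewrite subnK // => <-.
  rewrite (@big_nat_split2 _ 1 *%R m j _ _ j0 jm) /= (ltn_eqF j0) eqxx /=.
  rewrite mul1r sub0r qbracketN mulNr opprK mulrC.
  congr (_ * _); rewrite big_seq [RHS]big_seq_cond; apply: eq_bigl => i.
  by rewrite andbC mem_filter; case: (i =P j); rewrite ?andbF.
have P0 : \prod_(0 <= i < m.+1) br (y + m%:R - 0%:R - i%:R) = qprod y 1 m.+1 * br y.
  have := prod_descending y m 0; rewrite addn0 qprod_nil expr0 !mulr1 => <-.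
  by apply: eq_bigr => i _; rewrite subr0.
have Pj : \prod_(0 <= i < m.+1) br (y + m%:R - j%:R - i%:R) =
    qprod y 1 (m - j).+1 * br y * ((-1) ^+ j * qprod (- y) 1 j.+1).
  have := prod_descending y (m - j) j; rewrite subnK // => <-.
  by apply: eq_bigr => i _; rewrite natrB //; congr (br _); ring.
have := congr1 (fun t => t * br j%:R) e1.
rewrite mul0r mulrDl -2!mulrA W0 -mulrA -mulrA Wj P0 Pj => e2.
have sg : (-1) ^+ j * (-1) ^+ j = 1 :> K[i] by rewrite -exprMn mulrNN mulr1 expr1n.
move: ((-1) ^+ j) sg e2 => s s2 e2.
have ej : e j = s * s * e j by rewrite s2 mul1r.
apply: (mulIf y0); apply/eqP; rewrite -subr_eq0; apply/eqP.
transitivity (- (e 0%N * (qprod y 1 m.+1 * br y * qprod 0 1 m.+1) +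
    e j * (qprod y 1 (m - j).+1 * br y * (s * qprod (- y) 1 j.+1) *
     - (s * qprod 0 1 j.+1 * qprod 0 1 (m - j).+1)))); last by rewrite e2 oppr0.
by rewrite [in LHS]ej; ring.
Qed.

End Brackets.

Lemma sum_supported (V : nmodType) (T : eqType) (s S : seq T) (F : T -> V) :
  (forall i, i \notin S -> F i = 0) -> \sum_(i <- s) F i = \sum_(i <- s | i \in S) F i.
Proof.
move=> h; rewrite [RHS]big_mkcond; apply: eq_bigr => i _.
by case: ifPn => // /h.
Qed.

Section Leading.
Context (K : realType) (n : nat) (G : 'M[K]_n) (logq : K[i]).
Context (R : {fset 'rV[K]_n}) (m : 'rV[K]_n -> nat).
Local Notation cx := (@complexify K 1 n).

(** The prescribed normalisation, for the positive system of [v]; [vertex_coefficient] shows that it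
    is the coefficient at the vertex of every chamber. *)
Definition leading (v : 'rV[K]_n) (x : 'rV[K[i]]_n) : K[i] :=
  \prod_(a <- R | 0 < bil G v a) qprod logq (- cbil G (cx a) x) 1 (m a).+1.

(** [c] is extended by 0 outside the lattice points [S], so that coefficients make sense at every
    vector, in particular at all points of an edge. *)
Record ba_data (v0 : 'rV[K]_n) (S : {fset 'rV[K]_n}) (c : 'rV[K]_n -> 'rV[K[i]]_n -> K[i])
    (psi : 'rV[K[i]]_n -> 'rV[K[i]]_n -> K[i]) : Prop := BaData {
  ba_regular : regular G R v0;
  ba_supp : forall nu, nu \in S <-> polytope G [fset a in R | 0 < bil G v0 a]%fset m nu /\
                                    coweight_lattice G R nu;
  ba_zero : forall nu x, nu \notin S -> c nu x = 0;
  ba_cont : forall nu, ccont (c nu);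
  ba_exp : forall x z, psi x z = \sum_(nu <- S) c nu x * EE G logq (x + cx nu) z;
  ba_qi : forall a x, a \in R -> quasi_invariant G logq a (m a) (psi x);
  ba_norm : forall x, c (rho G R m v0) x = leading v0 x }.
End Leading.

(** * Coefficients along an edge *)

Section Edges.
Context (K : realType) (n : nat) (G : 'M[K]_n) (logq : K[i]).
Hypothesis hG : scalar_product G.
Hypothesis hq : forall k : nat, (0 < k)%N -> cexp logq ^+ k != 1.
Context (R : {fset 'rV[K]_n}) (m : 'rV[K]_n -> nat).
Hypothesis hR : root_system G R.
Hypothesis hred : reduced R.
Hypothesis hm : invariant_multiplicity G R m.
Context (v0 : 'rV[K]_n) (S : {fset 'rV[K]_n}) (c : 'rV[K]_n -> 'rV[K[i]]_n -> K[i]).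
Context (psi : 'rV[K[i]]_n -> 'rV[K[i]]_n -> K[i]).
Hypothesis ba : ba_data G logq R m v0 S c psi.
Implicit Types (a b u v w nu : 'rV[K]_n) (x y z : 'rV[K[i]]_n).
Local Notation cx := (@complexify K 1 n).
Local Notation cv := (coroot G).
Local Notation br := (qbracket logq).
Local Notation qprod := (qprod logq).
Local Notation rho := (rho G R m).
Local Notation leading := (leading G logq R m).

Let rv0 : regular G R v0. Proof. by case: ba. Qed.

Lemma ba_coweight nu a : nu \in S -> a \in R -> bil G nu a \is a Num.int.
Proof. by move=> /(ba_supp ba)[_ h] /h. Qed.

Lemma ba_polytope nu : nu \in S -> polytope G [fset a in R | 0 < bil G v0 a]%fset m nu.
Proof. by move=> /(ba_supp ba)[]. Qed.

Lemma ba_string a nu0 x s : a \in R -> bil G nu0 a \is a Num.int -> (1 <= s <= m a)%N ->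
  \sum_(nu <- S | inZ (cv a) (nu - nu0)) c nu x * br (s%:R * cbil G (x + cx nu) (cx a)) = 0.
Proof.
move=> aR hnu0 sm; apply: (string_relation hG hq (root_neq0 hR aR) (ba_exp ba x) _ _ sm).
  exact: (ba_qi ba).
by move=> nu nuS; rewrite bilBl rpredB // ba_coweight.
Qed.

Lemma rho_in_support v : regular G R v -> rho v \in S.
Proof.
move=> rv; apply/(ba_supp ba); split; first exact: (rho_polytope hG hR hm rv0).
exact: (rho_coweight hG hR hred hm).
Qed.

Lemma leading_ccont v : ccont (leading v).
Proof.
apply: ccont_prod => a _; apply: ccont_qprod.
apply: (ccont_ext (ccontB (ccont_cst 0) (ccont_cbil hG (cx a)))) => x; by rewrite sub0r.
Qed.

Lemma leading_wall u b v x : b \in R -> wall G R u b -> close_to G R u b v -> 0 < bil G v b ->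
  leading v x = leading u x * qprod (- cbil G (cx b) x) 1 (m b).+1.
Proof.
move=> bR [ub uw] cl vb.
rewrite /leading !(big_rem b bR) /= vb ub ltxx mul1r mulrC; congr (_ * _).
rewrite big_seq_cond [RHS]big_seq_cond.
have unb a : a \in rem b R -> a != b by rewrite mem_rem_uniq ?fset_uniq // !inE => /andP[].
apply: eq_bigl => a; case ar: (a \in rem b R) => //=.
have ab := unb a ar; have aR := mem_rem ar.
case: (eqVneq a (- b)) => [->|anb].
  by rewrite !bilNr ub oppr0 ltxx oppr_gt0 ltNge ltW.
by rewrite -[LHS]sgr_gt0 -[RHS]sgr_gt0 cl.
Qed.

Lemma wall_side u b : b \in R -> wall G R u b ->
  exists2 v, close_to G R u b v & 0 < bil G v b.
Proof.
move=> bR [ub uw]; have [e e0 he] := perturb G R u b.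
exists (u + e *: b); last by rewrite bilDl ub add0r bilZl mulr_gt0 // bil_gt0 // (root_neq0 hR).
by move=> a aR ab anb; apply: (he e e0 (lexx _) a aR); exact: uw.
Qed.

Lemma close_regular u b v : b \in R -> wall G R u b -> close_to G R u b v -> 0 < bil G v b ->
  regular G R v.
Proof.
move=> bR [ub uw] cl vb a aR; case: (eqVneq a b) => [->|ab]; first by rewrite lt0r_neq0.
case: (eqVneq a (- b)) => [->|anb]; first by rewrite bilNr oppr_eq0 lt0r_neq0.
by rewrite -sgr_eq0 cl // sgr_eq0 uw.
Qed.

Section Edge.
Variables (u b : 'rV[K]_n).
Hypothesis bR : b \in R.
Hypothesis hu : wall G R u b.
Let M := m b.
Let b0 : b != 0 := root_neq0 hR bR.

(** [p] runs from 0 at the end point on the side of [b] to [M] at the other one. It is real, because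
    coweights on an edge may have half-integral parameters. *)
Definition edge (p : K) : 'rV[K]_n := rho u + (M%:R / 2 - p) *: cv b.

Lemma edge_inj : injective edge.
Proof.
move=> p p' /addrI /eqP; rewrite -subr_eq0 -scalerBl scaler_eq0 (negPf (coroot_neq0 hG b0)) orbF.
by rewrite (_ : _ - _ = p' - p); [rewrite subr_eq0 => /eqP|ring].
Qed.

Lemma edge_shift p t : edge p + t *: cv b = edge (p - t).
Proof. by rewrite /edge -addrA -scalerDl; congr (_ + _ *: _); ring. Qed.

Lemma edge_bil p : bil G (edge p) b = M%:R - 2 * p.
Proof.
rewrite /edge bilDl (reflection_rho hG hR hm bR (proj1 hu)) add0r bilZl bil_coroot_self //.
by field.
Qed.

Lemma edge0 v : close_to G R u b v -> 0 < bil G v b -> rho v = edge 0.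
Proof. by move=> cl vb; rewrite (rho_wall hG hR hm bR hu cl vb) /edge subr0. Qed.

Lemma edge0_supp : edge 0 \in S.
Proof.
have [v cl vb] := wall_side bR hu.
by rewrite -(edge0 cl vb); apply: rho_in_support; exact: (close_regular bR hu cl vb).
Qed.

Lemma edge_range p : edge p \in S -> 0 <= p <= M%:R.
Proof.
move=> eS; have := ba_polytope eS.
move=> /(polytope_edge hG hR hm rv0 bR hu)[].
  rewrite /edge bilDr (bilZr _ (_ - _)); have /eqP -> : bil G u (cv b) == 0.
    by rewrite bil_coroot_eq0 // (proj1 hu).
  by rewrite mulr0 addr0.
move=> t ht /addrI /eqP; rewrite -subr_eq0 -scalerBl scaler_eq0.
rewrite (negPf (coroot_neq0 hG b0)) orbF subr_eq0 => /eqP e.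
by move: ht; rewrite -e ler_norml => /andP[h1 h2]; apply/andP; split; lra.
Qed.

(** A string through a nonzero coefficient has length at least [M] and must fit into [0, M], so it
    contains both end points. *)
Lemma edge_nonint p x : p \isn't a Num.int -> c (edge p) x = 0.
Proof.
move=> pZ; have [eS|] := boolP (edge p \in S); last exact: (ba_zero ba).
have hb a : a \in [:: b] -> bil G b a != 0 by rewrite inE => /eqP->; exact: bil_neq0.
apply: (@generic_zero _ _ _ _ hq S [:: b] b (c (edge p)) x (ba_cont ba _) hb) => t y gen.
apply/eqP; apply: contraNT pZ => cy.
have h s : (1 <= s <= m b)%N -> \sum_(nu <- S | inZ (cv b) (nu - edge p))
    c nu y * br (s%:R * cbil G (y + cx nu) (cx b)) = 0.
  by apply: ba_string => //; exact: ba_coweight.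
have := string_support hG hq (fset_uniq S) b0 (gen b (mem_head _ _)) h eS cy.
move=> /(string_spread (fset_uniq S) (coroot_neq0 hG b0))[k [l [kS lS kl]]].
move: kS lS; rewrite !mem_filter !edge_shift => /andP[_ /edge_range/andP[k1 _]].
move=> /andP[_ /edge_range/andP[_ l2]].
have -> : p = k%:~R by apply/eqP; rewrite eq_le; apply/andP; split; lra.
exact: intr_int.
Qed.

Lemma edge_string x s : (1 <= s <= M)%N ->
  \sum_(0 <= i < M.+1) c (edge i%:R) x * br (s%:R * (cbil G (cx b) x + M%:R - i%:R *+ 2)) = 0.
Proof.
move=> sm; rewrite -[RHS](@ba_string b (edge 0) x s bR (ba_coweight edge0_supp bR) sm).
pose F nu := c nu x * br (s%:R * cbil G (x + cx nu) (cx b)).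
have e i : c (edge i%:R) x * br (s%:R * (cbil G (cx b) x + M%:R - i%:R *+ 2)) = F (edge i%:R).
  rewrite /F cbilDl (cbilC hG x) cbil_complexify edge_bil rmorphB rmorphM /= !rmorph_nat.
  by congr (_ * br (_ * _)); ring.
under eq_bigr do rewrite e.
rewrite -(big_map (fun i => edge i%:R) xpredT F) -/F.
have F0 nu : nu \notin S -> F nu = 0 by move=> nS; rewrite /F (ba_zero ba _ nS) mul0r.
rewrite (sum_supported _ F0).
rewrite -big_filter -[RHS]big_filter; apply: perm_big; apply: uniq_perm.
- rewrite filter_uniq // map_inj_uniq ?iota_uniq // => i j /edge_inj /eqP.
  by rewrite eqr_nat => /eqP.
- by rewrite filter_uniq ?fset_uniq.
move=> nu; rewrite !mem_filter andbC; case nuS: (nu \in S); rewrite ?andbF ?andbT //.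
apply/mapP/asboolP => [[i _ ->]|[k ek]].
  exists (- i%:Z); rewrite -[edge i%:R](_ : edge 0 + (- i%:R) *: cv b = _).
    by rewrite addrC addrA addNr add0r mulrNz.
  by rewrite edge_shift opprK add0r.
have enu : nu = edge (- k%:~R) by rewrite -sub0r -edge_shift -ek addrC subrK.
have := nuS; rewrite enu => /edge_range /andP[k0 kM].
have k0' : 0 <= - k by rewrite -(ler_int K) rmorphN.
exists (absz (- k)); last by rewrite -mulrNz [(absz _)%:R]pmulrn gez0_abs.
rewrite mem_index_iota /= ltnS -lez_nat gez0_abs // -(ler_int K) rmorphN /=.
by rewrite -pmulrn.
Qed.

(* [N] is the part of the vertex normalisation that does not involve the direction b
   of the edge. *)
Lemma edge_formula (N : 'rV[K[i]]_n -> K[i]) : ccont N ->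
  (forall x, c (edge 0) x = N x * qprod (- cbil G (cx b) x) 1 M.+1) ->
  forall j x, (j <= M)%N ->
  c (edge j%:R) x * (qprod 0 1 j.+1 * qprod 0 1 (M - j).+1) =
  N x * qprod 0 1 M.+1 * (qprod (- cbil G (cx b) x) j.+1 M.+1 * qprod (cbil G (cx b) x) (M - j).+1 M.+1).
Proof.
move=> cN eN j x jM; pose y x := cbil G (cx b) x.
apply/eqP; rewrite -subr_eq0; apply/eqP.
pose f x := c (edge j%:R) x * (qprod 0 1 j.+1 * qprod 0 1 (M - j).+1) -
  N x * qprod 0 1 M.+1 * (qprod (- y x) j.+1 M.+1 * qprod (y x) (M - j).+1 M.+1).
have cy : ccont y by exact: ccont_cbil.
have cNy : ccont (fun x => - y x).
  by apply: (ccont_ext (ccontB (ccont_cst 0) cy)) => z; rewrite sub0r.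
have fc : ccont f.
  apply: ccontB; apply: ccontM; rewrite ?ccont_cst //; first exact: (ba_cont ba).
  - exact: ccont_cst.
  - by apply: ccontM => //; exact: ccont_cst.
  - by apply: ccontM; exact: ccont_qprod.
(* Not exponents of [psi]: genericity for this progression says that [[i + y]] is nonzero for all
   integers [i] from [- M] to [M], the factors to be cancelled below. *)
pose T := [seq ((k%:R - M%:R) / 2) *: cv b | k <- iota 0 (M + M).+1].
have hb a : a \in [:: b] -> bil G b a != 0 by rewrite inE => /eqP->; exact: bil_neq0.
apply: (generic_zero hq (S := T) fc hb (x := x)) => t w gen; rewrite /f -/(y w).
have hT k : (k <= M + M)%N -> br (k%:R - M%:R + y w) != 0.
  move=> kM; have kT : ((k%:R - M%:R) / 2) *: cv b \in T.
    by apply/mapP; exists k; rewrite // mem_iota add0n.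
  have := gen b (mem_head _ _) _ _ kT kT; rewrite qbracket_eq0; apply: contra => /eqP e.
  apply/eqP; rewrite -[RHS]e; congr (qpow _ _).
  rewrite bilDl bilZl bil_coroot_self // divfK ?pnatr_eq0 // /y (cbilC hG w).
  by rewrite rmorphD rmorphB /= !rmorph_nat; ring.
have U0 i : (i <= M)%N -> br (i%:R + y w) != 0.
  move=> iM; have := hT (i + M)%N; rewrite leq_add2r iM => /(_ isT).
  by rewrite natrD addrK.
have D0 i : (i <= M)%N -> br (i%:R - y w) != 0.
  move=> iM; rewrite -oppr_eq0 -qbracketN.
  have := hT (M - i)%N; rewrite (leq_trans (leq_subr _ _)) ?leq_addr // => /(_ isT).
  by rewrite natrB //; congr (br _ != 0); ring.
have hU : qprod (y w) 1 (M - j).+1 != 0.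
  rewrite prodf_seq_neq0; apply/allP => k; rewrite mem_index_iota ltnS => /andP[_ kM].
  by rewrite /= U0 // (leq_trans kM) // leq_subr.
have hD : qprod (- y w) 1 j.+1 != 0.
  rewrite prodf_seq_neq0; apply/allP => k; rewrite mem_index_iota ltnS => /andP[_ kj].
  by rewrite /= D0 // (leq_trans kj).
have y0 : br (y w) != 0 by have := U0 0%N (leq0n _); rewrite add0r.
have h := @rank_one_relation _ logq M (fun i => c (edge i%:R) w) (y w) (edge_string w) y0 j jM.
rewrite eN -/(y w) in h.
rewrite (@qprod_cat _ _ _ 1 j.+1 M.+1) // (@qprod_cat _ _ (y w) 1 (M - j).+1 M.+1) // in h; last first.
  by rewrite ltnS leq_subr.
apply: (mulfI hU); apply: (mulfI hD); rewrite !mulr0.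
move/eqP: h; rewrite -subr_eq0 => /eqP h; rewrite -[RHS]h; ring.
Qed.

End Edge.
End Edges.

(** * Brackets shifted by half periods *)

Section Periods.
Context (K : realType) (logq : K[i]).
Local Notation qp := (qpow logq).
Local Notation br := (qbracket logq).
Local Notation qprod := (qprod logq).
Implicit Types (t w : K[i]).

Lemma qpow_int_period t k : qp t = 1 -> qp (k%:~R * t) = 1.
Proof.
move=> t1; have h (j : nat) : qp (j%:R * t) = 1 by rewrite mulr_natl qpowMn t1 expr1n.
case: k => k; first by rewrite -pmulrn h.
by rewrite NegzE mulrNz -pmulrn mulNr qpowN h invr1.
Qed.

Lemma qpow_half_period w : qp (2 * w) = 1 -> qp (- w) = qp w.
Proof.
move=> w1; apply: (mulIf (qpow_neq0 logq w)); rewrite -!qpowD addNr qpow0 -w1.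
by congr (qp _); ring.
Qed.

Lemma qbracket_half_period t w : qp (2 * w) = 1 -> br (t + w) = qp w * br t.
Proof.
move=> w1; rewrite /qbracket opprD !qpowD (qpow_half_period w1); ring.
Qed.

Lemma qpow_sum (I : Type) (r : seq I) (P : pred I) (F : I -> K[i]) :
  qp (\sum_(i <- r | P i) F i) = \prod_(i <- r | P i) qp (F i).
Proof. by elim/big_rec2: _ => [|i y z _ <-]; rewrite ?qpow0 ?qpowD. Qed.

Lemma qprod_half_period t w i j : qp (2 * w) = 1 -> (i <= j)%N ->
  qprod (t + w) i j = qp ((j - i)%:R * w) * qprod t i j.
Proof.
move=> w1 ij; rewrite mulr_natl qpowMn -prodr_const_nat -big_split /=.
by apply: eq_bigr => k _; rewrite addrA qbracket_half_period.
Qed.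

Lemma qprod_addn t s i j : qprod (t + s%:R) i j = qprod t (i + s) (j + s).
Proof.
rewrite /qprod big_addn addnK; apply: eq_bigr => k _; congr (br _).
by rewrite natrD; ring.
Qed.

Lemma qprod_subn t s i j : qprod (t - s%:R) (i + s) (j + s) = qprod t i j.
Proof. by rewrite -qprod_addn subrK. Qed.

Lemma qprod_vanish s i j : (i <= s)%N -> (s < j)%N -> qprod (- s%:R) i j = 0.
Proof.
move=> si sj; apply/eqP; rewrite prodf_seq_eq0; apply/hasP; exists s.
  by rewrite mem_index_iota si.
by rewrite /= subrr qbracket0.
Qed.

End Periods.

(** * Vertex coefficients by crossing walls *)

Section Walk.
Context (K : realType) (n : nat) (G : 'M[K]_n) (logq : K[i]).
Hypothesis hG : scalar_product G.
Hypothesis hq : forall k : nat, (0 < k)%N -> cexp logq ^+ k != 1.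
Context (R : {fset 'rV[K]_n}) (m : 'rV[K]_n -> nat).
Hypothesis hR : root_system G R.
Hypothesis hred : reduced R.
Hypothesis hm : invariant_multiplicity G R m.
Context (v0 : 'rV[K]_n) (S : {fset 'rV[K]_n}) (c : 'rV[K]_n -> 'rV[K[i]]_n -> K[i]).
Context (psi : 'rV[K[i]]_n -> 'rV[K[i]]_n -> K[i]).
Hypothesis ba : ba_data G logq R m v0 S c psi.
Implicit Types (a b u v w nu : 'rV[K]_n) (x y z : 'rV[K[i]]_n).
Local Notation cx := (@complexify K 1 n).
Local Notation qprod := (qprod logq).
Local Notation rho := (rho G R m).
Local Notation leading := (leading G logq R m).
Local Notation edge := (edge G R m).

(** This is [edge_formula] at the far end [j = m b], where only the factor of the edge direction
    changes, from [b] to [- b]. *)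
Lemma vertex_step u b v v' : b \in R -> wall G R u b ->
  close_to G R u b v -> 0 < bil G v b -> close_to G R u b v' -> bil G v' b < 0 ->
  (forall x, c (rho v) x = leading v x) -> forall x, c (rho v') x = leading v' x.
Proof.
move=> bR wu cl vb cl' vb' V x.
have nbR : - b \in R by rewrite (root_opp hG hR).
have vb'' : 0 < bil G v' (- b) by rewrite bilNr oppr_gt0.
have cl'' := close_opp cl'.
have e0 := edge0 hG hR hm bR wu cl vb.
have := edge_formula hG hq hR hred hm ba bR wu
  (leading_ccont logq hG R m u).
have h y : c (edge u b 0) y = leading u y * qprod (- cbil G (cx b) y) 1 (m b).+1.
  by rewrite -e0 V; exact: (leading_wall _ _ _ bR wu cl vb).
move=> /(_ h (m b) x (leqnn _)).
rewrite subnn !qprod_nil mulr1 mul1r => e'.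
have nz := qprod_nat_neq0 hq (m b).+1 (ltn0Sn 0).
have {e'}e : c (edge u b (m b)%:R) x = leading u x * qprod (cbil G (cx b) x) 1 (m b).+1.
  by apply: (mulIf nz); rewrite e'; ring.
rewrite (leading_wall _ _ _ nbR (wall_opp wu) cl'' vb'').
rewrite (mult_opp hG hR hm bR) complexifyN [cbil _ _ _]bilNl opprK -e; congr (c _ _).
rewrite (rho_wall hG hR hm nbR (wall_opp wu) cl'' vb'') (mult_opp hG hR hm bR).
rewrite corootN scalerN /edge -scaleNr; congr (_ + _ *: _).
by field.
Qed.

Lemma sign_determines v v' : (forall a, a \in R -> (0 < bil G v a) = (0 < bil G v' a)) ->
  rho v = rho v' /\ forall x, leading v x = leading v' x.
Proof.
move=> h; split=> [|x]; rewrite /rho /leading.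
  congr (_ *: _); rewrite big_seq_cond [RHS]big_seq_cond; apply: eq_bigl => a.
  by case aR: (a \in R) => //=; rewrite h.
rewrite big_seq_cond [RHS]big_seq_cond; apply: eq_bigl => a.
by case aR: (a \in R) => //=; rewrite h.
Qed.

(** Induction on the number of roots positive on [v] and negative on [v0]: beyond the first wall on
    the way from [v] to [v0] there are fewer of them. *)
Lemma vertex_coefficient v x : regular G R v -> c (rho v) x = leading v x.
Proof.
have rv0 : regular G R v0 by case: ba.
pose sep v := [seq a <- R | (0 < bil G v a) && (bil G v0 a < 0)].
move: {2}(size (sep v)) (leqnn (size (sep v))) => k.
elim: k v x => [|k IH] v x szv rv.
  have [|-> ->] := @sign_determines v v0; last exact: (ba_norm ba).
  have h a : a \in R -> 0 < bil G v a -> 0 < bil G v0 a.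
    move=> aR va; rewrite lt_neqAle eq_sym rv0 //= leNgt; apply/negP => v0a.
    have : a \in sep v by rewrite mem_filter va v0a.
    by move: szv; rewrite leqn0 size_eq0 => /eqP->.
  move=> a aR; apply/idP/idP; first exact: h.
  move=> v0a; rewrite lt_neqAle eq_sym rv //= leNgt; apply/negP => va.
  have := h (- a); rewrite (root_opp hG hR) !bilNr !oppr_gt0 => /(_ aR va).
  by rewrite ltNge ltW.
(* Perturbing [v] inside its chamber makes the ratios of distinct separating roots differ, so that
   exactly one wall is met first. *)
pose D := [seq d <- [seq bil G v0 ab.1 *: ab.2 - bil G v0 ab.2 *: ab.1 |
   ab <- [seq (a, b) | a <- R, b <- R]] | d != 0].
have [|v1 [_ v1s v1D]] := @generic_near _ _ _ hG 0 v R D.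
  by move=> d; rewrite mem_filter /orth_proj scaler0 subr0 => /andP[].
have vv1 a : a \in R -> (0 < bil G v a) = (0 < bil G v1 a).
  by move=> aR; rewrite -[LHS]sgr_gt0 -[RHS]sgr_gt0 v1s // rv.
have rv1 : regular G R v1 by move=> a aR; rewrite -sgr_eq0 v1s ?sgr_eq0 ?rv.
have [-> ->] := sign_determines vv1.
have sepE : sep v = sep v1.
  by rewrite /sep; apply: eq_in_filter => a aR; rewrite vv1.
rewrite sepE in szv.
case E : (sep v1) => [|b1 l].
  by apply: IH => //; rewrite E.
have b1s : b1 \in sep v1 by rewrite E mem_head.
pose ratio a := bil G v1 a / - bil G v0 a.
have [b bs hmin] := seq_argmax (fun a => - ratio a) b1s.
have [v1b v0b bR] : [/\ 0 < bil G v1 b, bil G v0 b < 0 & b \in R].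
  by move: bs; rewrite mem_filter => /andP[/andP[? ?] ?].
pose t := ratio b.
have t0 : 0 < t by rewrite divr_gt0 // oppr_gt0.
pose u := v1 + t *: v0.
have ub : bil G u b = 0.
  by rewrite /u bilDl bilZl /t /ratio; field; rewrite lt_eqF.
have upos a : a \in R -> a != b -> a != - b -> 0 < bil G v1 a -> 0 < bil G u a.
  move=> aR ab anb v1a; rewrite /u bilDl bilZl.
  case: (ltrgt0P (bil G v0 a)) (rv0 a aR) => // v0a _.
    by rewrite addr_gt0 // mulr_gt0.
  have as_ : a \in sep v1 by rewrite mem_filter v1a v0a.
  have le : t <= ratio a by rewrite -lerN2; exact: hmin.
  have ra : bil G v1 a = ratio a * - bil G v0 a by rewrite /ratio divfK // oppr_eq0 rv0.
  rewrite ra (_ : _ + _ = (ratio a - t) * - bil G v0 a); last by ring.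
  rewrite pmulr_lgt0 ?oppr_gt0 // subr_gt0 lt_neqAle le andbT; apply/eqP => te.
  pose d := bil G v0 b *: a - bil G v0 a *: b.
  have d0 : d == 0.
    apply: contraT => d0; have /v1D : d \in D.
      rewrite mem_filter d0; apply/mapP; exists (b, a) => //.
      by apply/allpairsP; exists (b, a).
    rewrite /d bilBr !bilZr ra -te /t /ratio => /eqP; case; field.
    by rewrite lt_eqF.
  have : a = (bil G v0 a / bil G v0 b) *: b.
    move: d0; rewrite subr_eq0 => /eqP e; apply: (scalerI (a := bil G v0 b)).
      by rewrite lt_eqF.
    by rewrite e scalerA mulrCA divff ?mulr1 // lt_eqF.
  by move=> /(root_proportional hred bR aR)[] e; move: ab anb; rewrite e eqxx.
have sgu a : a \in R -> a != b -> a != - b -> Num.sg (bil G v1 a) = Num.sg (bil G u a).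
  move=> aR ab anb; case: (ltrgt0P (bil G v1 a)) (rv1 a aR) => // v1a _.
    by rewrite !gtr0_sg // upos.
  have : 0 < bil G u (- a).
    apply: upos; rewrite ?(root_opp hG hR) // ?bilNr ?oppr_gt0 //.
      by rewrite eqr_oppLR.
    by rewrite (inj_eq (@oppr_inj _)).
  by rewrite bilNr oppr_gt0 => ua; rewrite !ltr0_sg.
have wu : wall G R u b.
  by split=> // a aR ab anb; rewrite -sgr_eq0 -sgu // sgr_eq0 rv1.
have nbR : - b \in R by rewrite (root_opp hG hR).
(* [v2] lies just beyond the wall. The step is taken backwards, from [v2], which [b] does not
   separate from [v0], to [v1]. *)
have [v2 cl2 v2b] := wall_side hG hR nbR (wall_opp wu).
have rv2 := close_regular nbR (wall_opp wu) cl2 v2b.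
apply: (vertex_step nbR (wall_opp wu) cl2 v2b _ _ _).
- by apply: close_opp => a aR ab anb; rewrite sgu.
- by rewrite bilNr oppr_lt0.
move=> {}x; apply: IH => //; rewrite -ltnS; apply: leq_trans szv.
have us w : uniq (sep w) by rewrite filter_uniq // fset_uniq.
have usb : uniq (b :: sep v2).
  rewrite /= us andbT mem_filter; move: v2b; rewrite bilNr oppr_gt0 => h.
  by rewrite [0 < _]ltNge ltW.
have sub : {subset b :: sep v2 <= sep v1}.
  move=> a; rewrite inE => /orP[/eqP->//|]; rewrite !mem_filter => /andP[/andP[v2a v0a] aR].
  rewrite v0a aR !andbT.
  have ab : a != b.
    by apply: contraTneq v2a => ->; rewrite -leNgt ltW //; move: v2b; rewrite bilNr oppr_gt0.
  have anb : a != - b.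
    by apply: contraTneq v0a => ->; rewrite bilNr oppr_lt0 -leNgt ltW.
  by rewrite -sgr_gt0 sgu // -cl2 ?opprK // sgr_gt0.
exact: uniq_leq_size usb sub.
Qed.

End Walk.

(** * Quasi-invariance in the first variable *)

Section DualQuasiInvariance.
Context (K : realType) (n : nat) (G : 'M[K]_n) (logq : K[i]).
Hypothesis hG : scalar_product G.
Hypothesis hq : forall k : nat, (0 < k)%N -> cexp logq ^+ k != 1.
Context (R : {fset 'rV[K]_n}) (m : 'rV[K]_n -> nat).
Hypothesis hR : root_system G R.
Hypothesis hred : reduced R.
Hypothesis hm : invariant_multiplicity G R m.
Context (v0 : 'rV[K]_n) (S : {fset 'rV[K]_n}) (c : 'rV[K]_n -> 'rV[K[i]]_n -> K[i]).
Context (psi : 'rV[K[i]]_n -> 'rV[K[i]]_n -> K[i]).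
Hypothesis ba : ba_data G logq R m v0 S c psi.
Implicit Types (a b u v w nu : 'rV[K]_n) (x y z : 'rV[K[i]]_n).
Local Notation cx := (@complexify K 1 n).
Local Notation cv := (coroot G).
Local Notation qp := (qpow logq).
Local Notation qprod := (qprod logq).
Local Notation rho := (rho G R m).
Local Notation leading := (leading G logq R m).
Local Notation edge := (edge G R m).

Section Wall.
Variables (u b : 'rV[K]_n) (s : nat) (y : 'rV[K[i]]_n).
Hypothesis bR : b \in R.
Hypothesis hu : wall G R u b.
Hypothesis sm : (1 <= s <= m b)%N.
Hypothesis hy : qp (2 * cbil G (cx b) y) = 1.
Let b0 : b != 0 := root_neq0 hR bR.
Let h := (s%:R / 2) *: cv b.
Let Y := cbil G (cx b) y.

Lemma bil_root : bil G b (cv b) = 2.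
Proof. by rewrite bilC // bil_coroot_self. Qed.

Lemma bil_shift w : bil G w h = s%:R / 2 * bil G w (cv b).
Proof. by rewrite /h bilZr. Qed.

(** The reflection in [b] permutes the roots positive on [u] and reverses the sign of
    [(a, b^\vee)]. *)
Lemma sum_cartan_wall : \sum_(a <- R | 0 < bil G u a) (m a)%:R * bil G a (cv b) = 0.
Proof.
suff : \sum_(a <- R | 0 < bil G u a) (m a)%:R * bil G a (cv b) =
       - \sum_(a <- R | 0 < bil G u a) (m a)%:R * bil G a (cv b) by lra.
rewrite -[LHS](perm_big _ (perm_reflection hG hR bR)) /= big_map -sumrN.
rewrite big_seq_cond [RHS]big_seq_cond; apply: eq_big => [a|a /andP[aR _]].
  by rewrite wall_reflection // (proj1 hu).
rewrite hm // /reflection bilBl bilZl (bilC hG b) bil_coroot_self //; ring.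
Qed.

(* The affine reflection in (b, .) = Y fixes y and exchanges y + h and y - h. *)
Lemma leading_wall_sym : leading u (y + cx h) = leading u (y - cx h).
Proof.
rewrite /leading -[LHS](perm_big _ (perm_reflection hG hR bR)) /= big_map.
pose na a : K := bil G a (cv b).
have per a : a \in R -> qp (2 * ((na a)%:C%C * Y)) = 1.
  move=> aR; have /intrP[k ek] : na a \is a Num.int by exact: (cartan_int hR).
  by rewrite ek rmorph_int mulrCA qpow_int_period.
have e a : a \in R -> - cbil G (cx (reflection G b a)) (y + cx h) =
    - cbil G (cx a) (y - cx h) + (na a)%:C%C * Y.
  move=> aR; rewrite /reflection complexifyB complexifyZ cbilBl cbilZl -(complexifyN h).
  rewrite !cbilDr !cbil_complexify bilNr.
  rewrite !bil_shift bil_root -/Y -/(na a).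
  by rewrite rmorphN !rmorphM /= fmorphV !rmorph_nat; field.
transitivity (\prod_(a <- R | 0 < bil G u a)
   (qp ((m a)%:R * ((na a)%:C%C * Y)) * qprod (- cbil G (cx a) (y - cx h)) 1 (m a).+1)).
  rewrite big_seq_cond [RHS]big_seq_cond; apply: eq_big => [a|a /andP[aR _]].
    by rewrite wall_reflection // (proj1 hu).
  by rewrite hm // e // qprod_half_period ?per // subn1.
(* The half-period factors of all roots combine to a power with exponent 0, by [sum_cartan_wall]. *)
rewrite big_split /= -qpow_sum (_ : \sum_(_ <- _ | _) _ = 0) ?qpow0 ?mul1r //.
transitivity ((\sum_(a <- R | 0 < bil G u a) (m a)%:R * na a)%:C%C * Y).
  rewrite rmorph_sum mulr_suml; apply: eq_bigr => a _.
  by rewrite rmorphM /= rmorph_nat mulrA.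
by rewrite sum_cartan_wall mul0r.
Qed.

Lemma edge_coefficient (j : nat) x : (j <= m b)%N ->
  c (edge u b j%:R) x * (qprod 0 1 j.+1 * qprod 0 1 (m b - j).+1) =
  leading u x * qprod 0 1 (m b).+1 *
  (qprod (- cbil G (cx b) x) j.+1 (m b).+1 * qprod (cbil G (cx b) x) (m b - j).+1 (m b).+1).
Proof.
move=> jM.
have N1 : forall x, c (edge u b 0) x = leading u x * qprod (- cbil G (cx b) x) 1 (m b).+1.
  have [v cl vb] := wall_side hG hR bR hu => z.
  rewrite -(edge0 hG hR hm bR hu cl vb).
  rewrite (vertex_coefficient hG hq hR hred hm ba) ?(leading_wall _ _ _ bR hu cl vb) //.
  exact: (close_regular bR hu cl vb).
exact: (edge_formula hG hq hR hred hm ba bR hu (leading_ccont logq hG R m u) N1 x jM).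
Qed.

Lemma cbil_shiftD : cbil G (cx b) (y + cx h) = Y + s%:R.
Proof. by rewrite cbilDr cbil_complexify bil_shift bil_root divfK ?pnatr_eq0 // rmorph_nat. Qed.

Lemma cbil_shiftB : cbil G (cx b) (y - cx h) = Y - s%:R.
Proof. by rewrite cbilBr cbil_complexify bil_shift bil_root divfK ?pnatr_eq0 // rmorph_nat. Qed.

Lemma qprod_wallD t i l : (i <= l)%N -> qprod (t + Y) i l = qp Y ^+ (l - i) * qprod t i l.
Proof. by move=> il; rewrite qprod_half_period // mulr_natl qpowMn. Qed.

Lemma qprod_wallB t i l : (i <= l)%N -> qprod (t - Y) i l = qp Y ^+ (l - i) * qprod t i l.
Proof.
have hY : qp (2 * - Y) = 1 by rewrite mulrN qpowN hy invr1.
by move=> il; rewrite qprod_half_period // mulr_natl qpowMn qpow_half_period.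
Qed.

Lemma edge_dual_nat (j : nat) : (j + s <= m b)%N ->
  c (edge u b (j + s)%:R) (y + cx h) = c (edge u b j%:R) (y - cx h).
Proof.
move=> jM; have F0 i := qprod_nat_neq0 hq i (ltn0Sn 0).
have jb : (j <= m b)%N by apply: leq_trans jM; rewrite leq_addr.
have e1 := edge_coefficient (y + cx h) jM.
have e2 := edge_coefficient (y - cx h) jb.
rewrite cbil_shiftD leading_wall_sym in e1; rewrite cbil_shiftB in e2.
pose k := (m b - (j + s))%N.
have eM : m b = (k + j + s)%N by rewrite -addnA subnK.
have k1 : (m b - (j + s))%N = k by [].
have k2 : (m b - j)%N = (k + s)%N by rewrite eM addnAC addnK.
have l1 : (k < (m b).+1)%N by rewrite ltnS leq_subr.
have l2 : (k + s < (m b).+1)%N by rewrite -k2 ltnS leq_subr.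
have q1 i l : qprod s%:R i l = qprod 0 (i + s) (l + s) by rewrite -qprod_addn add0r.
have q2 i l : qprod (- s%:R) (i + s) (l + s) = qprod 0 i l by rewrite -[- _]add0r qprod_subn.
rewrite k1 (opprD Y) [- Y + _]addrC qprod_wallB // (addrC Y) qprod_wallD // q1 in e1.
rewrite k2 opprB qprod_wallB // [Y - _]addrC qprod_wallD // q1 in e2.
rewrite subSS k1 subSS in e1; rewrite subSS k2 subSS in e2.
rewrite (_ : (j + s).+1 = j.+1 + s)%N // in e1; rewrite (_ : (k + s).+1 = k.+1 + s)%N // in e2.
have lM : (m b).+1 = ((k + j).+1 + s)%N by rewrite eM addSn.
have A1 : qprod (- s%:R) (j.+1 + s) (m b).+1 = qprod 0 j.+1 (k + j).+1 by rewrite lM q2.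
have B2 : qprod (- s%:R) (k.+1 + s) (m b).+1 = qprod 0 k.+1 (k + j).+1 by rewrite lM q2.
rewrite A1 in e1; rewrite B2 in e2.
pose F i := qprod 0 1 i.+1.
have FF i l : (i <= l)%N -> F l = F i * qprod 0 i.+1 l.+1.
  by move=> il; rewrite /F (@qprod_cat _ _ _ 1 i.+1 l.+1).
have fA1 := FF j (k + j)%N (leq_addl _ _).
have fB2 := FF k (k + j)%N (leq_addr _ _).
have fA2 : F (m b + s)%N = F (j + s)%N * qprod 0 (j.+1 + s) ((m b).+1 + s).
  by rewrite !addSn -FF // leq_add2r.
have fB1 : F (m b + s)%N = F (k + s)%N * qprod 0 (k.+1 + s) ((m b).+1 + s).
  by rewrite !addSn -FF // leq_add2r leq_subr.
rewrite -/(F j) -/(F (k + s)%N) -/(F (m b)) in e2.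
rewrite -[qprod 0 1 (j.+1 + s)]/(F (j + s)%N) -/(F k) -/(F (m b)) in e1.
have nz : F (j + s)%N * F k * (F j * F (k + s)%N) != 0 by rewrite !mulf_neq0 ?F0.
apply: (mulIf nz).
set L := leading u (y - cx h) in e1 e2.
have k3 : (m b - k = j + s)%N by rewrite eM -addnA addKn.
have k4 : (m b - (k + s) = j)%N by rewrite eM addnAC addKn.
rewrite k3 in e1; rewrite k4 in e2.
have ee : qp Y ^+ k * qp Y ^+ (j + s) = qp Y ^+ (m b) by rewrite -exprD addnA -eM.
have ee' : qp Y ^+ (k + s) * qp Y ^+ j = qp Y ^+ (m b) by rewrite -exprD addnAC -eM.
(* With the q-factorials [F] as common denominator, both coefficients become this expression. *)
transitivity (L * F (m b) * qp Y ^+ m b * (F (k + j)%N * F (m b + s)%N)).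
  rewrite [LHS]mulrA e1 -ee fA1 fB1; ring.
rewrite [in RHS](mulrC (F (j + s)%N * F k)) [RHS]mulrA e2 -ee' fB2 fA2; ring.
Qed.

(** If only one of the two integral points lies on the edge, its coefficient contains the factor
    [[s - s]]; if neither does, or the parameters are not integers, both sides are 0. *)
Lemma edge_dual (r : K) :
  c (edge u b r) (y + cx h) = c (edge u b (r - s%:R)) (y - cx h).
Proof.
have [rZ|rZ] := boolP (r \is a Num.int); last first.
  rewrite !(edge_nonint hG hq hR hm ba bR hu) //.
  by apply: contra rZ => rsZ; rewrite -(subrK s%:R r) rpredD // rpred_nat.
have out t x : ~~ (0 <= t <= (m b)%:R) -> c (edge u b t) x = 0.
  by move=> ht; apply: (ba_zero ba); apply: contra ht => /(edge_range hG hR hm ba bR hu).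
have /andP[s1 sM] := sm.
have sgt0 : 0 < s%:R :> K by rewrite ltr0n.
case: (ltrP r 0) => r0.
  by rewrite !out // negb_and -!ltNge ?r0 //; apply/orP; left; lra.
have /natrP[j ej] : r \is a Num.nat by rewrite natrEint rZ r0.
rewrite {r rZ r0}ej.
have F0 i := qprod_nat_neq0 hq i (ltn0Sn 0).
case: (leqP s j) => sj; last first.
  have jM : (j <= m b)%N by rewrite (leq_trans (ltnW sj)).
  rewrite [RHS]out; last by rewrite negb_and -!ltNge subr_lt0 ltr_nat sj.
  have := edge_coefficient (y + cx h) jM.
  rewrite cbil_shiftD opprD [- Y + _]addrC qprod_wallB // qprod_vanish //.
  rewrite mulr0 !mul0r mulr0 => /eqP.
  by rewrite mulf_eq0 mulf_eq0 !(negPf (F0 _)) !orbF => /eqP.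
rewrite -natrB //; case: (leqP j (m b)) => jM.
  by rewrite -{1}(subnK sj) edge_dual_nat // subnK.
rewrite out ?ler_nat ?ler0n -?ltnNge //.
case: (leqP (j - s) (m b)) => jsM; last by rewrite out // ler_nat ler0n -ltnNge.
have := edge_coefficient (y - cx h) jsM.
have lt : (m b - (j - s) < s)%N by rewrite ltn_subLR // subnK.
rewrite cbil_shiftB [Y - _]addrC qprod_wallD // ?ltnS ?leq_subr // qprod_vanish //.
rewrite !mulr0 => /eqP.
by rewrite mulf_eq0 mulf_eq0 !(negPf (F0 _)) !orbF => /eqP.
Qed.

End Wall.

Lemma sum_shift (d : 'rV[K]_n) (T : seq 'rV[K]_n) (F : 'rV[K]_n -> K[i]) : uniq T ->
  {subset [seq nu + d | nu <- S] <= T} -> (forall nu, nu \notin S -> F nu = 0) ->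
  \sum_(nu <- S) F nu = \sum_(nu <- T) F (nu - d).
Proof.
move=> uT sub F0.
have E : \sum_(nu <- S) F nu = \sum_(nu <- [seq nu + d | nu <- S]) F (nu - d).
  by rewrite big_map; apply: eq_bigr => nu _; rewrite addrK.
rewrite E [RHS](@sum_supported _ _ T [seq nu + d | nu <- S]); last first.
  move=> nu nuS; apply: F0; apply: contra nuS => h.
  by apply/mapP; exists (nu - d); rewrite ?subrK.
rewrite -[RHS]big_filter; apply: perm_big; apply: uniq_perm; rewrite ?filter_uniq //.
  by rewrite map_inj_uniq ?fset_uniq //; exact: addIr.
by move=> nu; rewrite mem_filter; case E' : (nu \in _) => //=; rewrite sub.
Qed.

Lemma regular_independent u a b : regular G R v0 -> a \in R -> b \in R -> 0 < bil G v0 a ->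
  0 < bil G v0 b -> a != b -> bil G u a != 0 -> bil G u a *: b - bil G u b *: a != 0.
Proof.
move=> rv aR bR va vb ab ua; rewrite subr_eq0; apply: contra ab => /eqP e.
have : b = (bil G u b / bil G u a) *: a.
  apply: (scalerI ua); rewrite e scalerA; congr (_ *: _); field; exact: ua.
move=> /(root_proportional hred aR bR)[-> //|e']; move: vb.
by rewrite e' bilNr oppr_gt0 ltNge ltW.
Qed.

(** The difference has exponents in [S + h] and [S - h], up to the common shift. As [(u, h) = 0],
    these extend no further than the polytope in direction [u]. *)
Theorem dual_quasi_invariance b s x z : b \in R -> (1 <= s <= m b)%N ->
  qp (2 * cbil G (cx b) x) = 1 ->
  psi (x + cx ((s%:R / 2) *: cv b)) z = psi (x - cx ((s%:R / 2) *: cv b)) z.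
Proof.
move=> bR sm hx; have b0 := root_neq0 hR bR.
have rv0 : regular G R v0 by case: ba.
have [u wu] := wall_exists hG hR hred bR.
pose h := (s%:R / 2) *: cv b.
pose T := undup ([seq nu + h | nu <- S] ++ [seq nu + - h | nu <- S]).
have uT : uniq T by exact: undup_uniq.
pose d k y := c (k - h) (y + cx h) - c (k + h) (y - cx h).
have expd y z' : psi (y + cx h) z' - psi (y - cx h) z' = \sum_(k <- T) d k y * EE G logq (y + cx k) z'.
  rewrite !(ba_exp ba).
  rewrite (@sum_shift h T _ uT) /=; last 2 first.
  - by move=> nu nuS; rewrite mem_undup mem_cat nuS.
  - by move=> nu nuS; rewrite (ba_zero ba _ nuS) mul0r.
  rewrite (@sum_shift (- h) T _ uT) /=; last 2 first.
  - by move=> nu nuS; rewrite mem_undup mem_cat nuS orbT.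
  - by move=> nu nuS; rewrite (ba_zero ba _ nuS) mul0r.
  rewrite -sumrB; apply: eq_bigr => k _; rewrite opprK /d mulrBl.
  have -> : y + cx h + cx (k - h) = y + cx k by rewrite -addrA -complexifyD [h + _]addrC subrK.
  by have -> : y - cx h + cx (k + h) = y + cx k by rewrite complexifyD addrACA addNr addr0.
suff d0 k : k \in T -> d k x = 0.
  apply/eqP; rewrite -subr_eq0 -/h expd big_seq big1 // => k kT.
  by rewrite d0 // mul0r.
move=> kT.
have dc : ccont (d k).
  by apply: ccontB; apply: ccont_shift; exact: (ba_cont ba).
(* [b] and [- b] are orthogonal to [u]: they add nothing to the width, and moving along [u] could
   not make them generic. *)
pose B := [seq a <- R | [&& 0 < bil G v0 a, a != b & a != - b]].
have hB a : a \in B -> bil G u a != 0.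
  by rewrite mem_filter => /andP[/and3P[_ ab anb] aR]; exact: (proj2 wu).
apply: (generic_zero hq (S := T) dc hB) => t y gen.
(* Moving along [u] keeps [(b, y)], so the line stays in the hyperplane. *)
have hy : qp (2 * cbil G (cx b) y) = 1.
  rewrite /y cbilDr !cbilZr cbil_complexify bilC // (proj1 wu) !mulr0 addr0 //.
apply/eqP; apply: contraT => dk.
have uS : bil G u h = 0.
  by rewrite /h bilZr; have /eqP -> : bil G u (cv b) == 0; rewrite ?mulr0 // bil_coroot_eq0 // (proj1 wu).
have inT k' : k' \in T -> exists2 nu, nu \in S & k' = nu + h \/ k' = nu - h.
  rewrite mem_undup mem_cat => /orP[/mapP[nu nuS ->]|/mapP[nu nuS ->]]; exists nu => //; by [left|right].
have Tbound k' : k' \in T -> `|bil G u k'| <= bil G u (rho u).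
  move=> /inT[nu nuS e]; have -> : bil G u k' = bil G u nu.
    by case: e => ->; rewrite ?bilDr ?bilNr uS ?oppr0 addr0.
  exact: (polytope_bound hG hR hm rv0 _ (ba_polytope ba nuS)).
have [|||||mu [nu [/andP[muT dmu] /andP[nuT dnu] le]]] :=
  @quasi_invariant_width _ _ _ _ hG hq T (d^~ y) y (fun z => psi (y + cx h) z - psi (y - cx h) z)
    u B m k uT (expd y) _ _ _ gen _ _ kT dk.
- by rewrite filter_uniq // fset_uniq.
- by move=> a; rewrite mem_filter => /andP[_ aR]; exact: (root_neq0 hR).
- move=> a a'; rewrite !mem_filter => /andP[/and3P[va _ _] aR] /andP[/and3P[va' _ _] a'R].
  exact: regular_independent.
- move=> a k1 k2; rewrite mem_filter => /andP[_ aR] /inT[n1 n1S e1] /inT[n2 n2S e2].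
  have hI : s%:R * bil G (cv b) a \is a Num.int.
    by rewrite rpredM ?rpred_nat // bilC // (cartan_int hR).
  have hh : bil G h a = s%:R / 2 * bil G (cv b) a by rewrite /h bilZl.
  have c1 := ba_coweight ba n1S aR; have c2 := ba_coweight ba n2S aR.
  have : bil G (k1 - k2) a = bil G n1 a - bil G n2 a \/
         bil G (k1 - k2) a = bil G n1 a - bil G n2 a + s%:R * bil G (cv b) a \/
         bil G (k1 - k2) a = bil G n1 a - bil G n2 a - s%:R * bil G (cv b) a.
    rewrite bilBl; case: e1 => ->; case: e2 => ->; rewrite !(bilDl, bilBl, bilNl) hh.
    - by left; ring.
    - by right; left; field.
    - by right; right; field.
    - by left; ring.
  by case=> [|[]] ->; rewrite ?(rpredB, rpredD).
- move=> a; rewrite mem_filter => /andP[_ aR] s' s'm z' hz'.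
  by rewrite !(ba_qi ba _ aR).
have HB : \sum_(a <- B) (m a)%:R * `|bil G u (cv a)| = 2 * bil G u (rho u).
  rewrite (bil_rho hG hR hm u rv0) /B big_filter.
  rewrite [RHS](bigID (fun a => (a != b) && (a != - b))) /= [X in _ = _ + X]big1 ?addr0.
    by [].
  move=> a /andP[_]; rewrite negb_and !negbK => ab.
  have /eqP -> : bil G u (cv a) == 0.
    by case/orP: ab => /eqP ->; rewrite ?corootN ?bilNr ?oppr_eq0 bil_coroot_eq0 // (proj1 wu).
  by rewrite normr0 mulr0.
have top : bil G u mu = bil G u (rho u).
  have := Tbound mu muT; have := Tbound nu nuT; rewrite !ler_norml => /andP[h1 h2] /andP[h3 h4].
  by move: le; rewrite HB bilBr => le; apply/eqP; rewrite eq_le; apply/andP; split; lra.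
(* A topmost exponent lies on the line of the edge, where [edge_dual] makes [d] vanish. *)
suff [r er] : exists r, mu = edge u b r.
  have := edge_dual bR wu sm hy (r + s%:R / 2).
  have -> : edge u b (r + s%:R / 2) = mu - h.
    by rewrite er /h -scaleNr edge_shift opprK.
  have -> : edge u b (r + s%:R / 2 - s%:R) = mu + h.
    by rewrite er /h edge_shift; congr (edge _ _ _); field.
  by move=> e; move: dmu; rewrite /d -/h e subrr eqxx.
have [n1 n1S e1] := inT mu muT.
have topn : bil G u n1 = bil G u (rho u).
  by rewrite -top; case: e1 => ->; rewrite ?bilDr ?bilNr uS ?oppr0 addr0.
have [r' _ er'] := polytope_edge hG hR hm rv0 bR wu (ba_polytope ba n1S) topn.
have {er'}e' : n1 = edge u b ((m b)%:R / 2 - r').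
  by rewrite er' /edge; congr (_ + _ *: _); ring.
case: e1 => ->; rewrite e' /h -?scaleNr edge_shift; by eexists.
Qed.

End DualQuasiInvariance.

(** * Coefficients as exponential sums *)

Section ExponentialPolynomials.
Context (K : realType) (n : nat) (G : 'M[K]_n) (logq : K[i]).
Hypothesis hG : scalar_product G.
Hypothesis hq : forall k : nat, (0 < k)%N -> cexp logq ^+ k != 1.
Implicit Types (u v w mu nu : 'rV[K]_n) (x y z : 'rV[K[i]]_n) (f g : 'rV[K[i]]_n -> K[i]).
Implicit Types (P Q : 'rV[K]_n -> Prop) (s : seq (K[i] * 'rV[K]_n)).
Local Notation cx := (@complexify K 1 n).
Local Notation EE := (EE G logq).

Definition exp_sum s x : K[i] := \sum_(p <- s) p.1 * EE (cx p.2) x.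

Definition exp_poly P f := exists2 s, (forall p, p \in s -> P p.2) & forall x, f x = exp_sum s x.

Lemma exp_poly_ext P f g : exp_poly P f -> f =1 g -> exp_poly P g.
Proof. by move=> [s sP fs] fg; exists s => // x; rewrite -fg. Qed.

Lemma exp_poly_sub P Q f : (forall nu, P nu -> Q nu) -> exp_poly P f -> exp_poly Q f.
Proof. by move=> PQ [s sP fs]; exists s => // p /sP /PQ. Qed.

Lemma exp_poly0 P : exp_poly P (fun=> 0).
Proof. by exists [::] => // x; rewrite /exp_sum big_nil. Qed.

Lemma exp_poly_mono P c mu : P mu -> exp_poly P (fun x => c * EE (cx mu) x).
Proof.
move=> Pmu; exists [:: (c, mu)]; last by move=> x; rewrite /exp_sum big_seq1.
by move=> p; rewrite inE => /eqP->.
Qed.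

Lemma exp_polyD P f g : exp_poly P f -> exp_poly P g -> exp_poly P (fun x => f x + g x).
Proof.
move=> [s sP fs] [t tP gt]; exists (s ++ t).
  by move=> p; rewrite mem_cat => /orP[/sP|/tP].
by move=> x; rewrite fs gt /exp_sum big_cat.
Qed.

Lemma exp_polyM P Q T f g : (forall mu nu, P mu -> Q nu -> T (mu + nu)) ->
  exp_poly P f -> exp_poly Q g -> exp_poly T (fun x => f x * g x).
Proof.
move=> PQ [s sP fs] [t tQ gt].
exists [seq (p.1 * p'.1, p.2 + p'.2) | p <- s, p' <- t].
  by move=> _ /allpairsP[[p p'] [/= ps p't ->]] /=; apply: PQ; [exact: sP|exact: tQ].
move=> x; rewrite fs gt /exp_sum mulr_suml big_allpairs_dep; apply: eq_bigr => p _.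
rewrite mulr_sumr; apply: eq_bigr => p' _ /=.
by rewrite complexifyD EEDl; ring.
Qed.

Lemma exp_polyZ P c f : exp_poly P f -> exp_poly P (fun x => c * f x).
Proof.
move=> [s sP fs]; exists [seq (c * p.1, p.2) | p <- s].
  by move=> _ /mapP[p ps ->] /=; exact: sP.
move=> x; rewrite fs /exp_sum mulr_sumr big_map; apply: eq_bigr => p _ /=.
by rewrite mulrA.
Qed.

Lemma exp_poly_sum P (I : Type) (r : seq I) (A : pred I) (F : I -> 'rV[K[i]]_n -> K[i]) :
  (forall i, A i -> exp_poly P (F i)) -> exp_poly P (fun x => \sum_(i <- r | A i) F i x).
Proof.
move=> h; elim: r => [|i r IH].
  by apply: exp_poly_ext (exp_poly0 P) _ => x; rewrite big_nil.
case Ai: (A i).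
  by apply: exp_poly_ext (exp_polyD (h i Ai) IH) _ => x; rewrite big_cons Ai.
by apply: exp_poly_ext IH _ => x; rewrite big_cons Ai.
Qed.

(** A list may repeat an exponent; this sum depends only on the function represented
    ([coef_unique]). *)
Definition coef s mu : K[i] := \sum_(p <- s | p.2 == mu) p.1.

Lemma exp_sum_coef s (T : seq 'rV[K]_n) x : uniq T -> (forall p, p \in s -> p.2 \in T) ->
  exp_sum s x = \sum_(mu <- T) coef s mu * EE (cx mu) x.
Proof.
move=> uT sT; rewrite /exp_sum /coef.
under [RHS]eq_bigr do rewrite mulr_suml big_mkcond.
rewrite exchange_big big_seq [RHS]big_seq; apply: eq_bigr => p ps /=.
rewrite (bigD1_seq p.2) ?sT //= eqxx big1 ?addr0 // => mu.
by rewrite eq_sym => /negPf ->.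
Qed.

Lemma coef_eq0 s mu : (forall x, exp_sum s x = 0) -> coef s mu = 0.
Proof.
move=> h.
pose D := [seq d <- [seq p.2 - mu | p <- s] | d != 0].
have [w wD] : exists w, forall d, d \in D -> bil G w d != 0.
  by apply: generic => // d; rewrite mem_filter => /andP[].
have := @expR_sum_eq0 _ _ s (fun p => p.1) (fun p => 2 * bil G p.2 w) (2 * bil G mu w).
have h1 t : \sum_(p <- s) p.1 * (expR (t * (2 * bil G p.2 w)))%:C%C = 0.
  by rewrite -[RHS](h ((t%:C%C / logq) *: cx w)); apply: eq_bigr => p _; rewrite EE_line.
move=> /(_ h1) <-; rewrite /coef big_seq_cond [RHS]big_seq_cond; apply: eq_bigl => p.
case ps: (p \in s) => //=; rewrite (inj_eq (mulfI _)) ?pnatr_eq0 //.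
apply/eqP/eqP => [-> //|e]; apply/eqP; rewrite -subr_eq0; apply: contraT => d0.
have : p.2 - mu \in D by rewrite mem_filter d0; apply/mapP; exists p.
by move=> /wD; rewrite bilC // bilBl e subrr eqxx.
Qed.

Section Low.
Variables (v : 'rV[K]_n) (L : 'rV[K]_n -> Prop).
Hypothesis LD : forall mu nu, L mu -> L nu -> L (mu + nu).

(** Expresses that [f] tends to [k] along [(t / logq) v] for t to infinity. [L] records the lattice
    of exponents, for periodicity and integrality. *)
Definition low k f := exp_poly (fun mu => bil G v mu < 0 /\ L mu) (fun x => f x - k).

Lemma low_ext k f g : low k f -> f =1 g -> low k g.
Proof. by move=> h fg; apply: exp_poly_ext h _ => x; rewrite fg. Qed.

Lemma low_cst k : low k (fun=> k).
Proof. by apply: exp_poly_ext (exp_poly0 _) _ => x; rewrite subrr. Qed.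

Lemma lowD k l f g : low k f -> low l g -> low (k + l) (fun x => f x + g x).
Proof. by move=> hf hg; apply: exp_poly_ext (exp_polyD hf hg) _ => x; ring. Qed.

Lemma lowM k l f g : low k f -> low l g -> low (k * l) (fun x => f x * g x).
Proof.
move=> hf hg.
have hfg : exp_poly (fun mu => bil G v mu < 0 /\ L mu) (fun x => (f x - k) * (g x - l)).
  apply: (exp_polyM _ hf hg) => mu nu [mu0 Lmu] [nu0 Lnu].
  by split; [rewrite bilDr; lra|exact: LD].
apply: exp_poly_ext (exp_polyD hfg (exp_polyD (exp_polyZ k hg) (exp_polyZ l hf))) _ => x.
by ring.
Qed.

Lemma low_sum (I : Type) (r : seq I) (A : pred I) (k : I -> K[i]) (F : I -> 'rV[K[i]]_n -> K[i]) :
  (forall i, A i -> low (k i) (F i)) ->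
  low (\sum_(i <- r | A i) k i) (fun x => \sum_(i <- r | A i) F i x).
Proof.
move=> h; elim: r => [|i r IH].
  by rewrite big_nil; apply: low_ext (low_cst 0) _ => x; rewrite big_nil.
rewrite big_cons; case Ai: (A i).
  by apply: low_ext (lowD (h i Ai) IH) _ => x; rewrite big_cons Ai.
by apply: low_ext IH _ => x; rewrite big_cons Ai.
Qed.

Lemma low_prod (I : Type) (r : seq I) (A : pred I) (k : I -> K[i]) (F : I -> 'rV[K[i]]_n -> K[i]) :
  (forall i, A i -> low (k i) (F i)) ->
  low (\prod_(i <- r | A i) k i) (fun x => \prod_(i <- r | A i) F i x).
Proof.
move=> h; elim: r => [|i r IH].
  by rewrite big_nil; apply: low_ext (low_cst 1) _ => x; rewrite big_nil.
rewrite big_cons; case Ai: (A i).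
  by apply: low_ext (lowM (h i Ai) IH) _ => x; rewrite big_cons Ai.
by apply: low_ext IH _ => x; rewrite big_cons Ai.
Qed.

Lemma low_det (N : nat) (A : 'M[K[i]]_N) (B : 'rV[K[i]]_n -> 'M[K[i]]_N) :
  (forall i j, low (A i j) (fun x => B x i j)) -> low (\det A) (fun x => \det (B x)).
Proof.
move=> h; rewrite /determinant; apply: low_sum => s _.
apply: lowM; first exact: low_cst.
by apply: low_prod => i _; exact: h.
Qed.

Lemma low_adj (N : nat) (A : 'M[K[i]]_N) (B : 'rV[K[i]]_n -> 'M[K[i]]_N) i j :
  (forall i j, low (A i j) (fun x => B x i j)) -> low ((\adj A) i j) (fun x => (\adj (B x)) i j).
Proof.
move=> h.
have := @low_cst ((-1) ^+ (j + i)).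
have hd : low (\det (row' j (col' i A))) (fun x => \det (row' j (col' i (B x)))).
  apply: low_det => k l; rewrite !mxE; apply: low_ext (h _ _) _ => x; by rewrite !mxE.
move=> /lowM /(_ hd); rewrite /adjugate mxE /cofactor => H.
by apply: low_ext H _ => x; rewrite mxE.
Qed.

End Low.
End ExponentialPolynomials.

(** * Solving the string conditions near infinity *)

Section RationalCoefficients.
Context (K : realType) (n : nat) (G : 'M[K]_n) (logq : K[i]).
Hypothesis hG : scalar_product G.
Hypothesis hq : forall k : nat, (0 < k)%N -> cexp logq ^+ k != 1.
Context (R : {fset 'rV[K]_n}) (m : 'rV[K]_n -> nat).
Hypothesis hR : root_system G R.
Hypothesis hred : reduced R.
Hypothesis hm : invariant_multiplicity G R m.
Context (v0 : 'rV[K]_n) (S : {fset 'rV[K]_n}) (c : 'rV[K]_n -> 'rV[K[i]]_n -> K[i]).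
Context (psi : 'rV[K[i]]_n -> 'rV[K[i]]_n -> K[i]).
Hypothesis ba : ba_data G logq R m v0 S c psi.
Implicit Types (a b u v w nu : 'rV[K]_n) (x y z : 'rV[K[i]]_n).
Local Notation cx := (@complexify K 1 n).
Local Notation cv := (coroot G).
Local Notation qp := (qpow logq).
Local Notation br := (qbracket logq).
Local Notation EE := (EE G logq).
Local Notation rho := (rho G R m).
Local Notation leading := (leading G logq R m).

Definition weight_lattice mu := forall a, a \in R -> bil G mu (cv a) \is a Num.int.

Lemma weight_latticeD mu nu : weight_lattice mu -> weight_lattice nu -> weight_lattice (mu + nu).
Proof. by move=> h1 h2 a aR; rewrite bilDl rpredD ?h1 ?h2. Qed.

Lemma root_weight a (k : int) : a \in R -> weight_lattice (k%:~R *: a).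
Proof. by move=> aR b bR; rewrite bilZl rpredM ?intr_int // (cartan_int hR). Qed.

(** The half-sum [rho] of the dual system ([dual_rhoE]), and the top exponent of [leading v]. *)
Definition dual_rho v : 'rV[K]_n := \sum_(a <- R | 0 < bil G v a) ((m a)%:R / 2) *: a.

Definition lead_const v : K[i] :=
  \prod_(a <- R | 0 < bil G v a) \prod_(1 <= k < (m a).+1) - qp (- k%:R).

(** Factor by factor, [[k - (a, x)] = - q^(- k) q^((a, x)) (1 - q^(2 k) q^(- 2 (a, x)))]. *)
Lemma leading_factor v : exists2 g, low G logq v weight_lattice 1 g &
  forall x, leading v x = lead_const v * EE (cx (dual_rho v)) x * g x.
Proof.
pose g x := \prod_(a <- R | 0 < bil G v a) \prod_(1 <= k < (m a).+1)
  (1 - qp (2 * k%:R) * EE (cx (- a)) x).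
exists g.
  pose P a := (a \in R) && (0 < bil G v a).
  apply: (low_ext (f := fun x => \prod_(a <- R | P a) \prod_(1 <= k < (m a).+1)
     (1 - qp (2 * k%:R) * EE (cx (- a)) x))); last by move=> x; rewrite /g -big_seq_cond.
  rewrite [X in low _ _ _ _ X](_ : 1 = \prod_(a <- R | P a) \prod_(1 <= k < (m a).+1) 1); last first.
    by rewrite big1 // => a _; rewrite big1.
  apply: (low_prod weight_latticeD) => a /andP[aR va].
  apply: (low_prod weight_latticeD) => k _.
  apply: (exp_poly_ext (f := fun x => (- qp (2 * k%:R)) * EE (cx (- a)) x)); last first.
    by move=> x; ring.
  apply: exp_poly_mono; split; first by rewrite bilNr oppr_lt0.
  by rewrite -scaleN1r -[-1]/((-1)%:~R); exact: root_weight.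
move=> x; rewrite /leading /lead_const /dual_rho /g complexify_sum.
have -> : EE (\sum_(a <- R | 0 < bil G v a) cx (((m a)%:R / 2) *: a)) x =
          \prod_(a <- R | 0 < bil G v a) EE (cx (((m a)%:R / 2) *: a)) x.
  by elim/big_rec2: _ => [|a y z _ <-]; rewrite ?EE0l ?EEDl.
rewrite -!big_split /=; apply: eq_bigr => a _.
have -> : EE (cx (((m a)%:R / 2) *: a)) x = \prod_(1 <= k < (m a).+1) qp (cbil G (cx a) x).
  rewrite prodr_const_nat subn1 /= -qpowMn /EE complexifyZ cbilZl; congr (qp _).
  by rewrite rmorphM /= fmorphV !rmorph_nat -mulr_natl; field.
rewrite -!big_split /=; apply: eq_bigr => k _.
have -> : EE (cx (- a)) x = qp (- (2 * cbil G (cx a) x)).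
  by rewrite /EE complexifyN [cbil _ _ _]bilNl mulrN.
rewrite mulrBr mulr1 mulrACA -!qpowD !mulNr -!qpowD /qbracket opprB.
by rewrite [RHS]addrC opprK; congr (qp _ - qp _); ring.
Qed.

Section Limit.
Variable v : 'rV[K]_n.
Hypothesis rv : regular G R v.

(* The string conditions rescaled by q^(- s (x, a)), in the limit x -> oo along v. *)
Definition limit_relations (f : 'rV[K]_n -> K[i]) := forall a nu0 s, a \in R -> 0 < bil G v a ->
  nu0 \in S -> (1 <= s <= m a)%N ->
  \sum_(nu <- S | inZ (cv a) (nu - nu0)) f nu * qp (s%:R * (bil G nu a)%:C%C) = 0.

(** The nodes [q^((nu, a))] are distinct along a string, so the support of a nonzero solution is as
    wide as the polytope in direction [v] and contains the vertex [rho v]. *)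
Lemma limit_kernel f : limit_relations f -> f (rho v) = 0 -> forall nu, nu \in S -> f nu = 0.
Proof.
move=> rel f0 nu0 nu0S; apply/eqP; apply: contraT => fnu0.
have rv0 : regular G R v0 by case: ba.
pose B := [seq a <- R | 0 < bil G v a].
pose T := [seq nu <- S | f nu != 0].
have [|||||mu [nu [muT nuT le]]] := @width_roots _ _ _ hG v B m T nu0.
- by rewrite filter_uniq // fset_uniq.
- by move=> a; rewrite mem_filter => /andP[_ /(root_neq0 hR)].
- move=> a b; rewrite !mem_filter => /andP[va aR] /andP[vb bR] ab vaN.
  exact: (regular_independent hred rv aR bR va vb ab vaN).
- by rewrite mem_filter fnu0.
- move=> a nu; rewrite mem_filter => /andP[va aR]; rewrite mem_filter => /andP[fnu nuS].
  have a0 := root_neq0 hR aR.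
  have [||k [l [kS lS kl]]] := @string_spread _ _ S (fun nu => f nu != 0) (cv a) (m a) nu (fset_uniq S).
  - exact: coroot_neq0.
  - pose r := [seq nu' <- S | inZ (cv a) (nu' - nu)].
    have -> : [seq nu' <- S | inZ (cv a) (nu' - nu) && (f nu' != 0)] = [seq nu' <- r | f nu' != 0].
      by rewrite /r -filter_predI; apply: eq_filter => k /=; rewrite andbC.
    pose Y nu' := qp (bil G nu' a)%:C%C.
    apply: (@count_support _ _ r f Y Y (m a) nu) => //.
    + by rewrite filter_uniq // fset_uniq.
    + move=> k l; rewrite !mem_filter => /andP[/asboolP[k' ek] kS] /andP[/asboolP[l' el] lS].
      move=> /eqP; rewrite -subr_eq0 => /eqP e.
      have : qp (2 * (k' - l'))%:~R = 1.
        have -> : (2 * (k' - l'))%:~R = (bil G k a)%:C%C - (bil G l a)%:C%C.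
          have -> : bil G k a = bil G nu a + 2 * k'%:~R.
            by rewrite -(subrK nu k) ek bilDl bilZl bil_coroot_self //; ring.
          have -> : bil G l a = bil G nu a + 2 * l'%:~R.
            by rewrite -(subrK nu l) el bilDl bilZl bil_coroot_self //; ring.
          rewrite -(rmorphB (real_complex K)) /= -[LHS](rmorph_int (real_complex K)); congr (_%:C%C).
          by rewrite intrM intrB; ring.
        by rewrite qpowD qpowN -/(Y k) -/(Y l); move/eqP: e; rewrite subr_eq0 => /eqP ->; rewrite divff // qpow_neq0.
      move=> /eqP; rewrite qpow_int_eq1 // mulf_eq0 /= subr_eq0 => /eqP kl.
      by rewrite -(subrK nu k) -(subrK nu l) ek el kl.
    + by move=> nu' _; exact: qpow_neq0.
    + move=> p sp; apply: (sum_horner _ sp) => k km.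
      rewrite -[RHS](rel a nu k.+1 aR va nuS _) // big_filter; apply: eq_bigr => nu' _.
      by rewrite -mulrA -exprS mulr_natl qpowMn.
    + by rewrite mem_filter nuS andbT; apply/asboolP; exists 0; rewrite subrr scale0r.
  by exists k%:~R, l%:~R.
have bd k : k \in T -> `|bil G v k| <= bil G v (rho v).
  by rewrite mem_filter => /andP[_ kS]; exact: (polytope_bound hG hR hm rv0 _ (ba_polytope ba kS)).
have := bil_rho hG hR hm v rv; rewrite -big_filter -/B => e; rewrite -e in le.
have := bd mu muT; have := bd nu nuT; rewrite !ler_norml => /andP[h1 h2] /andP[h3 h4].
have top : bil G v mu = bil G v (rho v).
  by move: le; rewrite bilBr => le; apply/eqP; rewrite eq_le; apply/andP; split; lra.
move: muT; rewrite mem_filter => /andP[fmu muS].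
have emu := polytope_vertex hG hR hm rv0 rv (ba_polytope ba muS) top.
by rewrite emu f0 eqxx in fmu.
Qed.

Lemma sum_nth_ord (F : 'rV[K]_n -> K[i]) : \sum_(j < size S) F (nth 0 S j) = \sum_(nu <- S) F nu.
Proof. by rewrite [RHS](big_nth 0) big_mkord. Qed.

(** Cramer's rule. The limit system with the value at [rho v] adjoined has a left inverse [L] by
    [limit_kernel]; [L] times the actual system tends to the identity, so its determinant [Q] tends
    to 1. One vector [l] serves the limits of the coefficients and all solutions of the limit
    system. *)
Theorem rational_coefficients : exists l Q P,
  [/\ low G logq v weight_lattice 1 Q,
      forall nu, nu \in S -> low G logq v weight_lattice (l nu) (P nu),
      forall nu x, nu \in S -> Q x * c nu x = leading v x * P nu x &
      forall f, limit_relations f -> forall nu, nu \in S -> f nu = f (rho v) * l nu].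
Proof.
pose N := size S.
pose rows : seq ('rV[K]_n * 'rV[K]_n * nat) :=
  [seq (an, s) | an <- [seq (a, nu0) | a <- [seq a <- R | 0 < bil G v a], nu0 <- S],
                 s <- iota 1 (m an.1)].
pose p := size rows.
have rowsP t : reflect [/\ t.1.1 \in R, 0 < bil G v t.1.1, t.1.2 \in S & (1 <= t.2 <= m t.1.1)%N]
    (t \in rows).
  apply: (iffP idP).
    move=> /allpairsPdep[[a nu0] [s [/allpairsP[[a' nu'] [/= ha hnu [-> ->]]] hs ->]]] /=.
    by move: ha hs; rewrite mem_filter mem_iota add1n ltnS => /andP[-> ->].
  case: t => [[a nu0] s] /= [aR va nuS sm]; apply/allpairsPdep; exists (a, nu0), s; split=> //.
    by apply/allpairsP; exists (a, nu0); rewrite /= mem_filter va aR.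
  by rewrite mem_iota add1n ltnS.
pose row (i : 'I_p) := nth (0, 0, 0%N) rows i.
pose nn (j : 'I_N) := nth 0 S j.
pose ent0 t nu : K[i] := if inZ (cv t.1.1) (nu - t.1.2) then qp (t.2%:R * (bil G nu t.1.1)%:C%C) else 0.
pose ent t nu x : K[i] := if inZ (cv t.1.1) (nu - t.1.2)
  then qp (- (t.2%:R * cbil G x (cx t.1.1))) * br (t.2%:R * cbil G (x + cx nu) (cx t.1.1)) else 0.
pose top : 'rV[K[i]]_N := \row_j (nn j == rho v)%:R.
pose M0 : 'M[K[i]]_(1 + p, N) := col_mx top (\matrix_(i < p, j < N) ent0 (row i) (nn j)).
pose Mx x : 'M[K[i]]_(1 + p, N) := col_mx top (\matrix_(i < p, j < N) ent (row i) (nn j) x).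
have rowin i : row i \in rows by rewrite mem_nth.
have nnS j : nn j \in S by rewrite mem_nth.
have SI nu : nu \in S -> exists j, nu = nn j.
  move=> nuS; have lt : (index nu S < N)%N by rewrite index_mem.
  by exists (Ordinal lt); rewrite /nn /= nth_index.
have topE (f : 'rV[K]_n -> K[i]) : (top *m (\col_j f (nn j))) 0 0 = f (rho v).
  rewrite mxE; under eq_bigr do rewrite !mxE.
  rewrite (sum_nth_ord (fun nu => (nu == rho v)%:R * f nu)).
  have tS : rho v \in S by exact: (rho_in_support hG hR hred hm ba rv).
  rewrite (bigD1_seq (rho v)) ?fset_uniq //= eqxx mul1r big1 ?addr0 // => nu /negPf ->.
  by rewrite mul0r.
have botE (f : 'rV[K]_n -> K[i]) (e : _ -> _ -> K[i]) i :
    ((\matrix_(i < p, j < N) e (row i) (nn j)) *m (\col_j f (nn j))) i 0 =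
    \sum_(nu <- S) e (row i) nu * f nu.
  by rewrite mxE -sum_nth_ord; apply: eq_bigr => j _; rewrite !mxE.
have [L LM] : exists L, L *m M0 = 1%:M.
  apply/row_fullP; rewrite /row_full -mxrank_tr; apply/inj_row_free => w hw.
  pose f nu := \sum_(j < N | nn j == nu) w 0 j.
  have fnn j : f (nn j) = w 0 j.
    rewrite /f (bigD1 j) //= big1 ?addr0 // => k /andP[/eqP e kj].
    case/eqP: kj; apply/val_inj/eqP.
    by rewrite -(nth_uniq 0 (ltn_ord k) (ltn_ord j) (fset_uniq S)); apply/eqP.
  have wE : w^T = \col_j f (nn j) by apply/colP => j; rewrite !mxE fnn.
  have : M0 *m w^T = 0 by rewrite -[M0]trmxK -trmx_mul hw trmx0.
  rewrite wE mul_col_mx -[0]vsubmxK => /eq_col_mx[e1 e2].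
  have f0 : f (rho v) = 0 by rewrite -topE e1 !mxE.
  have rel : limit_relations f.
    move=> a nu0 s aR va nuS sm.
    have /(nthP (0, 0, 0%N))[i ip ei] : (a, nu0, s) \in rows by apply/rowsP.
    have : ((\matrix_(i < p, j < N) ent0 (row i) (nn j)) *m (\col_j f (nn j))) (Ordinal ip) 0 = 0.
      by rewrite e2 !mxE.
    rewrite botE /row /= ei => e3; rewrite -[RHS]e3 big_mkcond; apply: eq_bigr => nu _.
    by rewrite /ent0 /=; case: ifP => _; rewrite ?mul0r // mulrC.
  by apply/rowP => j; rewrite -fnn !mxE (limit_kernel rel f0 (nnS j)).
pose Bx x : 'M[K[i]]_N := L *m Mx x.
pose ll : 'cV[K[i]]_N := L *m col_mx 1%:M 0.
have Blow i j : low G logq v weight_lattice ((1%:M : 'M[K[i]]_N) i j) (fun x => Bx x i j).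
  rewrite -LM mxE; apply: (low_ext (f := fun x => \sum_k L i k * Mx x k j)); last first.
    by move=> x; rewrite [RHS]mxE.
  apply: low_sum => k _; apply: (lowM weight_latticeD); first exact: low_cst.
  case: (splitP k) => k' ek.
    have -> : k = lshift p k' by apply: val_inj.
    rewrite col_mxEu; apply: (low_ext (low_cst _ _ _ _ _)) => x; by rewrite col_mxEu.
  have -> : k = rshift 1 k' by apply: val_inj.
  rewrite col_mxEd mxE; apply: (low_ext (f := fun x => ent (row k') (nn j) x)); last first.
    by move=> x; rewrite col_mxEd mxE.
  move: (row k') (rowin k') => t /rowsP[aR va nuS /andP[s1 sm]].
  rewrite /ent /ent0; case: ifP => _; last exact: low_cst.
  pose h : K[i] := t.2%:R * (bil G (nn j) t.1.1)%:C%C.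
  (* [q^(- X) [X + h] = q^h - q^(- h - 2 X)], and the second term decays along [v]. *)
  apply: (exp_poly_ext (f := fun x => - qp (- h) * EE (cx ((- t.2%:Z)%:~R *: t.1.1)) x)).
    apply: exp_poly_mono; split; last exact: root_weight.
    by rewrite bilZr mulrNz mulNr oppr_lt0 mulr_gt0 // -pmulrn ltr0n.
  move=> x; pose X := t.2%:R * cbil G x (cx t.1.1).
  have -> : t.2%:R * cbil G (x + cx (nn j)) (cx t.1.1) = X + h.
    by rewrite cbilDl cbil_complexify mulrDr.
  have -> : EE (cx ((- t.2%:Z)%:~R *: t.1.1)) x = qp (- (2 * X)).
    rewrite /EE complexifyZ cbilZl rmorph_int mulrNz -pmulrn (cbilC hG _ x) /X; congr (qp _).
    by ring.
  rewrite -/X /qbracket mulrBr -!qpowD mulNr -qpowD.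
  have -> : - X + (X + h) = h by ring.
  have -> : - X - (X + h) = - h - 2 * X by ring.
  by ring.
have ellE x : Bx x *m (\col_j c (nn j) x) = c (rho v) x *: ll.
  rewrite /Bx -mulmxA mul_col_mx /ll scalemxAr; congr (L *m _).
  rewrite scale_col_mx scaler0; congr col_mx.
    by apply/matrixP => i j; rewrite !ord1 (topE (fun nu => c nu x)) !mxE mulr1.
  apply/colP => i; rewrite (botE (fun nu => c nu x) (fun t nu => ent t nu x)) mxE.
  have /rowsP[aR va nuS sm] := rowin i.
  set t := row i in aR va nuS sm *.
  have := ba_string hG hq hR ba x aR (ba_coweight ba nuS aR) sm => e.
  rewrite -[RHS](mulr0 (qp (- (t.2%:R * cbil G x (cx t.1.1))))) -[X in _ = _ * X]e [in RHS]big_mkcond [in RHS]mulr_sumr.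
  apply: eq_bigr => nu _; rewrite /ent; case: ifP => _; last by rewrite mul0r mulr0.
  by ring.
exists (fun nu => \sum_(j < N | nn j == nu) ll j 0).
exists (fun x => \det (Bx x)).
exists (fun nu x => \sum_(j < N | nn j == nu) (\adj (Bx x) *m ll) j 0).
split.
- have := low_det weight_latticeD Blow; by rewrite det1.
- move=> nu nuS.
  apply: low_sum => j _.
  have -> : ll j 0 = \sum_k (\adj (1%:M : 'M[K[i]]_N)) j k * ll k 0.
    have <- : \adj 1%:M *m ll = ll.
      by have := mul_adj_mx (1%:M : 'M[K[i]]_N); rewrite det1 mulmx1 => ->; rewrite mul1mx.
    rewrite mxE; apply: eq_bigr => k _; congr (_ * _).
    by have := mul_adj_mx (1%:M : 'M[K[i]]_N); rewrite det1 mulmx1 => ->; rewrite mul1mx.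
  apply: (low_ext (f := fun x => \sum_k (\adj (Bx x)) j k * ll k 0)); last first.
    by move=> x; rewrite [RHS]mxE.
  apply: low_sum => k _; apply: (lowM weight_latticeD); last exact: low_cst.
  exact: (low_adj weight_latticeD).
- move=> nu x nuS; have [j0 ej] := SI nu nuS.
  have one (F : 'I_N -> K[i]) : \sum_(j < N | nn j == nu) F j = F j0.
    rewrite (bigD1 j0) ?ej //= big1 ?addr0 // => k /andP[/eqP e kj].
    case/eqP: kj; apply/val_inj/eqP.
    by rewrite -(nth_uniq 0 (ltn_ord k) (ltn_ord j0) (fset_uniq S)); apply/eqP.
  rewrite one ej -(vertex_coefficient hG hq hR hred hm ba) //.
  have := congr1 (fun X => (\adj (Bx x) *m X) j0 0) (ellE x).
  rewrite mulmxA mul_adj_mx mul_scalar_mx -scalemxAr [LHS]mxE mxE [RHS]mxE.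
  by [].
- move=> f rel nu nuS; have [j0 ej] := SI nu nuS.
  have one (F : 'I_N -> K[i]) : \sum_(j < N | nn j == nu) F j = F j0.
    rewrite (bigD1 j0) ?ej //= big1 ?addr0 // => k /andP[/eqP e kj].
    case/eqP: kj; apply/val_inj/eqP.
    by rewrite -(nth_uniq 0 (ltn_ord k) (ltn_ord j0) (fset_uniq S)); apply/eqP.
  rewrite one ej.
  have : M0 *m (\col_j f (nn j)) = f (rho v) *: col_mx 1%:M 0.
    rewrite mul_col_mx scale_col_mx scaler0; congr col_mx.
      by apply/matrixP => i j; rewrite !ord1 topE !mxE mulr1.
    apply/colP => i; rewrite botE mxE.
    have /rowsP[aR va nuS' sm] := rowin i.
    rewrite -[RHS](rel _ _ _ aR va nuS' sm) [in RHS]big_mkcond; apply: eq_bigr => k _.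
    by rewrite /ent0; case: ifP => _; rewrite ?mul0r // mulrC.
  move=> /(congr1 (fun X => (L *m X) j0 0)); rewrite mulmxA LM mul1mx mxE => ->.
  by rewrite -scalemxAr mxE.
Qed.

End Limit.
End RationalCoefficients.

Section Coefficients.
Context (K : realType) (n : nat) (G : 'M[K]_n) (logq : K[i]).
Hypothesis hG : scalar_product G.
Hypothesis hq : forall k : nat, (0 < k)%N -> cexp logq ^+ k != 1.
Implicit Types (s t : seq (K[i] * 'rV[K]_n)) (mu nu : 'rV[K]_n).

Lemma coef_cat s t mu : coef (s ++ t) mu = coef s mu + coef t mu.
Proof. by rewrite /coef big_cat. Qed.

Lemma coef_out s mu : (forall p, p \in s -> p.2 != mu) -> coef s mu = 0.
Proof. by move=> h; rewrite /coef big_seq_cond big1 // => p /andP[/h /negPf ->]. Qed.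

Lemma coef_unique s t mu : (forall x, exp_sum G logq s x = exp_sum G logq t x) ->
  coef s mu = coef t mu.
Proof.
move=> h; pose t' := [seq (- p.1, p.2) | p <- t].
have e1 x : exp_sum G logq (s ++ t') x = 0.
  rewrite /exp_sum big_cat /= -/(exp_sum G logq s x) h /t' big_map /exp_sum -big_split /=.
  by rewrite big1 // => p _; rewrite mulNr subrr.
have := coef_eq0 hG hq mu e1; rewrite coef_cat => /eqP; rewrite addr_eq0 => /eqP ->.
rewrite /coef big_map -sumrN; apply: eq_bigr => p _; by rewrite opprK.
Qed.

End Coefficients.

(** * The expansion of the dual normalisation *)

Section DualLeading.
Context (K : realType) (n : nat) (G : 'M[K]_n) (logq : K[i]).
Hypothesis hG : scalar_product G.
Hypothesis hq : forall k : nat, (0 < k)%N -> cexp logq ^+ k != 1.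
Context (R : {fset 'rV[K]_n}) (m md : 'rV[K]_n -> nat).
Hypothesis hR : root_system G R.
Hypothesis hred : reduced R.
Hypothesis hm : invariant_multiplicity G R m.
Hypothesis hmd : forall a, a \in R -> md (coroot G a) = m a.
Context (v0 : 'rV[K]_n) (S : {fset 'rV[K]_n}) (c : 'rV[K]_n -> 'rV[K[i]]_n -> K[i]).
Context (psi : 'rV[K[i]]_n -> 'rV[K[i]]_n -> K[i]).
Hypothesis ba : ba_data G logq R m v0 S c psi.
Implicit Types (a b u v w nu : 'rV[K]_n) (x y z : 'rV[K[i]]_n).
Local Notation cx := (@complexify K 1 n).
Local Notation cv := (coroot G).
Local Notation qp := (qpow logq).
Local Notation br := (qbracket logq).
Local Notation EE := (EE G logq).
Local Notation R' := (dual_roots G R).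

Lemma big_dual_positive (T : Type) (idx : T) (op : Monoid.com_law idx) v (F : 'rV[K]_n -> T) :
  \big[op/idx]_(b <- R' | 0 < bil G v b) F b = \big[op/idx]_(a <- R | 0 < bil G v a) F (cv a).
Proof.
have pe : perm_eq R' [seq cv a | a <- R].
  apply: uniq_perm; rewrite ?fset_uniq //.
    by rewrite (map_inj_uniq (can_inj (corootK hG))) fset_uniq.
  move=> b; rewrite dual_rootsP //; apply/idP/mapP => [bR|[a aR ->]]; last by rewrite corootK.
  by exists (cv b); rewrite ?corootK.
rewrite (perm_big _ pe) big_map big_seq_cond [RHS]big_seq_cond; apply: eq_bigl => a.
by case aR: (a \in R) => //=; rewrite (bil_coroot_gt0 hG hR).
Qed.

Lemma dual_rho_dual v : dual_rho G R' md v = rho G R m v.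
Proof.
rewrite /dual_rho big_dual_positive /rho scaler_sumr big_seq_cond [RHS]big_seq_cond.
by apply: eq_bigr => a /andP[aR _]; rewrite hmd // [RHS]scalerA mulrC.
Qed.

Lemma dual_rhoE v : dual_rho G R m v = rho G R' md v.
Proof.
rewrite /dual_rho /rho big_dual_positive scaler_sumr big_seq_cond [RHS]big_seq_cond.
by apply: eq_bigr => a /andP[aR _]; rewrite hmd // corootK // scalerA mulrC.
Qed.

Lemma lead_const_dual v : lead_const G logq R' md v = lead_const G logq R m v.
Proof.
rewrite /lead_const big_dual_positive big_seq_cond [RHS]big_seq_cond.
by apply: eq_bigr => a /andP[aR _]; rewrite hmd.
Qed.

Lemma dual_leadingE v z : leading G logq R' md v z =
  \prod_(a <- R | 0 < bil G v a) qprod logq (- cbil G (cx (cv a)) z) 1 (m a).+1.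
Proof.
rewrite /leading big_dual_positive big_seq_cond [RHS]big_seq_cond.
by apply: eq_bigr => a /andP[aR _]; rewrite hmd.
Qed.

Lemma qprod_exp_poly b k : exp_poly G logq
  (fun nu => exists2 l : nat, (l <= k)%N & nu = (k%:R / 2 - l%:R) *: b)
  (fun z => qprod logq (- cbil G (cx b) z) 1 k.+1).
Proof.
elim: k => [|k IH].
  apply: (exp_poly_ext (f := fun z => 1 * EE (cx 0) z)).
    by apply: exp_poly_mono; exists 0%N => //; rewrite mul0r subr0 scale0r.
  by move=> z; rewrite qprod_nil complexify0 EE0l mulr1.
pose half (i : nat) (nu : 'rV[K]_n) := nu = (2^-1 - i%:R) *: b.
have hb : exp_poly G logq (fun nu => exists2 i : nat, (i <= 1)%N & half i nu)
    (fun z => br (k.+1%:R - cbil G (cx b) z)).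
  apply: (exp_poly_ext (f := fun z => qp k.+1%:R * EE (cx ((- 2^-1) *: b)) z +
     (- qp (- k.+1%:R)) * EE (cx (2^-1 *: b)) z)).
    apply: exp_polyD; apply: exp_poly_mono; [exists 1%N|exists 0%N] => //.
      by rewrite /half; congr (_ *: _); field.
    by rewrite /half subr0.
  move=> z; rewrite /EE !complexifyZ !cbilZl mulNr -!qpowD /qbracket opprB.
  by rewrite rmorphN fmorphV rmorph_nat; congr (qp _ - qp _); field.
apply: (exp_poly_ext (exp_polyM _ IH hb)); last by move=> z; rewrite [RHS]qprod_recr.
move=> mu nu [l lk ->] [i i1 ->]; exists (l + i)%N.
  by rewrite -[k.+1]addn1 leq_add.
by rewrite -scalerDl natrD -[k.+1]addn1 natrD; congr (_ *: _); field.
Qed.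

(** The exponents are [rho - \sum l_a a^\vee] with integers [0 <= l_a <= m_a]: points of the
    polytope and, like [rho], coweights. *)
Lemma dual_leading_exp_poly : exp_poly G logq (fun nu => nu \in S) (leading G logq R' md v0).
Proof.
have rv0 : regular G R v0 by case: ba.
pose Q (r : seq 'rV[K]_n) nu := exists2 l : 'rV[K]_n -> nat, (forall a, (l a <= m a)%N) &
  nu = \sum_(a <- r) ((m a)%:R / 2 - (l a)%:R) *: cv a.
have h (r : seq 'rV[K]_n) : uniq r -> exp_poly G logq (Q r)
    (fun z => \prod_(a <- r) qprod logq (- cbil G (cx (cv a)) z) 1 (m a).+1).
  elim: r => [|a r IH] /=.
    move=> _; apply: (exp_poly_ext (f := fun z => 1 * EE (cx 0) z)).
      by apply: exp_poly_mono; exists (fun=> 0%N) => //; rewrite big_nil.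
    by move=> z; rewrite big_nil complexify0 EE0l mulr1.
  move=> /andP[ar ur].
  apply: (exp_poly_ext (exp_polyM _ (qprod_exp_poly (cv a) (m a)) (IH ur))); last first.
    by move=> z; rewrite big_cons.
  move=> mu nu [i im ->] [l lm ->].
  exists (fun b => if b == a then i else l b) => [b|]; first by case: eqP => [->|].
  rewrite big_cons eqxx; congr (_ + _); rewrite big_seq [RHS]big_seq; apply: eq_bigr => b br.
  by rewrite ifN //; apply: contraNneq ar => <-.
have := h [seq a <- R | 0 < bil G v0 a] (filter_uniq _ (fset_uniq R)).
move=> H; apply: (exp_poly_ext (exp_poly_sub _ H)); last first.
  by move=> z; rewrite dual_leadingE big_filter.
move=> nu [l lm ->]; apply/(ba_supp ba).
have e : \sum_(a <- [seq a <- R | 0 < bil G v0 a]) ((m a)%:R / 2 - (l a)%:R) *: cv a =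
  rho G R m v0 - \sum_(a <- R | 0 < bil G v0 a) (l a)%:R *: cv a.
  rewrite big_filter /rho scaler_sumr -sumrB; apply: eq_bigr => a _.
  by rewrite scalerBl [in RHS]scalerA mulrC.
split.
  exists (fun a => (l a)%:R); first by move=> a _; rewrite ler0n ler_nat lm.
  by rewrite e rho_veeE big_positive_roots.
move=> a aR; rewrite e bilBl rpredB //; first exact: (rho_coweight hG hR hred hm).
rewrite bil_suml big_seq_cond; apply: rpred_sum => b /andP[bR _].
by rewrite bilZl rpredM ?rpred_nat // bilC // (cartan_int hR).
Qed.

(** The product vanishes at [z + k a / 2] if [q^(2 (a^\vee, z)) = 1], because its factor
    [[k - (a^\vee, .)]] becomes [- [(a^\vee, z)]]; [string_vanishing] turns this into a limit
    relation. *)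
Theorem dual_leading_expansion : exists f : 'rV[K]_n -> K[i],
  [/\ forall z, leading G logq R' md v0 z = \sum_(nu <- S) f nu * EE (cx nu) z,
      limit_relations G logq R m S v0 f & f (rho G R m v0) = lead_const G logq R m v0].
Proof.
have [s sS es] := dual_leading_exp_poly.
have ef z : leading G logq R' md v0 z = \sum_(nu <- S) coef s nu * EE (cx nu) z.
  by rewrite es (@exp_sum_coef _ _ _ _ s S) // fset_uniq.
exists (coef s); split => //.
  move=> a nu0 k aR va nu0S km.
  apply: (string_vanishing hG hq (x := 0) (b := fun nu => coef s nu * qp (k%:R * (bil G nu a)%:C%C)) (root_neq0 hR aR)).
    move=> z hz.
    have : leading G logq R' md v0 (z + cx ((k%:R / 2) *: a)) = 0.
      rewrite dual_leadingE; apply/eqP; rewrite prodf_seq_eq0; apply/hasP; exists a => //.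
      rewrite va /= prodf_seq_eq0; apply/hasP; exists k; first by rewrite mem_index_iota ltnS.
      rewrite /= cbilDr cbil_complexify bilZr bil_coroot_self ?(root_neq0 hR) //.
      rewrite divfK ?pnatr_eq0 // rmorph_nat opprD addrCA subrr addr0 qbracketN oppr_eq0.
      by rewrite qbracket_eq0 hz.
    rewrite ef => e; rewrite -[RHS]e; apply: eq_bigr => nu _.
    rewrite add0r EEDr -mulrA [X in _ = _ * X]mulrC; congr (_ * (_ * _)).
    rewrite /EE cbil_complexify bilZr; congr (qp _).
    by rewrite !rmorphM /= fmorphV !rmorph_nat; field.
  by move=> nu nuS; rewrite bilBl rpredB //; exact: (ba_coweight ba).
have [g [t tl eg] eL] := @leading_factor _ _ _ logq R' md (dual_root_system hG hR) v0.
rewrite dual_rho_dual lead_const_dual in eL.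
set kap := lead_const G logq R m v0 in eL *; set rr := rho G R m v0 in eL *.
pose t' := (kap, rr) :: [seq (kap * p.1, rr + p.2) | p <- t].
have -> : coef s rr = coef t' rr.
  apply: (coef_unique hG hq) => x; rewrite -es eL /exp_sum /t' big_cons /= big_map.
  have -> : g x = 1 + exp_sum G logq t x by rewrite -eg; ring.
  rewrite mulrDr mulr1 /exp_sum mulr_sumr; congr (_ + _); apply: eq_bigr => p _ /=.
  by rewrite complexifyD EEDl; ring.
rewrite /t' -cat1s coef_cat [X in _ + X]coef_out ?addr0 /coef ?big_cons ?big_nil ?eqxx ?addr0 //.
move=> _ /mapP[p pt ->] /=; have [vp _] := tl p pt.
apply: contraTneq vp => e; rewrite -leNgt.
have -> : p.2 = 0 by apply: (addrI rr); rewrite addr0.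
by rewrite bil0r.
Qed.

End DualLeading.

(** * Laurent polynomials in one variable *)

Section OneVariable.
Context (K : realType) (logq : K[i]).
Hypothesis hq : forall k : nat, (0 < k)%N -> cexp logq ^+ k != 1.
Local Notation qp := (qpow logq).
Implicit Types (z : 'rV[K[i]]_1) (f : 'rV[K[i]]_1 -> K[i]) (p q r : {poly K[i]}).

(** The roots of the polynomial [q] are removed one at a time. A nonzero root is a value of [qp], so
    it is a root of [p] too and continuity permits division; a root 0 is absorbed into [f] as a
    factor [qp z]. *)
Lemma laurent_quotient q p f : q != 0 -> ccont f ->
  (forall z, q.[qp (z 0 0)] * f z = p.[qp (z 0 0)]) ->
  exists k r, [/\ (k < size q)%N, (size r <= size p)%N &
    forall z, qp (z 0 0) ^+ k * f z = r.[qp (z 0 0)]].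
Proof.
have lq := logq_neq0 hq.
move: {2}(size q) (leqnn (size q)) => N; elim: N q p f => [|N IH] q p f sq q0 fc h.
  by move: q0; rewrite -size_poly_eq0 -leqn0 sq.
have [sq1|sq1] := eqVneq (size q) 1.
  have /size_poly1P[k k0 ek] : size q == 1 by rewrite sq1.
  exists 0%N, (k^-1 *: p); split; rewrite ?sq1 ?size_scale ?invr_neq0 // => z.
  by rewrite expr0 mul1r hornerZ -h ek hornerC mulKf.
have [t rt] := closed_rootP q sq1.
have /factor_theorem[q1 eq1] := rt.
have q10 : q1 != 0 by apply: contraNneq q0 => e; rewrite eq1 e mul0r.
have sq1' : size q = (size q1).+1 by rewrite eq1 size_Mmonic ?monicXsubC // size_XsubC addn2.
have [t0|t0] := eqVneq t 0.
  have fc' : ccont (fun z => qp (z 0 0) * f z).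
    by apply: ccontM => //; apply: ccont_cexp; apply: ccontM; [exact: ccont_coord|exact: ccont_cst].
  have [|z|k [r [kq sr hr]]] := IH q1 p (fun z => qp (z 0 0) * f z) _ q10 fc'.
  - by rewrite -ltnS -sq1'.
  - by rewrite mulrA -h eq1 hornerM hornerXsubC t0 subr0.
  exists k.+1, r; split => //; first by rewrite sq1' ltnS.
  by move=> z; rewrite exprSr -mulrA hr.
have [w ew] := cexp_surj t0.
pose z0 : 'rV[K[i]]_1 := const_mx (w / logq).
have qz0 : qp (z0 0 0) = t by rewrite /z0 mxE /qpow divfK.
have /factor_theorem[p1 ep1] : root p t.
  by rewrite /root -qz0 -h qz0 (rootP rt) mul0r.
have h1 z : q1.[qp (z 0 0)] * f z = p1.[qp (z 0 0)].
  apply/eqP; rewrite -subr_eq0; apply/eqP.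
  pose g z := q1.[qp (z 0 0)] * f z - p1.[qp (z 0 0)].
  have pc (p' : {poly K[i]}) : ccont (fun z : 'rV[K[i]]_1 => p'.[qp (z 0 0)]).
    apply: (ccont_ext (f := fun z : 'rV[K[i]]_1 => \sum_(i < size p') p'`_i * qp (z 0 0) ^+ i)).
      apply: ccont_sum => i _; apply: ccontM; first exact: ccont_cst.
      have qc : ccont (fun z : 'rV[K[i]]_1 => qp (z 0 0)).
        by apply: ccont_cexp; apply: ccontM; [exact: ccont_coord|exact: ccont_cst].
      elim: (i : nat) => [|j IHj].
        by apply: (ccont_ext (ccont_cst 1)) => z'; rewrite expr0.
      by apply: (ccont_ext (ccontM qc IHj)) => z'; rewrite exprS.
    by move=> z'; rewrite horner_coef.
  have gc : ccont g by apply: ccontB => //; apply: ccontM.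
  have g0 z' : qp (z' 0 0) != t -> g z' = 0.
    move=> zt; apply/eqP; rewrite /g; have := h z'.
    rewrite eq1 ep1 !hornerM !hornerXsubC => /eqP; rewrite -subr_eq0 mulrAC -mulrBl.
    by rewrite mulf_eq0 [_ - t == 0]subr_eq0 (negPf zt) orbF.
  have [zt|zt] := eqVneq (qp (z 0 0)) t; last exact: g0.
  (* On this real line [qp] takes the value [t] only at parameter 0. *)
  apply: (line_identity (w := const_mx logq^-1) (bad := [:: 0]) gc) => s.
  rewrite inE => s0; apply: g0; rewrite !mxE qpowD zt.
  have -> : qp (s%:C%C * logq^-1) = (expR s)%:C%C by rewrite /qpow divfK // cexp_real.
  rewrite -subr_eq0 -{2}[t]mulr1 -mulrBr mulf_neq0 // subr_eq0.
  rewrite -(rmorph1 (real_complex K)) (inj_eq (@complexI K)) -expR0.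
  by rewrite (inj_eq (@expR_inj K)).
have [|k [r [kq sr hr]]] := IH q1 p1 f _ q10 fc h1.
  by rewrite -ltnS -sq1'.
exists k, r; split => //; first by rewrite sq1' ltnW.
case: (eqVneq p1 0) ep1 sr => [-> _ sr|p10 ep1 sr].
  by move: sr; rewrite size_poly0 leqn0 size_poly_eq0 => /eqP->; rewrite size_poly0.
by rewrite ep1 size_Mmonic ?monicXsubC // size_XsubC addn2 /= (leq_trans sr).
Qed.

Lemma qpow_nat_inj (i j : nat) : (qp i%:R == qp j%:R) = (i == j).
Proof.
rewrite -(inj_eq (mulIf (qpow_neq0 logq (- j%:R)))) -!qpowD subrr qpow0.
have -> : i%:R - j%:R = (i%:Z - j%:Z)%:~R :> K[i] by rewrite intrB -!pmulrn.
by rewrite (qpow_int_eq1 hq) subr_eq0 eqz_nat.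
Qed.

(** Lagrange basis at the nodes q^0, ..., q^(E - 1), distinct because q is not a root of unity. *)
Definition node_basis (E i : nat) : {poly K[i]} :=
  (\prod_(j <- rem i (iota 0 E)) (qp i%:R - qp j%:R))^-1 *:
  \prod_(j <- rem i (iota 0 E)) ('X - (qp j%:R)%:P).

Lemma size_node_basis E i : (i < E)%N -> (size (node_basis E i) <= E)%N.
Proof.
move=> iE; apply: (leq_trans (size_scale_leq _ _)).
by rewrite size_prod_XsubC size_rem ?mem_iota // size_iota prednK // (leq_ltn_trans _ iE).
Qed.

Lemma node_basisE E i k : (i < E)%N -> (k < E)%N -> (node_basis E i).[qp k%:R] = (k == i)%:R.
Proof.
move=> iE kE; rewrite /node_basis hornerZ horner_prod.
have [->|ki] := eqVneq k i.
  under [X in _ * X]eq_bigr do rewrite hornerXsubC.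
  rewrite mulVf // prodf_seq_neq0; apply/allP => j.
  rewrite mem_rem_uniq ?iota_uniq // !inE => /andP[ji _] /=.
  by rewrite subr_eq0 qpow_nat_inj eq_sym.
rewrite [X in _ * X](_ : _ = 0) ?mulr0 //.
apply/eqP; rewrite prodf_seq_eq0; apply/hasP; exists k.
  by rewrite mem_rem_uniq ?iota_uniq // !inE ki mem_iota.
by rewrite /= hornerXsubC subrr.
Qed.

Lemma node_interpolation E p w : (size p <= E)%N ->
  p.[w] = \sum_(0 <= i < E) p.[qp i%:R] * (node_basis E i).[w].
Proof.
move=> sp; pose g := \sum_(0 <= i < E) p.[qp i%:R] *: node_basis E i.
suff -> : p = g.
  rewrite {1}/g horner_sum; apply: eq_big_nat => i /andP[_ iE]; rewrite hornerZ; congr (_ * _).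
  rewrite /g horner_sum (bigD1_seq i) ?mem_index_iota ?iota_uniq //= hornerZ node_basisE // eqxx mulr1.
  rewrite big_seq_cond big1 ?addr0 // => k /andP[]; rewrite mem_index_iota => /andP[_ kE] ki.
  by rewrite hornerZ node_basisE // eq_sym (negPf ki) mulr0.
apply/eqP; rewrite -subr_eq0; apply/eqP.
apply: (@roots_geq_poly_eq0 _ _ [seq qp k%:R | k <- iota 0 E]).
- apply/allP => w0 /mapP[k]; rewrite mem_iota add0n => /andP[_ kE] ->.
  rewrite /root hornerD hornerN subr_eq0 /g horner_sum.
  rewrite (bigD1_seq k) ?mem_index_iota ?iota_uniq //= hornerZ node_basisE // eqxx mulr1.
  rewrite big_seq_cond big1 ?addr0 // => i /andP[]; rewrite mem_index_iota => /andP[_ iE] ik.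
  by rewrite hornerZ node_basisE // eq_sym (negPf ik) mulr0.
- by rewrite map_inj_uniq ?iota_uniq // => i j /eqP; rewrite qpow_nat_inj => /eqP.
rewrite size_map size_iota (leq_trans (size_polyD _ _)) // size_polyN geq_max sp /=.
rewrite /g; apply: (leq_trans (size_sum _ _ _)); apply/bigmax_leqP_seq => i.
rewrite mem_index_iota => /andP[_ iE] _.
exact: leq_trans (size_scale_leq _ _) (size_node_basis iE).
Qed.

End OneVariable.

(** * From rational to polynomial coefficients *)

Section Polynomiality.
Context (K : realType) (n : nat) (G : 'M[K]_n) (logq : K[i]).
Hypothesis hG : scalar_product G.
Hypothesis hq : forall k : nat, (0 < k)%N -> cexp logq ^+ k != 1.
Context (R : {fset 'rV[K]_n}).
Hypothesis hR : root_system G R.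
Implicit Types (a b u v w mu nu : 'rV[K]_n) (x y : 'rV[K[i]]_n).
Implicit Types (F Q P : 'rV[K[i]]_n -> K[i]).
Local Notation cx := (@complexify K 1 n).
Local Notation cv := (coroot G).
Local Notation qp := (qpow logq).
Local Notation EE := (EE G logq).

(** Makes [q^(2 (mu, x + t a^\vee))] a multiple of an integral power of [qp t]. *)
Definition half_weight mu := forall a, a \in R -> 2 * bil G mu (cv a) \is a Num.int.

(** One [D] serves all [x] and may be enlarged, so that numerator and denominator can share it. *)
Lemma exp_sum_line (s : seq (K[i] * 'rV[K]_n)) b : b \in R ->
  (forall p, p \in s -> half_weight p.2) -> exists D : nat, forall D', (D <= D')%N ->
  forall x, exists2 q : {poly K[i]}, (size q <= (D' + D').+1)%N &
    forall t, qp t ^+ D' * exp_sum G logq s (x + t *: cx (cv b)) = q.[qp t].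
Proof.
move=> bR hs.
pose e (p : K[i] * 'rV[K]_n) := Num.floor (2 * bil G p.2 (cv b)).
have eE p : p \in s -> 2 * bil G p.2 (cv b) = (e p)%:~R.
  by move=> ps; have := hs p ps b bR; rewrite intrEfloor => /eqP ->.
have [D hD] : exists D : nat, forall p, p \in s -> (absz (e p) <= D)%N.
  apply: (@seq_uniform _ s (fun p D => (absz (e p) <= D)%N)).
    by move=> p k l kl h; exact: leq_trans kl.
  by move=> p _; exists (absz (e p)).
exists D => D' DD' x.
have e0 p : p \in s -> exists2 j : nat, (j <= D' + D')%N & j%:Z = e p + D'%:Z.
  move=> /hD h; have {}h : `|e p| <= D'%:Z by rewrite -abszE lez_nat (leq_trans h).
  move: h; rewrite ler_norml => /andP[h1 h2].
  have h3 : 0 <= e p + D'%:Z by rewrite -lerBlDr sub0r.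
  exists (absz (e p + D'%:Z)); last by rewrite gez0_abs.
  by rewrite -lez_nat gez0_abs // PoszD lerD2r.
pose j p := absz (e p + D'%:Z).
have jE p : p \in s -> ((j p)%:Z = e p + D'%:Z) /\ (j p <= D' + D')%N.
  by move=> /e0[k k1 k2]; rewrite /j -k2 absz_nat.
exists (\sum_(p <- s) (p.1 * EE (cx p.2) x) *: 'X^(j p)).
  apply: (leq_trans (size_sum _ _ _)); apply/bigmax_leqP_seq => p ps _.
  by apply: (leq_trans (size_scale_leq _ _)); rewrite size_polyXn ltnS; case: (jE p ps).
move=> t; rewrite /exp_sum mulr_sumr horner_sum big_seq [RHS]big_seq; apply: eq_bigr => p ps.
rewrite EEDr hornerZ hornerXn -!qpowMn mulrCA -mulrA; congr (_ * _).
rewrite mulrCA; congr (_ * _).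
rewrite /EE -qpowD cbilZr cbil_complexify; congr (qp _).
have -> : 2 * (t * (bil G p.2 (cv b))%:C%C) = t * (2 * bil G p.2 (cv b))%:C%C.
  by rewrite rmorphM /= rmorph_nat; ring.
rewrite eE // rmorph_int -mulr_natr -[t *+ j p]mulr_natr -mulrDr; congr (_ * _).
have [jp _] := jE p ps.
by rewrite addrC [(j p)%:R]pmulrn jp intrD.
Qed.

(** A Laurent polynomial [q^(- D t) p(q^t)] with [size p <= E] is the sum of its values at
    [t = 0, ..., E - 1] with these weights. *)
Definition line_weight (D E i : nat) (t : K[i]) : K[i] :=
  (qp t ^+ D)^-1 * qp i%:R ^+ D * (node_basis logq E i).[qp t].

(** On a line [F] is continuous and a quotient of polynomials in [qp t], hence a Laurent polynomial.
    [D] and [E] are uniform in [x], so base points with [Q x = 0] are reached through [dense]. *)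
Lemma line_interpolation F Q P b : b \in R -> ccont F ->
  exp_poly G logq half_weight Q -> exp_poly G logq half_weight P ->
  (forall f, ccont f -> (forall x, Q x != 0 -> f x = 0) -> forall x, f x = 0) ->
  (forall x, Q x * F x = P x) ->
  exists D E, forall x t,
    F (x + t *: cx (cv b)) = \sum_(0 <= i < E) F (x + i%:R *: cx (cv b)) * line_weight D E i t.
Proof.
move=> bR Fc [sQ hQ eQ] [sP hP eP] dense QFP.
have [D1 h1] := exp_sum_line bR hQ; have [D2 h2] := exp_sum_line bR hP.
pose D := maxn D1 D2.
(* Numerator and denominator have size at most [2 D + 1], so the remaining power of [qp t] is at
   most [2 D], and clearing it gives a polynomial of size at most [4 D + 1]. *)
exists (D + D)%N, ((D + D) + (D + D)).+1 => x t.
apply/eqP; rewrite -subr_eq0; apply/eqP; move: x.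
pose E := ((D + D) + (D + D)).+1.
pose f x := F (x + t *: cx (cv b)) -
   \sum_(0 <= i < E) F (x + i%:R *: cx (cv b)) * line_weight (D + D) E i t.
have fc : ccont f.
  apply: ccontB; first exact: ccont_shift.
  by apply: ccont_sum => i _; apply: ccontM; [exact: ccont_shift|exact: ccont_cst].
apply: (dense f fc) => x Qx; rewrite /f.
have [q sq hq'] := h1 D (leq_maxl _ _) x.
have [p sp hp] := h2 D (leq_maxr _ _) x.
have q0 : q != 0.
  apply: contraNneq Qx => q0; have := hq' 0.
  by rewrite qpow0 expr1n mul1r scale0r addr0 -eQ q0 horner0 => ->.
pose g (z : 'rV[K[i]]_1) := F (x + z 0 0 *: cx (cv b)).
have gc : ccont g.
  pose l (z : 'rV[K[i]]_1) : 'rV[K[i]]_n := x + z 0 0 *: cx (cv b).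
  have lc i : ccont (fun z : 'rV[K[i]]_1 => l z 0 i).
    apply: (ccont_ext (f := fun z : 'rV[K[i]]_1 => x 0 i + z 0 0 * cx (cv b) 0 i)).
      apply: ccontD; first exact: ccont_cst.
      by apply: ccontM; [exact: ccont_coord|exact: ccont_cst].
    by move=> z; rewrite !mxE.
  exact: (ccont_comp lc Fc).
have hz (z : 'rV[K[i]]_1) : q.[qp (z 0 0)] * g z = p.[qp (z 0 0)].
  by rewrite -hq' -hp /g -eQ -eP -mulrA QFP.
have [k [r [kq sr hr]]] := laurent_quotient hq q0 gc hz.
have kD : (k <= D + D)%N by rewrite -ltnS (leq_trans kq).
pose p' := r * 'X^(D + D - k).
have p'E (w : K[i]) : p'.[qp w] = qp w ^+ (D + D) * F (x + w *: cx (cv b)).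
  have := hr (const_mx w); rewrite /g !mxE => e.
  by rewrite /p' hornerM hornerXn -e mulrAC -exprD addnC subnK.
have sp' : (size p' <= E)%N.
  apply: (leq_trans (size_polyMleq _ _)); rewrite size_polyXn /E addnS /=.
  by rewrite -addSn leq_add // ?(leq_trans sr) // leq_subr.
have := node_interpolation hq (qp t) sp'; rewrite p'E => e.
apply/eqP; rewrite subr_eq0; apply/eqP.
apply: (mulfI (expf_neq0 (D + D) (qpow_neq0 logq t))); rewrite e mulr_sumr.
apply: eq_bigr => i _; rewrite p'E /line_weight.
have h0 : qp t ^+ (D + D) != 0 by rewrite expf_neq0 // qpow_neq0.
by rewrite -[_^-1 * _ * _]mulrA mulrCA mulVKf //; ring.
Qed.

Lemma line_weight_exp_poly D E i w :
  exp_poly G logq (fun=> True) (fun x => line_weight D E i (cbil G (cx w) x)).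
Proof.
have hexp j : exp_poly G logq (fun=> True) (fun x => qp (cbil G (cx w) x) ^+ j).
  apply: (exp_poly_ext (f := fun x => 1 * EE (cx ((j%:R / 2) *: w)) x)).
    exact: exp_poly_mono.
  move=> x; rewrite mul1r /EE complexifyZ cbilZl -qpowMn; congr (qp _).
  by rewrite rmorphM /= fmorphV !rmorph_nat -mulr_natl; field.
apply: (@exp_polyM _ _ _ _ (fun=> True) (fun=> True)) => //.
  apply: (exp_poly_ext (f := fun x => qp i%:R ^+ D * EE (cx ((- (D%:R / 2)) *: w)) x)).
    exact: exp_poly_mono.
  move=> x; rewrite mulrC; congr (_ * _).
  rewrite /EE complexifyZ cbilZl -qpowMn -qpowN; congr (qp _).
  by rewrite rmorphN rmorphM /= fmorphV !rmorph_nat -[_ *+ D]mulr_natl; field.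
apply: (exp_poly_ext (f := fun x => \sum_(j < size (node_basis logq E i))
   (node_basis logq E i)`_j * qp (cbil G (cx w) x) ^+ j)).
  by apply: exp_poly_sum => j _; exact: exp_polyZ.
by move=> x; rewrite horner_coef.
Qed.

(** Moving along one coroot after another expresses [F] by its values at finitely many points, with
    weights that are exponential sums in [x]. *)
Lemma interpolated_exp_poly F :
  (forall b, b \in R -> exists D E, forall x t,
    F (x + t *: cx (cv b)) = \sum_(0 <= i < E) F (x + i%:R *: cx (cv b)) * line_weight D E i t) ->
  exp_poly G logq (fun=> True) F.
Proof.
move=> h; have [t ht] := coroot_coordinates hG hR.
have main (l : seq 'rV[K]_n) y : {subset l <= R} -> exp_poly G logq (fun=> True)
    (fun x => F (y + \sum_(a <- l) cbil G (cx (t a)) x *: cx (cv a))).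
  elim: l y => [|a l IH] y sl.
    apply: (exp_poly_ext (f := fun x => F y * EE (cx 0) x)); first exact: exp_poly_mono.
    by move=> x; rewrite big_nil addr0 complexify0 EE0l mulr1.
  have [D [E hDE]] := h a (sl a (mem_head _ _)).
  apply: (exp_poly_ext (f := fun x => \sum_(0 <= i < E)
    F ((y + i%:R *: cx (cv a)) + \sum_(a <- l) cbil G (cx (t a)) x *: cx (cv a)) *
    line_weight D E i (cbil G (cx (t a)) x))).
    apply: exp_poly_sum => i _.
    apply: (@exp_polyM _ _ _ _ (fun=> True) (fun=> True)) => //; last exact: line_weight_exp_poly.
    by apply: IH => b bl; apply: sl; rewrite inE bl orbT.
  move=> x; rewrite big_cons addrCA addrC hDE; apply: eq_bigr => i _; congr (F _ * _).
  by rewrite addrAC.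
have mR := main R 0 (fun a aR => aR); apply: (exp_poly_ext mR) => x.
by rewrite add0r -ht.
Qed.

(** Along [v] the function [Q] is a polynomial in [exp(- 2 t)] with constant term 1, hence has
    finitely many zeros on each such line. *)
Lemma low_dense v (L : 'rV[K]_n -> Prop) Q : (forall mu, L mu -> bil G v mu \is a Num.int) ->
  low G logq v L 1 Q ->
  forall f, ccont f -> (forall x, Q x != 0 -> f x = 0) -> forall x, f x = 0.
Proof.
move=> hL [s hs es] f fc h x.
have jE p : p \in s -> exists j : nat, bil G v p.2 = - j.+1%:R.
  move=> ps; have [v0 Lp] := hs p ps; have /intrP[k ek] := hL _ Lp.
  have k0 : k < 0 by rewrite -(ltr_int K) -ek.
  case: k ek k0 => // k ek _; exists k; by rewrite ek NegzE mulrNz -pmulrn.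
pose j (p : K[i] * 'rV[K]_n) := absz (Num.floor (- bil G v p.2)).
have {}jE p : p \in s -> bil G v p.2 = - (j p)%:R /\ (0 < j p)%N.
  move=> /jE[k e]; rewrite /j e opprK.
  by have -> : Num.floor (k.+1%:R : K) = k.+1%:Z by rewrite [k.+1%:R]pmulrn intrKfloor.
pose q : {poly K[i]} := 1 + \sum_(p <- s) (p.1 * EE (cx p.2) x) *: 'X^(j p).
have q0 : q != 0.
  apply/eqP => q0; have : q.[0] = 1.
    rewrite /q hornerD hornerC horner_sum big_seq big1 ?addr0 // => p /jE[_ jp].
    by rewrite hornerZ hornerXn expr0n (gtn_eqF jp) mulr0.
  by rewrite q0 horner0 => /esym/eqP; rewrite oner_eq0.
have [rs hrs] := closed_field_poly_normal q.
pose bad := [seq - ln (complex.Re r) / 2 | r <- rs].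
apply: (line_identity (w := logq^-1 *: cx v) (bad := bad) fc) => t tb.
apply: h; apply: contra tb => /eqP Q0.
have qt : q.[(expR (- (2 * t)))%:C%C] = 0.
  rewrite -[RHS]Q0 -[X in _ = X](subrK 1) es addrC /q hornerD hornerC horner_sum; congr (_ + _).
  rewrite /exp_sum big_seq [RHS]big_seq; apply: eq_bigr => p ps.
  rewrite hornerZ hornerXn EEDr -mulrA; congr (_ * (_ * _)).
  rewrite scalerA EE_line // -rmorphXn /= -expRM_natl; congr (expR _)%:C%C.
  by rewrite bilC //; case: (jE p ps) => -> _; ring.
have : root q (expR (- (2 * t)))%:C%C by rewrite /root qt.
rewrite hrs rootZ ?lead_coef_eq0 // root_prod_XsubC => rr.
apply/mapP; exists (expR (- (2 * t)))%:C%C => //=.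
by rewrite expRK; field.
Qed.

End Polynomiality.

(** * Exponents and top coefficient in the first variable *)

Section CoefficientStructure.
Context (K : realType) (n : nat) (G : 'M[K]_n) (logq : K[i]).
Hypothesis hG : scalar_product G.
Hypothesis hq : forall k : nat, (0 < k)%N -> cexp logq ^+ k != 1.
Context (R : {fset 'rV[K]_n}) (m : 'rV[K]_n -> nat).
Hypothesis hR : root_system G R.
Hypothesis hred : reduced R.
Hypothesis hm : invariant_multiplicity G R m.
Context (v0 : 'rV[K]_n) (S : {fset 'rV[K]_n}) (c : 'rV[K]_n -> 'rV[K[i]]_n -> K[i]).
Context (psi : 'rV[K[i]]_n -> 'rV[K[i]]_n -> K[i]).
Hypothesis ba : ba_data G logq R m v0 S c psi.
Implicit Types (a b u v w mu nu : 'rV[K]_n) (x y z : 'rV[K[i]]_n).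
Implicit Types (s t : seq (K[i] * 'rV[K]_n)).
Local Notation cx := (@complexify K 1 n).
Local Notation cv := (coroot G).
Local Notation EE := (EE G logq).
Local Notation ES := (exp_sum G logq).
Local Notation weight := (weight_lattice G R).
Local Notation low v := (low G logq v weight).

(** The shift multiplies [q^(2 (mu, x))] by [exp(2 pi i (mu, b^\vee))], so it detects exponents
    modulo the weight lattice. *)
Definition period b : 'rV[K[i]]_n := ((pi *i)%C / logq) *: cx (cv b).

Lemma EE_period mu b x : EE (cx mu) (x + period b) =
  EE (cx mu) x * cexp ((2 * pi * bil G mu (cv b)) *i)%C.
Proof.
rewrite EEDr; congr (_ * _); rewrite /EE /period cbilZr cbil_complexify /qpow; congr cexp.
have -> : ((2 * pi * bil G mu (cv b)) *i)%C = 2 * (pi *i)%C * (bil G mu (cv b))%:C%C.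
  by apply/eqP; rewrite eq_complex /=; apply/andP; split; apply/eqP; ring.
by field; exact: logq_neq0 hq.
Qed.

Lemma cexp_2ipi_int (r : K) : r \is a Num.int -> cexp ((2 * pi * r) *i)%C = 1.
Proof.
move=> /intrP[k ->].
have addi (a b : K) : ((a + b) *i)%C = (a *i)%C + (b *i)%C.
  by apply/eqP; rewrite eq_complex /= addr0 !eqxx.
have h1 : cexp ((2 * pi) *i)%C = 1 :> K[i].
  by rewrite mulr_natl mulr2n addi cexpD cexp_ipi mulrNN mulr1.
have h (j : nat) : cexp ((2 * pi * j%:R) *i)%C = 1 :> K[i].
  elim: j => [|j IH]; first by rewrite mulr0; exact: cexp0.
  by rewrite -(natr1 j) mulrDr mulr1 addi cexpD IH h1 mulr1.
case: k => k; first by rewrite -pmulrn h.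
rewrite NegzE mulrNz -pmulrn.
have -> : ((2 * pi * - k.+1%:R) *i)%C = - ((2 * pi * k.+1%:R) *i)%C :> K[i].
  by apply/eqP; rewrite eq_complex /= oppr0 eqxx mulrN eqxx.
by rewrite cexpN h invr1.
Qed.

Lemma low_period v k f b x : b \in R -> low v k f -> f (x + period b) = f x.
Proof.
move=> bR [s hs es]; apply: (addIr (- k)); rewrite !es; apply: eq_big_seq => p ps.
rewrite EE_period cexp_2ipi_int ?mulr1 //.
by have [_ h] := hs p ps; exact: h.
Qed.

(** Each exponent occurs once and with nonzero coefficient, so bounds on the support become bounds
    on the list. *)
Definition reduced_sum s : seq (K[i] * 'rV[K]_n) :=
  [seq (coef s mu, mu) | mu <- undup [seq p.2 | p <- s] & coef s mu != 0].

Lemma reduced_sumE s x : ES (reduced_sum s) x = ES s x.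
Proof.
rewrite (@exp_sum_coef _ _ _ _ s (undup [seq p.2 | p <- s])) ?undup_uniq //; last first.
  by move=> p ps; rewrite mem_undup map_f.
rewrite /reduced_sum /exp_sum big_map big_filter big_mkcond; apply: eq_bigr => mu _ /=.
by case: eqP => [->|//]; rewrite mul0r.
Qed.

Lemma reduced_sum_coef s p : p \in reduced_sum s -> coef s p.2 != 0.
Proof. by move=> /mapP[mu]; rewrite mem_filter => /andP[h _] ->. Qed.

Lemma coef_cons p s mu : coef (p :: s) mu = (if p.2 == mu then p.1 else 0) + coef s mu.
Proof. by rewrite /coef big_cons; case: eqP => // _; rewrite add0r. Qed.

Section Top.
Variable v : 'rV[K]_n.
Hypothesis rv : regular G R v.
Hypothesis iv : forall mu, weight mu -> bil G v mu \is a Num.int.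
Local Notation top := (dual_rho G R m v).

Lemma half_weight_dual_rho : half_weight G R top.
Proof.
move=> b bR; rewrite /dual_rho bil_suml mulr_sumr big_seq_cond; apply: rpred_sum => a /andP[aR _].
by rewrite bilZl mulrA mulrCA divff ?pnatr_eq0 // mulr1 rpredM ?rpred_nat // (cartan_int hR).
Qed.

Lemma weight_half mu : weight mu -> half_weight G R mu.
Proof. by move=> h b bR; rewrite rpredM ?rpred_nat // h. Qed.

(** Exponents are compared in [Q c = kap q^(2 (top, x)) h], where along [v] the functions [Q] and
    [h] tend to 1 and [l nu]. The factor [l] is shared with all solutions of the limit system, which
    later identifies the top coefficient. *)
Lemma coefficient_top nu : nu \in S -> exists2 l : K[i],
  forall f, limit_relations G logq R m S v f -> f nu = f (rho G R m v) * l &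
  exp_poly G logq (fun=> True) (c nu) /\
  forall s, (forall x, c nu x = ES s x) ->
    coef s top = lead_const G logq R m v * l /\
    forall mu, coef s mu != 0 ->
      [/\ bil G v mu <= bil G v top, bil G v mu = bil G v top -> mu = top & weight (mu - top)].
Proof.
move=> nuS.
have [l [Q [P [lowQ lowP QcP hl]]]] := rational_coefficients hG hq hR hred hm ba rv.
exists (l nu); first by move=> f hf; exact: (hl f hf nu nuS).
have [g lowg eL] := leading_factor logq m hR v.
set kap := lead_const G logq R m v in eL *.
have lowh := lowM (@weight_latticeD _ _ G R) lowg (lowP nu nuS).
rewrite mul1r in lowh; set h := (fun x => _) in lowh.
have Qc x : Q x * c nu x = kap * EE (cx top) x * h x by rewrite QcP // eL /h; ring.
have dense := low_dense hG hq iv lowQ.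
have cc : ccont (c nu) by exact: (ba_cont ba).
have polyl k f : low v k f -> exp_poly G logq weight f.
  move=> lf; have w0 : weight 0 by move=> b bR; rewrite bil0l rpred0.
  apply: (exp_poly_ext (f := fun x => (f x - k) + k * EE (cx 0) x)).
    apply: exp_polyD; last exact: exp_poly_mono.
    by apply: exp_poly_sub lf => mu [].
  by move=> x; rewrite complexify0 EE0l mulr1 subrK.
split.
  apply: (interpolated_exp_poly hG hR) => b bR.
  apply: (line_interpolation hq bR cc _ _ dense Qc).
    by apply: exp_poly_sub (polyl _ _ lowQ); exact: weight_half.
  apply: (@exp_polyM _ _ _ _ (fun mu => mu = top) weight).
  - move=> mu mu' -> hmu b' b'R; rewrite bilDl mulrDr rpredD ?half_weight_dual_rho //.
    exact: weight_half.
  - exact: exp_poly_mono.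
  - exact: polyl lowh.
move=> s es.
have coefper b mu : b \in R -> coef s mu != 0 -> bil G (mu - top) (cv b) \is a Num.int.
  move=> bR cmu; pose om := cexp ((2 * pi * bil G top (cv b)) *i)%C.
  (* Holds where [Q] is nonzero, since [Q] and [h] are periodic, and everywhere by density;
     comparing coefficients then shows that [(mu - top, b^\vee)] is an integer. *)
  have per : forall x, c nu (x + period b) - om * c nu x = 0.
    apply: dense.
      apply: ccontB; first exact: ccont_shift.
      by apply: ccontM => //; exact: ccont_cst.
    move=> x Qx; apply: (mulfI Qx); rewrite mulr0 mulrBr.
    rewrite -{1}(low_period x bR lowQ) Qc EE_period (low_period x bR lowh) -/om.
    rewrite [X in _ - X]mulrCA Qc.
    by ring.
  have := @coef_unique _ _ _ _ hG hq
    [seq (p.1 * cexp ((2 * pi * bil G p.2 (cv b)) *i)%C, p.2) | p <- s] [seq (om * p.1, p.2) | p <- s] mu.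
  have e1 x : ES [seq (p.1 * cexp ((2 * pi * bil G p.2 (cv b)) *i)%C, p.2) | p <- s] x =
              ES [seq (om * p.1, p.2) | p <- s] x.
    have /eqP := per x; rewrite subr_eq0 !es => /eqP e.
    rewrite {2}/exp_sum big_map /=.
    transitivity (om * ES s x); last first.
      by rewrite /exp_sum mulr_sumr; apply: eq_bigr => p _; rewrite mulrA.
    rewrite -e /exp_sum big_map; apply: eq_bigr => p _ /=.
    by rewrite EE_period mulrAC -mulrA.
  move=> /(_ e1); rewrite {1}/coef big_map /= {1}/coef big_map /= -mulr_sumr -/(coef s mu).
  under eq_bigr => p /eqP -> do [].
  rewrite -mulr_suml -/(coef s mu) [RHS]mulrC => /(mulfI cmu) e.
  have {}e : cexp ((2 * pi * bil G mu (cv b)) *i)%C = om by [].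
  apply: cexp_2ipi_eq1.
  have -> : ((2 * pi * bil G (mu - top) (cv b)) *i)%C =
     ((2 * pi * bil G mu (cv b)) *i)%C - ((2 * pi * bil G top (cv b)) *i)%C.
    by apply/eqP; rewrite eq_complex /= subrr eqxx /= bilBl; apply/eqP; ring.
  by rewrite cexpD cexpN e mulfV // cexp_neq0.
pose s' := reduced_sum s.
have cs' mu : coef s' mu = coef s mu.
  by apply: (coef_unique hG hq) => x; rewrite reduced_sumE.
have [tQ htQ etQ] := lowQ; have [th hth eth] := lowh.
pose tL := s' ++ [seq (p.1 * p'.1, p.2 + p'.2) | p <- tQ, p' <- s'].
pose tR := (kap * l nu, top) :: [seq (kap * p.1, top + p.2) | p <- th].
have LR mu : coef tL mu = coef tR mu.
  apply: (coef_unique hG hq) => x.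
  transitivity (Q x * c nu x).
    rewrite /tL /exp_sum big_cat /= -/(ES s' x) reduced_sumE -es.
    rewrite -[X in X * _](subrK 1) etQ mulrDl mul1r addrC; congr (_ + _).
    rewrite big_allpairs_dep /= es -(reduced_sumE s) /exp_sum mulr_suml; apply: eq_bigr => p _.
    by rewrite mulr_sumr; apply: eq_bigr => p' _; rewrite /= complexifyD EEDl; ring.
  rewrite Qc -[h x](subrK (l nu)) eth /tR /exp_sum big_cons big_map /= mulrDr addrC.
  congr (_ + _); first by ring.
  by rewrite mulr_sumr; apply: eq_bigr => p _ /=; rewrite complexifyD EEDl; ring.
(* At a level bounding all exponents, the lower terms of [Q] and [h] contribute nothing. *)
have key (Lam : K) mu0 : (forall p, p \in s' -> bil G v p.2 <= Lam) -> bil G v top <= Lam ->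
    bil G v mu0 = Lam -> coef s mu0 = if top == mu0 then kap * l nu else 0.
  move=> hs htop hmu0; have := LR mu0.
  rewrite /tL coef_cat cs' [X in _ + X]coef_out ?addr0; last first.
    move=> _ /allpairsP[[p p'] [/= ptQ p's' ->]] /=; have [vp _] := htQ p ptQ.
    have := hs p' p's'; apply: contraTneq => e; rewrite -ltNge -hmu0 -e bilDr.
    by lra.
  move=> ->; rewrite /tR coef_cons /= [X in _ + X]coef_out ?addr0 //.
  move=> _ /mapP[p pth ->] /=; have [vp _] := hth p pth.
  apply: contraTneq htop => e; rewrite -ltNge -hmu0 -e bilDr; lra.
have bound p : p \in s' -> bil G v p.2 <= bil G v top.
  move=> ps'; have [p1 p1s' hmax] := seq_argmax (fun p => bil G v p.2) ps'.
  rewrite leNgt; apply/negP => lt.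
  have lt1 : bil G v top < bil G v p1.2 by apply: lt_le_trans lt (hmax p ps').
  have := key (bil G v p1.2) p1.2 hmax (ltW lt1) erefl.
  case: eqP => [e|_ e]; first by move: lt1; rewrite e ltxx.
  by have := reduced_sum_coef p1s'; rewrite e eqxx.
split.
  by rewrite (key (bil G v top) top bound (lexx _) erefl) eqxx.
move=> mu cmu.
have mus' : (coef s mu, mu) \in s'.
  apply/mapP; exists mu => //; rewrite mem_filter cmu mem_undup.
  apply: contraT => mun; move: cmu; rewrite coef_out ?eqxx // => p ps.
  by apply: contraNneq mun => <-; exact: map_f.
split; first exact: (bound _ mus').
- move=> e; have := key (bil G v top) mu bound (lexx _) e.
  by case: eqP => [-> //|_ e']; move: cmu; rewrite e' eqxx.
- by move=> b bR; exact: coefper.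
Qed.

End Top.
End CoefficientStructure.

(** * Duality *)

Section Duality.
Context (K : realType) (n : nat) (G : 'M[K]_n) (logq : K[i]).
Hypothesis hG : scalar_product G.
Hypothesis hq : forall k : nat, (0 < k)%N -> cexp logq ^+ k != 1.
Context (R : {fset 'rV[K]_n}) (m md : 'rV[K]_n -> nat).
Hypothesis hR : root_system G R.
Hypothesis hred : reduced R.
Hypothesis hm : invariant_multiplicity G R m.
Hypothesis hmd : forall a, a \in R -> md (coroot G a) = m a.
Context (v0 : 'rV[K]_n) (S : {fset 'rV[K]_n}) (c : 'rV[K]_n -> 'rV[K[i]]_n -> K[i]).
Context (psi : 'rV[K[i]]_n -> 'rV[K[i]]_n -> K[i]).
Hypothesis ba : ba_data G logq R m v0 S c psi.
Hypothesis iv0 : forall mu, weight_lattice G R mu -> bil G v0 mu \is a Num.int.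
Implicit Types (a b u v w mu nu : 'rV[K]_n) (x y z : 'rV[K[i]]_n).
Local Notation cx := (@complexify K 1 n).
Local Notation cv := (coroot G).
Local Notation EE := (EE G logq).
Local Notation ES := (exp_sum G logq).
Local Notation R' := (dual_roots G R).
Local Notation top := (dual_rho G R m v0).

Let rv0 : regular G R v0. Proof. by case: ba. Qed.

Lemma dual_rhoN : dual_rho G R m (- v0) = - top.
Proof.
have hR' := dual_root_system hG hR; have hm' := dual_invariant hG hR hm hmd.
have rv' := dual_regular hG hR rv0.
rewrite !(dual_rhoE hG hR hmd) (rhoE hG hR' hm' (- v0) rv') (rhoE hG hR' hm' v0 rv').
rewrite -scalerN -sumrN; congr (_ *: _); apply: eq_bigr => b _.
by rewrite bilNl sgrN scaleNr.
Qed.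

(** [coefficient_top] in the directions [v0] and [- v0] bounds the exponents from both sides. *)
Lemma coefficient_expansion f : limit_relations G logq R m S v0 f ->
    f (rho G R m v0) = lead_const G logq R m v0 ->
  exists s : 'rV[K]_n -> seq (K[i] * 'rV[K]_n), forall nu, nu \in S ->
  [/\ forall x, c nu x = ES (s nu) x, coef (s nu) top = f nu &
  forall p, p \in s nu -> [/\ `|bil G v0 p.2| <= bil G v0 top,
     bil G v0 p.2 = bil G v0 top -> p.2 = top & weight_lattice G R (p.2 - top)]].
Proof.
move=> hf f0.
suff /boolp.choice[s hs] : forall nu, exists s : seq (K[i] * 'rV[K]_n), nu \in S ->
  [/\ forall x, c nu x = ES s x, coef s top = f nu &
  forall p, p \in s -> [/\ `|bil G v0 p.2| <= bil G v0 top,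
     bil G v0 p.2 = bil G v0 top -> p.2 = top & weight_lattice G R (p.2 - top)]].
  by exists s.
move=> nu; case nuS: (nu \in S); last by exists [::].
have [l hl [[s _ es] hs]] := coefficient_top hG hq hR hred hm ba rv0 iv0 nuS.
have rvN : regular G R (- v0) by move=> a aR; rewrite bilNl oppr_eq0 rv0.
have ivN mu : weight_lattice G R mu -> bil G (- v0) mu \is a Num.int.
  by move=> h; rewrite bilNl rpredN iv0.
have [lN _ [_ hsN]] := coefficient_top hG hq hR hred hm ba rvN ivN nuS.
have [ct hc] := hs s es; have [_ hcN] := hsN s es.
exists (reduced_sum s) => _.
have cs mu : coef (reduced_sum s) mu = coef s mu.
  by apply: (coef_unique hG hq) => x; rewrite reduced_sumE.
split.
- by move=> x; rewrite reduced_sumE.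
- by rewrite cs ct hl // f0.
- move=> p /reduced_sum_coef hp; have [h1 h2 h3] := hc _ hp; have [h4 _ _] := hcN _ hp.
  split=> //; rewrite ler_norml h1 andbT.
  by move: h4; rewrite dual_rhoN bilNl bilNr bilNl opprK lerNl.
Qed.

Context (S' : {fset 'rV[K]_n}) (c' : 'rV[K]_n -> 'rV[K[i]]_n -> K[i]).
Context (psi' : 'rV[K[i]]_n -> 'rV[K[i]]_n -> K[i]).
Hypothesis ba' : ba_data G logq R' md v0 S' c' psi'.

Theorem duality x z : psi x z = psi' z x.
Proof.
have hR' := dual_root_system hG hR; have hm' := dual_invariant hG hR hm hmd.
have hred' := dual_reduced hG hR hred.
have rv' : regular G R' v0 by case: ba'.
have etop : top = rho G R' md v0 by exact: (dual_rhoE hG hR hmd).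
have [f [ef hf f0]] := dual_leading_expansion hG hq hR hred hm hmd ba.
have [s hs] := coefficient_expansion hf f0.
pose T := undup ((S' : seq 'rV[K]_n) ++ flatten [seq [seq p.2 | p <- s nu] | nu <- S]).
have uT : uniq T by exact: undup_uniq.
have sT nu p : nu \in S -> p \in s nu -> p.2 \in T.
  move=> nuS ps; rewrite mem_undup mem_cat; apply/orP; right.
  by apply/flattenP; exists [seq p.2 | p <- s nu]; [exact: map_f|exact: map_f].
have S'T mu : mu \in S' -> mu \in T by move=> h; rewrite mem_undup mem_cat h.
have TP mu : mu \in T -> [/\ `|bil G v0 mu| <= bil G v0 top,
    bil G v0 mu = bil G v0 top -> mu = top & forall b, b \in R' -> bil G mu b \is a Num.int].
  have topc b : b \in R' -> bil G top b \is a Num.int.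
    by rewrite etop; exact: (rho_coweight hG hR' hred' hm' rv').
  rewrite mem_undup mem_cat => /orP[muS'|].
    rewrite etop; have pmu := ba_polytope ba' muS'; split.
    - exact: (polytope_bound hG hR' hm' rv').
    - exact: (polytope_vertex hG hR' hm' rv' rv').
    - by move=> b bR'; exact: (ba_coweight ba').
  move=> /flattenP[_ /mapP[nu nuS ->] /mapP[p ps ->]].
  have [_ _ h] := hs nu nuS; have [h1 h2 h3] := h p ps; split=> // b bR'.
  rewrite -(subrK top p.2) bilDl rpredD ?topc // -(corootK hG b) h3 //.
  by rewrite -(dual_rootsP R hG).
(* The coefficient of [q^(2 (z + mu, y))] in [psi y z - psi' z y], see [eD]. *)
pose d mu z := \sum_(nu <- S) coef (s nu) mu * EE (cx nu) z - c' mu z.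
(* At [top] the sum is the expansion [ef] of the dual normalisation, which is also the coefficient
   of [psi']. *)
have dtop z0 : d top z0 = 0.
  apply/eqP; rewrite /d subr_eq0 etop (ba_norm ba') ef; apply/eqP.
  rewrite big_seq [RHS]big_seq; apply: eq_bigr => nu nuS.
  by rewrite -etop; have [_ -> _] := hs nu nuS.
have ccd mu : ccont (d mu).
  apply: ccontB; last exact: (ba_cont ba').
  apply: ccont_sum => nu _; apply: ccontM; [exact: ccont_cst|exact: ccont_EE].
have eD z0 y : psi y z0 - psi' z0 y = \sum_(mu <- T) d mu z0 * EE (z0 + cx mu) y.
  rewrite (ba_exp ba) (ba_exp ba').
  under [RHS]eq_bigr do rewrite mulrBl; rewrite sumrB; congr (_ - _).
    transitivity (\sum_(nu <- S) \sum_(mu <- T) coef (s nu) mu * EE (cx nu) z0 * EE (z0 + cx mu) y).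
      rewrite big_seq [RHS]big_seq; apply: eq_bigr => nu nuS.
      have [-> _ _] := hs nu nuS; rewrite (@exp_sum_coef _ _ _ _ (s nu) T) //; last first.
        by move=> p; exact: sT.
      rewrite mulr_suml; apply: eq_bigr => mu _.
      rewrite !EEDl (EEC _ hG y z0); ring.
    by rewrite exchange_big; apply: eq_bigr => mu _; rewrite -mulr_suml.
  rewrite [RHS](@sum_supported _ _ T S'); last by move=> mu h; rewrite (ba_zero ba') ?mul0r.
  rewrite -[RHS]big_filter; apply: perm_big; apply: uniq_perm.
  - exact: fset_uniq.
  - exact: filter_uniq.
  - by move=> mu; rewrite mem_filter andb_idr //; exact: S'T.
pose B := [seq b <- R' | 0 < bil G v0 b].
have BR b : b \in B -> b \in R' by rewrite mem_filter => /andP[].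
have Bp b : b \in B -> 0 < bil G v0 b by rewrite mem_filter => /andP[].
have d0 mu z0 : mu \in T -> d mu z0 = 0.
  move=> muT; apply: (generic_zero (G := G) hq (S := T) (B := B) (w := v0) (ccd mu)).
    by move=> b /Bp h; rewrite gt_eqF.
  move=> t z1 gen; apply/eqP; apply: contraT => dmu.
  have [mu1 [mu2 [/andP[mu1T d1] /andP[mu2T d2] hw]]] :
    exists mu1 mu2, [/\ (mu1 \in T) && (d mu1 z1 != 0), (mu2 \in T) && (d mu2 z1 != 0) &
      \sum_(b <- B) (md b)%:R * `|bil G v0 (cv b)| <= bil G v0 (mu1 - mu2)].
    apply: (quasi_invariant_width hG hq (f := fun y => psi y z1 - psi' z1 y) (x := z1)
        (c := fun mu => d mu z1) (nu0 := mu)) => //.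
    - by rewrite filter_uniq ?fset_uniq.
    - by move=> b /BR bR'; exact: (root_neq0 hR').
    - by move=> b1 b2 h1 h2; apply: (regular_independent hred' rv'); rewrite ?BR ?Bp.
    - move=> b mu3 mu4 /BR bR' h3 h4; have [_ _ h5] := TP _ h3; have [_ _ h6] := TP _ h4.
      by rewrite bilBl rpredB ?h5 ?h6.
    - move=> b /BR bR' k hk y hy.
      have bR : cv b \in R by rewrite -(dual_rootsP R hG).
      have e2 := ba_qi ba' z1 bR' hk hy; congr (_ - _); last exact: e2.
      have := dual_quasi_invariance hG hq hR hred hm ba (b := cv b) (s := k) (x := y) z1 bR _ hy.
      by rewrite corootK // -(hmd bR) corootK //; apply.
  have := bil_rho hG hR' hm' v0 rv'; rewrite -big_filter -/B -etop => e.
  rewrite -e bilBr in hw.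
  have [b1 t1 _] := TP _ mu1T; have [b2 _ _] := TP _ mu2T.
  (* The exponents just fill the required width, so a nonzero coefficient would have to occur at
     [top]. *)
  have e1 : mu1 = top.
    apply: t1; move: b1 b2; rewrite !ler_norml => /andP[_ b1] /andP[b2 _].
    by apply/eqP; rewrite eq_le b1 /=; lra.
  by move: d1; rewrite e1 dtop eqxx.
apply/eqP; rewrite -subr_eq0 eD; apply/eqP; rewrite big_seq big1 // => mu muT.
by rewrite d0 // mul0r.
Qed.

End Duality.

(** * Normalized functions and the duality theorem *)

Section Normalized.
Context (K : realType) (n : nat) (G : 'M[K]_n) (logq : K[i]).
Hypothesis hG : scalar_product G.
Context (R : {fset 'rV[K]_n}) (m : 'rV[K]_n -> nat).
Hypothesis hR : root_system G R.

Lemma weyl_invariant_multiplicity : weyl_invariant G R m -> invariant_multiplicity G R m.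
Proof.
move=> h a b aR bR; apply: (h (reflection G a)) bR; exists [:: a] => // c.
by rewrite inE => /eqP->.
Qed.

Hypothesis hred : reduced R.
Hypothesis hm : invariant_multiplicity G R m.

Lemma normalized_ba_data v psi : regular G R v ->
  normalized_baker_akhiezer G logq R [fset a in R | 0 < bil G v a]%fset m psi ->
  exists S c, ba_data G logq R m v S c psi.
Proof.
move=> rv [c [[he hqi] hc hn]].
set A := (polytope _ _ _ `&` _) in he hc.
have fA : finite_set A := coweight_polytope_finite hG hR hm rv.
exists (fset_set A), (fun nu => if nu \in fset_set A then c nu else fun=> 0).
have memA nu : nu \in fset_set A <-> A nu by rewrite in_fset_set // in_setE.
split=> //.
- by move=> nu x /negPf->.
- move=> nu; case: ifPn => [/memA h|_]; [split; exact: hc|exact: ccont_cst].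
- move=> x z; rewrite he fsbig_finite // big_distrr /= big_seq [RHS]big_seq.
  apply: eq_bigr => nu nuA; rewrite nuA EEDl /EE; ring.
- by move=> a x aR s hs z hz; exact: hqi.
- move=> x; rewrite ifT; last first.
    apply/memA; split; first exact: (rho_polytope hG hR hm rv).
    exact: (rho_coweight hG hR hred hm).
  by rewrite -rho_veeE hn /normalization big_positive_roots.
Qed.

End Normalized.

Theorem theorem4p7 (K : realType) (n : nat) (G : 'M[K]_n)
    (R Rp : {fset 'rV[K]_n}) (m mdual : 'rV[K]_n -> nat) (q logq : K[i])
    (psi psidual : 'rV[K[i]]_n -> 'rV[K[i]]_n -> K[i]) :
  scalar_product G ->
  root_system G R -> reduced R -> irreducible_rs G R ->
  positive_roots G R Rp ->
  weyl_invariant G R m ->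
  (forall a, a \in R -> mdual (coroot G a) = m a) ->
  cexp logq = q ->
  (forall k : nat, (0 < k)%N -> q ^+ k != 1) ->
  normalized_baker_akhiezer G logq R Rp m psi ->
  normalized_baker_akhiezer G logq (dual_roots G R) (dual_roots G Rp) mdual psidual ->
  forall x z : 'rV[K[i]]_n, psi x z = psidual z x.
Proof.
move=> hG hR hred _ [v rv ->] /weyl_invariant_multiplicity hm hmd <- hq.
(* The positive system depends only on signs, so its defining vector may be replaced by an integral
   one. *)
have [v' [rv' iv' pos]] := integral_regular hG hR rv.
have <- : [fset a in R | 0 < bil G v' a]%fset = [fset a in R | 0 < bil G v a]%fset.
  by apply/fsetP => a; rewrite !inE /=; case aR: (a \in R); rewrite //= pos.
rewrite (dual_positive hG hR) => bapsi bapsi'.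
have hR' := dual_root_system hG hR; have hm' := dual_invariant hG hR hm hmd.
have [S [c ba]] := normalized_ba_data hG hR hred hm rv' bapsi.
have [S' [c' ba']] := normalized_ba_data hG hR' (dual_reduced hG hR hred) hm' (dual_regular hG hR rv') bapsi'.
exact: (duality hG hq hR hred hm hmd ba iv' ba').
Qed.
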